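(* Let $d\ge3$. For every $\varepsilon>0$ there exists $N_0=N_0(\varepsilon)\in(0,\infty)$ such that for every integer $N\ge N_0$, every $p\in[2\varepsilon,1-2\varepsilon]$ and all $1\le r<R<\infty$, with $A$ the connection event $\{B_r\leftrightarrow\partial B_R\}$, one has $$\mathbb P[\mathcal V(p)\in A]\le \mathbb P[\mathcal V_N(p+\varepsilon)\in A].$$ In particular, $\lim_{N\to\infty}p_c(N)=p_c$.
   Context: Let $\eta$ be a Poisson point process of intensity $1$ on $\mathbb R^d\times[0,1]$. For $p\in[0,1]$ set $\overline\eta_o(p)=\{x:\exists t\in[0,p],\ (x,t)\in\eta\}$, $\overline\eta_c(p)=\{x:\exists t\in(p,1],\ (x,t)\in\eta\}$. Euclidean distance is denoted $d(\cdot,\cdot)$, with $d(y,\emptyset)=\infty$. Voronoi percolation is $\mathcal V(p)=\{y\in\mathbb R^d: d(y,\overline\eta_o(p))\le d(y,\overline\eta_c(p))\}$. Truncated model, for an integer $N\ge1$: for $x\in N\mathbb Z^d$ let $\underline\Lambda_N(x)=x+[0,N)^d$. Set $\overline\eta^N_o(p)=\overline\eta_o(p)$, and define $\overline\eta^N_c(p)$ box by box: $\overline\eta^N_c(p)\cap\underline\Lambda_N(x)$ equals $\overline\eta_c(p)\cap\underline\Lambda_N(x)$ if $|\overline\eta_c(p)\cap\underline\Lambda_N(x)|\le 2N^d$, and equals the whole box $\underline\Lambda_N(x)$ otherwise. Then $\mathcal V_N(p)=\{y\in\mathbb R^d: d(y,\overline\eta^N_o(p))\le\min\{d(y,\overline\eta^N_c(p)),N\}\}$.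 A set percolates if it contains an unbounded connected component; $p_c=\inf\{p:\mathbb P[\mathcal V(p)\text{ percolates}]>0\}$ and $p_c(N)=\inf\{p:\mathbb P[\mathcal V_N(p)\text{ percolates}]>0\}$. $B_r$ is the closed Euclidean ball of radius $r$ centred at $0$; a set $\mathcal V$ belongs to $\{B_r\leftrightarrow\partial B_R\}$ if some connected component of $\mathcal V$ intersects both $B_r$ and $\partial B_R$. *)

(* Defs.v *)
From HB Require Import structures.
From mathcomp Require Import all_boot all_order all_algebra.
From mathcomp Require Import all_classical all_reals all_analysis.
From mathcomp Require Import measurable_realfun.
Set Implicit Arguments.
Unset Strict Implicit.
Unset Printing Implicit Defensive.
Import Order.TTheory GRing.Theory Num.Theory.
Import numFieldNormedType.Exports.
Local Open Scope classical_set_scope.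
Local Open Scope ring_scope.

(* The product sigma-algebra on row vectors, built as the library does for
   [n.-tuple T]; for T = R it is the Borel sigma-algebra of R^n. *)
Definition rV_display : measure_display -> measure_display.
Proof. exact. Qed.

Section measurable_rV.
Context {d} {T : measurableType d}.
Variable n : nat.

Let coors : 'I_n -> 'rV[T]_n -> T := fun i v => v ord0 i.

Let rV_set0 : g_sigma_preimage coors set0.
Proof. exact: sigma_algebra0. Qed.

Let rV_setC A : g_sigma_preimage coors A -> g_sigma_preimage coors (~` A).
Proof. exact: sigma_algebraC. Qed.

Let rV_bigcup (F : (set 'rV[T]_n)^nat) :
  (forall i, g_sigma_preimage coors (F i)) ->
  g_sigma_preimage coors (\bigcup_i (F i)).
Proof. exact: sigma_algebra_bigcup. Qed.

HB.instance Definition _ := @isMeasurable.Build (rV_display d)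
  'rV[T]_n (g_sigma_preimage coors) rV_set0 rV_setC rV_bigcup.

End measurable_rV.

Lemma measurable_rV_coord d (T : measurableType d) n (i : 'I_n) :
  measurable_fun [set: 'rV[T]_n] (fun v : 'rV[T]_n => v ord0 i).
Proof.
move=> _ Y mY; rewrite setTI; apply: sub_sigma_algebra => /=.
rewrite -bigcup_seq/=; exists i => /=; first by rewrite mem_index_enum.
by exists Y => //; rewrite setTI.
Qed.

Lemma measurable_fun_rVP d1 d2 (T1 : measurableType d1)
    (T2 : measurableType d2) n (f : T1 -> 'rV[T2]_n) :
  measurable_fun [set: T1] f <->
  forall i, measurable_fun [set: T1] (fun x => f x ord0 i).
Proof.
split=> [mf i|mf].
  exact: (measurableT_comp (measurable_rV_coord i) mf).
apply: (@measurability _ _ _ _ [set: T1] f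
  (\big[setU/set0]_(i < n) preimage_set_system setT
    (fun v : 'rV[T2]_n => v ord0 i) measurable)) => //.
move=> _ [A + <-]; rewrite -bigcup_seq/= => -[i _ [B mB <-]].
by rewrite [X in _ (_ `&` _ @^-1` X)]setTI; exact: mf.
Qed.

Section lebesgue_rV.
Context {R : realType}.

Definition rV_cons n (z : R * 'rV[R]_n) : 'rV[R]_n.+1 :=
  \row_i oapp (fun j => z.2 ord0 j) z.1 (unlift ord0 i).

Lemma measurable_rV_cons n : measurable_fun [set: R * 'rV[R]_n] (@rV_cons n).
Proof.
apply/measurable_fun_rVP => i; rewrite /rV_cons.
case: (unliftP ord0 i) => [j ->|->].
  apply: (eq_measurable_fun (fun z : R * 'rV[R]_n => z.2 ord0 j)).
    by move=> z _; rewrite mxE liftK.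
  exact: (measurableT_comp (measurable_rV_coord j) measurable_snd).
apply: (eq_measurable_fun (fun z : R * 'rV[R]_n => z.1)).
  by move=> z _; rewrite mxE unlift_none.
exact: measurable_fst.
Qed.

Definition rV_uncons n (v : 'rV[R]_n.+1) : R * 'rV[R]_n :=
  (v ord0 ord0, \row_j v ord0 (lift ord0 j)).

Lemma rV_consK n : cancel (@rV_cons n) (@rV_uncons n).
Proof.
move=> [x v]; rewrite /rV_uncons /rV_cons mxE unlift_none /=; congr pair.
by apply/rowP => j; rewrite !mxE liftK.
Qed.

Lemma measurable_rV_uncons n :
  measurable_fun [set: 'rV[R]_n.+1] (@rV_uncons n).
Proof.
apply: measurable_fun_pair; first exact: measurable_rV_coord.
apply/measurable_fun_rVP => i.
apply: (eq_measurable_fun (fun v : 'rV[R]_n.+1 => v ord0 (lift ord0 i))).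
  by move=> v _; rewrite mxE.
exact: measurable_rV_coord.
Qed.

Section step.
Variables (n : nat) (mu : {sigma_finite_measure set 'rV[R]_n -> \bar R}).

Definition lebesgue_rVS : set 'rV[R]_n.+1 -> \bar R :=
  pushforward ((@lebesgue_measure R) \x mu)%E (@rV_cons n).

Let lebesgue_rVS0 : lebesgue_rVS set0 = 0%E.
Proof. by rewrite /lebesgue_rVS /pushforward preimage_set0 measure0. Qed.

Let lebesgue_rVS_ge0 A : (0 <= lebesgue_rVS A)%E.
Proof. by rewrite /lebesgue_rVS /pushforward; exact: measure_ge0. Qed.

Let lebesgue_rVS_sigma_additive : semi_sigma_additive lebesgue_rVS.
Proof.
move=> F mF tF mUF; rewrite /lebesgue_rVS /pushforward preimage_bigcup.
apply: measure_semi_sigma_additive.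
- by move=> k; rewrite -[X in measurable X]setTI; exact: measurable_rV_cons.
- apply/trivIsetP => /= i j _ _ ij; rewrite -preimage_setI.
  by move/trivIsetP : tF => /(_ _ _ _ _ ij) ->//; rewrite preimage_set0.
- by rewrite -preimage_bigcup -[X in measurable X]setTI;
    exact: measurable_rV_cons.
Qed.

HB.instance Definition _ := isMeasure.Build _ _ _ lebesgue_rVS
  lebesgue_rVS0 lebesgue_rVS_ge0 lebesgue_rVS_sigma_additive.

Let lebesgue_rVS_sigma_finite : sigma_finite setT lebesgue_rVS.
Proof.
have /sigma_finiteP[F [FT ndF Foo]] := sigma_finiteT (@lebesgue_measure R).
have /sigma_finiteP[G [GT ndG Goo]] := sigma_finiteT mu.
exists (fun k => @rV_uncons n @^-1` (F k `*` G k)).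
  apply/seteqP; split=> // v _.
  have [i _ Fi] : (\bigcup_i F i) (rV_uncons v).1 by rewrite -FT.
  have [j _ Gj] : (\bigcup_i G i) (rV_uncons v).2 by rewrite -GT.
  exists (maxn i j) => //; split.
    by move: Fi; exact/subsetPset/ndF/leq_maxl.
  by move: Gj; exact/subsetPset/ndG/leq_maxr.
move=> k; have [mF Fk] := Foo k; have [mG Gk] := Goo k.
have mFG : measurable (F k `*` G k) by exact: measurableX.
split.
  by rewrite -[X in measurable X]setTI; exact: measurable_rV_uncons.
rewrite /lebesgue_rVS /pushforward -comp_preimage.
rewrite (_ : _ \o _ = id); last by apply/funext => z /=; rewrite rV_consK.
by rewrite preimage_id product_measure1E// lte_mul_pinfty// ge0_fin_numE.
Qed.

HB.instance Definition _ := Measure_isSigmaFinite.Build _ _ _ lebesgue_rVS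
  lebesgue_rVS_sigma_finite.

End step.

(* d-dimensional Lebesgue measure, as an iterated product of the
   one-dimensional one. *)
Fixpoint lebesgue_rV n : {sigma_finite_measure set 'rV[R]_n -> \bar R} :=
  match n with
  | 0 => \d_(0 : 'rV[R]_0)
  | n'.+1 => lebesgue_rVS (lebesgue_rV n')
  end.

Lemma lebesgue_rV_box n (A : 'I_n -> set R) : (forall i, measurable (A i)) ->
  lebesgue_rV n [set v | forall i, A i (v ord0 i)] =
  (\prod_(i < n) lebesgue_measure (A i))%E.
Proof.
elim: n A => [A _|n IH A mA] /=.
  by rewrite big_ord0 diracE mem_set//= => -[].
have mB : measurable [set v : 'rV[R]_n | forall i, A (lift ord0 i) (v ord0 i)].
  rewrite (_ : [set _ | _] = \bigcap_(i in [set: 'I_n])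
      ((fun v : 'rV[R]_n => v ord0 i) @^-1` A (lift ord0 i))).
    apply: fin_bigcap_measurable => // i _.
    by rewrite -[X in measurable X]setTI; exact: measurable_rV_coord.
  by apply/seteqP; split=> v /= Av i; [move=> _; exact: Av|exact: Av].
rewrite big_ord_recl -IH// -product_measure1E//; last exact: mA.
rewrite /lebesgue_rVS /pushforward; congr (_ _).
apply/seteqP; split=> -[x v] /=.
  move=> Av; split=> [|i].
    by have := Av ord0; rewrite mxE unlift_none.
  by have := Av (lift ord0 i); rewrite mxE liftK.
move=> [Ax Av] i; rewrite mxE; case: (unliftP ord0 i) => [j ->|->].
- by rewrite /=; exact: Av.
- exact: Ax.
Qed.

End lebesgue_rV.

Section poisson_process.
Context {R : realType} (d : nat).
Context {dT : measure_display} {T : measurableType dT}.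
Local Open Scope ereal_scope.

Definition num_points (E B : set ('rV[R]_d * R)) : \bar R := counting (E `&` B).

(* Poisson point process on D with intensity measure mu, as a random locally
   finite subset of D. *)
Record poisson_process (P : probability T R) (D : set ('rV[R]_d * R))
    (mu : set ('rV[R]_d * R) -> \bar R) (eta : T -> set ('rV[R]_d * R)) :
    Prop := {
  pp_support : forall w, eta w `<=` D ;
  pp_locally_finite : forall w (K : set ('rV[R]_d * R)), compact K ->
    finite_set (eta w `&` K) ;
  pp_measurable : forall B : set ('rV[R]_d * R), measurable B -> B `<=` D ->
    measurable_fun [set: T] (fun w => num_points (eta w) B) ;
  (* the second argument of [poisson_prob] is a dummy one *)
  pp_poisson : forall B : set ('rV[R]_d * R), measurable B -> B `<=` D ->
    mu B < +oo -> forall k : nat,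
    P [set w | num_points (eta w) B = k%:R%:E] =
    poisson_prob (fine (mu B)) k [set k] ;
  pp_independent : forall (n : nat) (B : 'I_n -> set ('rV[R]_d * R)),
    (forall i, measurable (B i)) -> (forall i, B i `<=` D) ->
    trivIset [set: 'I_n] B ->
    forall A : 'I_n -> set (\bar R), (forall i, measurable (A i)) ->
    P [set w | forall i, A i (num_points (eta w) (B i))] =
    \prod_(i < n) P [set w | A i (num_points (eta w) (B i))] }.

End poisson_process.

Section voronoi.
Context {R : realType} {d : nat}.
Implicit Types (E : set ('rV[R]_d * R)) (p : R) (N : nat).
Implicit Types (x y : 'rV[R]_d) (A V : set 'rV[R]_d).

(* The library's norm on 'rV[R]_d is the sup norm, hence the explicit Euclidean
   one. *)
Definition enorm x : R := Num.sqrt (\sum_i x ord0 i ^+ 2).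

(* equal to +oo when A is empty *)
Definition dist_to y A : \bar R := ereal_inf [set (enorm (y - x))%:E | x in A].

Definition open_points E p : set 'rV[R]_d :=
  [set x | exists2 t, t \in `[0, p] & E (x, t)].

Definition closed_points E p : set 'rV[R]_d :=
  [set x | exists2 t, t \in `]p, 1] & E (x, t)].

Definition voronoi E p : set 'rV[R]_d :=
  [set y | (dist_to y (open_points E p) <= dist_to y (closed_points E p))%E].

(* N z + [0, N)^d *)
Definition grid_box N (z : 'rV[int]_d) : set 'rV[R]_d :=
  [set y | forall i, N%:R * (z ord0 i)%:~R <= y ord0 i
                     < N%:R * (z ord0 i)%:~R + N%:R].

Definition trunc_closed_points N E p : set 'rV[R]_d :=
  \bigcup_(z in [set: 'rV[int]_d])
    (let C := closed_points E p `&` grid_box N z in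
     if (C #<= `I_(2 * N ^ d)%N)%card then C else grid_box N z).

Definition trunc_voronoi N E p : set 'rV[R]_d :=
  [set y | (dist_to y (open_points E p) <=
            mine (dist_to y (trunc_closed_points N E p)) N%:R%:E)%E].

Definition closed_eball (r : R) : set 'rV[R]_d := [set x | enorm x <= r].

Definition esphere (r : R) : set 'rV[R]_d := [set x | enorm x = r].

(* V belongs to {B_r <-> partial B_s} *)
Definition connects (r s : R) V : Prop :=
  exists2 x, V x &
    connected_component V x `&` closed_eball r !=set0 /\
    connected_component V x `&` esphere s !=set0.

(* Boundedness for the sup norm is boundedness for the Euclidean one. *)
Definition percolates V : Prop :=
  exists2 x, V x & ~ bounded_set (connected_component V x).

(* Taken in \bar R so that the infimum of the empty set is +oo. *)
Definition critical_point {dT : measure_display} {T : measurableType dT}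
    (P : probability T R) (V : R -> T -> set 'rV[R]_d) : \bar R :=
  ereal_inf [set p%:E | p in
    [set p | 0 <= p <= 1 /\ (0 < P [set w | percolates (V p w)])%E]].

End voronoi.

(* Main.v *)
(* Fix a constant [K], and tile space by macro-cells of side [N / K]. On a mesh
   much finer than the macro-cells, [V(p)] and [V_N(p + eps)] become events of
   independent Bernoulli variables (a cell contains an open, resp. a closed,
   point), and the mesh tends to 0 at the end. Moving a little intensity from
   closed to open in one region at a time turns the first event into the second
   without decreasing its probability.
   - To forbid points of the Voronoi set at distance more than [N] from the
     open points, one macro-cell at a time: a sprinkled point in the macro-cell
     excludes them there, as a closed point before the move and as an open one
     after it, and one can couple so that one of the two is present.
   - To close entirely a box with more than [2 N^d] closed points: such a box
     has probability at most [(e / 4)^(N^d)]. Around the box, and around the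
     sphere of radius [r] near it, there is a wall of at most [K^d / 10]
     macro-cells. If the wall has no open point, but a closed point in each
     macro-cell, then the connection does not see the box; hence opening points
     in the wall gains a factor of order [e^(- N^d / 10)], which for large [N]
     is more than what closing the box costs.
   Since [V_N] is contained in [V], the critical points converge as soon as
   [V_N(1)], a Boolean model of radius [N], percolates for [N] large. This is a
   renormalisation in a plane: a block is good if at most one of its 3 x 3
   sub-blocks is not, and a bad block of level [n] contains one of at most
   [81^(2^n)] sets of [2^n] vacant cells. *)

Require Import Defs.
From HB Require Import structures.
From mathcomp Require Import all_boot all_order all_algebra.
From mathcomp Require Import all_classical all_reals all_analysis.
From mathcomp Require Import measurable_realfun.
From mathcomp Require Import ring lra zify.
Import Order.TTheory GRing.Theory Num.Theory.
Import numFieldNormedType.Exports.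
Local Open Scope classical_set_scope.
Local Open Scope ring_scope.
Set Implicit Arguments.
Unset Strict Implicit.
Unset Printing Implicit Defensive.

(** * Bernoulli configurations *)

(** The wall must include the sphere of radius [r] because the two radii may be much closer to each
    other than [N]: a connecting component could lie entirely inside a wall around the box, and
    closing the box could destroy it. Such a component crosses the sphere of radius [r], so walling
    the sphere too excludes it. [K] is fixed before [N] since two requirements pull apart: the wall
    may fill only a small fraction of the volume of a box, as opening it must cost less than (4 /
    e)^(N^d), while each of its macro-cells, of volume (N / K)^d, must receive a sprinkled closed
    point with probability close to 1; the latter is left to large [N]. Discretisation errors are
    one-sided: both discrete sets are relaxed by a slack [kap] of the order of the mesh, so each
    discrete event contains the continuum one. In the limit nothing is lost: the discrete truncated
    sets shrink into V_N, and connections survive decreasing limits of compact sets. *)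

Section bernoulli.
Context {R : realType} {I : finType}.
Implicit Types (t u : I -> R) (s : seq I) (f g : {set I} -> R) (A B : {set I}).

(** Mean of [f] over a random subset of [s] containing each [i] independently with probability 1 -
    e^(- t i), as for the occupancy of cells by Poisson points. Rates are preferred to probabilities
    because they add up under superposition. *)
Fixpoint Ex t s f : R :=
  if s is i :: s' then
    expR (- t i) * Ex t s' f +
    (1 - expR (- t i)) * Ex t s' (fun A => f (i |: A)%SET)
  else f finset.set0.

Let q01 t i : (forall i, 0 <= t i) -> 0 <= expR (- t i) <= 1.
Proof. by move=> t0; rewrite expR_ge0 -expR0 ler_expR oppr_le0 t0. Qed.

Lemma Ex_cst t s (c : R) : Ex t s (fun=> c) = c.
Proof. by elim: s => //= i s ->; rewrite -mulrDl addrC subrK mul1r. Qed.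

Lemma eq_Ex t s f g : f =1 g -> Ex t s f = Ex t s g.
Proof. by move=> fg; congr (Ex t s _); apply/funext. Qed.

Lemma ExD t s f g : Ex t s (fun A => f A + g A) = Ex t s f + Ex t s g.
Proof. by elim: s f g => //= i s IH f g; rewrite !IH; ring. Qed.

Lemma ExZ t s (c : R) f : Ex t s (fun A => c * f A) = c * Ex t s f.
Proof. by elim: s f => //= i s IH f; rewrite !IH; ring. Qed.

Lemma ExN t s f : Ex t s (fun A => - f A) = - Ex t s f.
Proof.
by under eq_Ex do rewrite -mulN1r; rewrite ExZ mulN1r.
Qed.

Lemma Ex_le t s f g : (forall i, 0 <= t i) ->
  (forall A, A \subset [set i in s | t i != 0]%SET -> f A <= g A) ->
  Ex t s f <= Ex t s g.
Proof.
move=> t0; elim: s f g => [|i s IH] f g fg /=; first by apply: fg; apply: finset.sub0set.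
have /andP[q0 q1] := q01 i t0.
have sub A : A \subset [set j in s | t j != 0]%SET -> A \subset [set j in i :: s | t j != 0]%SET.
  move=> /fintype.subsetP As; apply/fintype.subsetP => j /As.
  by rewrite !finset.inE => /andP[-> ->]; rewrite orbT.
apply: lerD; first by apply: ler_wpM2l => //; apply: IH => A /sub; exact: fg.
have [ti0|ti0] := eqVneq (t i) 0.
  by rewrite ti0 oppr0 expR0 subrr !mul0r.
apply: ler_wpM2l; first by rewrite subr_ge0.
apply: IH => A As; apply: fg; rewrite finset.subUset (sub _ As) andbT finset.sub1set.
by rewrite !finset.inE eqxx ti0.
Qed.

Lemma Ex_ge0 t s f : (forall i, 0 <= t i) -> (forall A, 0 <= f A) ->
  0 <= Ex t s f.
Proof. by move=> t0 f0; rewrite -(Ex_cst t s 0); apply: Ex_le. Qed.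

Lemma Ex_exchange t s u s' (f : {set I} -> {set I} -> R) :
  Ex t s (fun A => Ex u s' (f A)) = Ex u s' (fun B => Ex t s (f^~ B)).
Proof.
elim: s f => //= i s IH f.
by rewrite !IH ExD !ExZ.
Qed.

(** In the union of two independent configurations a site is vacant with probability e^(-t) e^(-u).
    All sprinkling below rests on this identity. *)
Lemma Ex_conv t u s f :
  Ex (fun i => t i + u i) s f = Ex t s (fun A => Ex u s (fun B => f (A :|: B)%SET)).
Proof.
elim: s f => [|i s IH] f /=; first by rewrite finset.setU0.
rewrite !IH opprD expRD.
set e1 := expR _; set e2 := expR _.
rewrite !ExD !ExZ.
have E1 : Ex t s (fun A => Ex u s (fun B => f (A :|: (i |: B))%SET)) =
          Ex t s (fun A => Ex u s (fun B => f (i |: (A :|: B))%SET)).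
  by apply: eq_Ex => A; apply: eq_Ex => B; rewrite finset.setUCA.
have E2 : Ex t s (fun A => Ex u s (fun B => f ((i |: A) :|: B)%SET)) =
          Ex t s (fun A => Ex u s (fun B => f (i |: (A :|: B))%SET)).
  by apply: eq_Ex => A; apply: eq_Ex => B; rewrite finset.setUA.
have E3 : Ex t s (fun A => Ex u s (fun B => f ((i |: A) :|: (i |: B))%SET)) =
          Ex t s (fun A => Ex u s (fun B => f (i |: (A :|: B))%SET)).
  by apply: eq_Ex => A; apply: eq_Ex => B; rewrite -finset.setUUr.
rewrite E1 E2 E3; ring.
Qed.

Definition setincr f := forall A B, A \subset B -> f A <= f B.
Definition setdecr f := forall A B, A \subset B -> f B <= f A.

Lemma setdecrU f i : setdecr f -> setdecr (fun A => f (i |: A)%SET).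
Proof. by move=> df A B AB; apply: df; exact: finset.setUS. Qed.

Lemma Ex_incr_rate t u s f : (forall i, 0 <= t i <= u i) -> setincr f ->
  Ex t s f <= Ex u s f.
Proof.
move=> tu f_incr.
have -> : u = (fun i => t i + (u i - t i)) by apply/funext => i; ring.
rewrite Ex_conv; apply: Ex_le => [i|A _]; first by case/andP: (tu i).
rewrite -[leLHS](Ex_cst (fun i => u i - t i) s).
apply: Ex_le => [i|B _]; first by rewrite subr_ge0; case/andP: (tu i).
exact/f_incr/finset.subsetUl.
Qed.

Lemma Ex_decr_rate t u s f : (forall i, 0 <= t i <= u i) -> setdecr f ->
  Ex u s f <= Ex t s f.
Proof.
move=> tu df; rewrite -lerN2 -!ExN; apply: Ex_incr_rate => // A B AB.
by rewrite lerN2 df.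
Qed.

(** Harris inequality. Conditioning on one site reduces it to Chebyshev's inequality on two points,
    whose excess is q (1 - q) (F0 - F1) (G0 - G1). *)
Lemma Ex_harris t s f g : (forall i, 0 <= t i) -> setdecr f -> setdecr g ->
  Ex t s f * Ex t s g <= Ex t s (fun A => f A * g A).
Proof.
move=> t0; elim: s f g => //= i s IH f g df dg.
have /andP[q0 q1] := q01 i t0.
have h0 := IH _ _ df dg; have h1 := IH _ _ (setdecrU i df) (setdecrU i dg).
have hF : Ex t s (fun A => f (i |: A)%SET) <= Ex t s f.
  by apply: Ex_le => // A _; exact/df/finset.subsetUr.
have hG : Ex t s (fun A => g (i |: A)%SET) <= Ex t s g.
  by apply: Ex_le => // A _; exact/dg/finset.subsetUr.
set F0 := Ex t s f in h0 hF *; set G0 := Ex t s g in h0 hG *.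
set F1 := Ex t s _ in h1 hF *; set G1 := Ex t s _ in h1 hG *.
set H0 := Ex t s _ in h0 *; set H1 := Ex t s _ in h1 *.
move: (expR _) q0 q1 => q q0 q1.
apply: (@le_trans _ _ (q * (F0 * G0) + (1 - q) * (F1 * G1))); last first.
  by apply: lerD; apply: ler_wpM2l => //; rewrite subr_ge0.
rewrite -subr_ge0.
have -> : q * (F0 * G0) + (1 - q) * (F1 * G1) -
  (q * F0 + (1 - q) * F1) * (q * G0 + (1 - q) * G1) =
  (q * (1 - q)) * ((F0 - F1) * (G0 - G1)) by ring.
by rewrite !mulr_ge0 ?subr_ge0.
Qed.

(** Quantitative monotonicity in the rates, by induction on the sites. If the first site is absent,
    the induction hypothesis supplies the gain; if it is present, only plain monotonicity is used.
    The missing gain is covered by [th]: under [t] the site is present less often than under [u], by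
    this factor at least. *)
Lemma Ex_gain t u s f (th : R) : (forall i, 0 <= t i <= u i) ->
  0 <= th <= 1 ->
  (forall i, i \in s -> 1 - expR (- t i) <= th * (1 - expR (- u i))) ->
  setincr f -> f finset.set0 = 0 ->
  Ex t s f <= (1 - (1 - th) * expR (- \sum_(i <- s) t i)) * Ex u s f.
Proof.
move=> tu /andP[th0 th1]; have t0 i : 0 <= t i by case/andP: (tu i).
have u0 i : 0 <= u i by have /andP[a b] := tu i; exact: le_trans a b.
elim: s f => [|i s IH] f hth df f0 /=; first by rewrite f0 mulr0.
have {}IH f' (df' : setincr f') (f'0 : f' finset.set0 = 0) :
    Ex t s f' <= (1 - (1 - th) * expR (- \sum_(i <- s) t i)) * Ex u s f'.
  by apply: IH => // j js; apply: hth; rewrite inE js orbT.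
rewrite big_cons opprD expRD.
have /andP[q0 q1] := q01 i t0; have /andP[r0 r1] := q01 i u0.
have qr : expR (- u i) <= expR (- t i) by rewrite ler_expR lerN2; case/andP: (tu i).
have hth_i := hth i (mem_head _ _).
have S0 : 0 <= \sum_(j <- s) t j by rewrite sumr_ge0.
set P := expR (- \sum_(j <- s) t j) in IH *.
have P0 : 0 <= P by exact: expR_ge0.
have P1 : P <= 1 by rewrite /P -expR0 ler_expR oppr_le0.
have A0 : 0 <= Ex u s f.
  by apply: Ex_ge0 => // A; rewrite -f0; exact/df/finset.sub0set.
(* Subtracting [g1] makes the shifted function vanish at the empty set, as the induction hypothesis
   demands. *)
set g1 := f [set i]%SET.
have h1 : Ex t s (fun A => f (i |: A)%SET) - g1 <=
   (1 - (1 - th) * P) * (Ex u s (fun A => f (i |: A)%SET) - g1).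
  have := IH (fun A => f (i |: A)%SET - g1); rewrite !ExD !Ex_cst; apply.
    by move=> A B AB; rewrite lerB// df// finset.setUS.
  by rewrite finset.setU0 subrr.
have h0 := IH _ df f0.
have gB : g1 <= Ex u s (fun A => f (i |: A)%SET).
  by rewrite -{1}(Ex_cst u s g1); apply: Ex_le => // A _; exact/df/finset.subsetUl.
have AB : Ex u s f <= Ex u s (fun A => f (i |: A)%SET).
  by apply: Ex_le => // A _; exact/df/finset.subsetUr.
have g10 : 0 <= g1 by rewrite -f0; exact/df/finset.sub0set.
set A := Ex u s f in A0 h0 AB *; set At := Ex t s f in h0 *.
set B := Ex u s _ in h1 gB AB *; set Bt := Ex t s _ in h1 *.
move: (expR (- t i)) (expR (- u i)) q0 q1 r0 r1 qr hth_i => q r q0 q1 r0 r1 qr hi.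
set c := (1 - th) * P in h1 h0 *.
have c0 : 0 <= c by rewrite mulr_ge0// subr_ge0.
have c1 : c <= 1 by rewrite /c; apply: mulr_ile1 => //; lra.
have hB : Bt <= B.
  have : (1 - c) * (B - g1) <= B - g1 by apply: ler_piMl; lra.
  lra.
apply: (@le_trans _ _ (q * ((1 - c) * A) + (1 - q) * B)).
  by apply: lerD; apply: ler_wpM2l => //; rewrite subr_ge0.
have -> : (1 - th) * (q * P) = q * c by rewrite /c; ring.
(* the difference is linear in (A, B) on the cone 0 <= A <= B *)
rewrite -subr_ge0.
have -> : (1 - q * c) * (r * A + (1 - r) * B) - (q * ((1 - c) * A) + (1 - q) * B) =
  ((1 - q * c) * (1 - r) - (1 - q)) * (B - A) by rewrite /c; ring.
rewrite mulr_ge0 ?subr_ge0//.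
have qc : q * c <= 1 - th.
  rewrite /c mulrCA -[leRHS]mulr1; apply: ler_wpM2l; first by rewrite subr_ge0.
  by rewrite mulr_ile1.
apply: le_trans hi _; apply: ler_wpM2r; first by rewrite subr_ge0.
lra.
Qed.

End bernoulli.

Local Notation disj A C := (fintype.disjoint (mem A) (mem C)).

(** * Moving intensity from closed to open sites *)

Section bernoulli_events.
Context {R : realType} {I : finType}.
Implicit Types (t u : I -> R) (s : seq I) (f g : {set I} -> R) (A B C : {set I}).

Lemma sumr_mem B : \sum_(i <- index_enum I) (i \in B)%:R = #|B|%:R :> R.
Proof.
rewrite -natr_sum -sum1_card [in RHS]big_mkcond; congr _%:R.
Qed.

Lemma disjointsU1 (i : I) A C :
  disj (i |: A)%SET C = (i \notin C) && disj A C.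
Proof.
by rewrite -!finset.setI_eq0 finset.setIUl finset.setU_eq0 !finset.setI_eq0 finset.disjoints1.
Qed.

Lemma Ex_disjoint t s C :
  Ex t s (fun A => (disj A C)%:R) = expR (- \sum_(i <- s | i \in C) t i).
Proof.
elim: s => [|i s IH] /=.
  by rewrite big_nil oppr0 expR0 finset.disjoints_subset finset.sub0set.
rewrite big_cons IH; case: ifP => iC; last first.
  rewrite (_ : (fun A => (disj (i |: A)%SET C)%:R) = (fun A => (disj A C)%:R : R)).
    by rewrite IH -mulrDl addrC subrK mul1r.
  by apply/funext => A; rewrite disjointsU1 iC.
rewrite (_ : (fun A => (disj (i |: A)%SET C)%:R) = (fun=> 0)).
  by rewrite Ex_cst mulr0 addr0 opprD expRD.
by apply/funext => A; rewrite disjointsU1 iC.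
Qed.

(** Union bound over the sets that the configuration misses. *)
Lemma Ex_hit t s (Cs : seq {set I}) : (forall i, 0 <= t i) ->
  1 - \sum_(C <- Cs) expR (- \sum_(i <- s | i \in C) t i) <=
  Ex t s (fun A => (all (fun C => ~~ (disj A C)) Cs)%:R).
Proof.
move=> t0; elim: Cs => [|C Cs IH] /=; first by rewrite big_nil subr0 Ex_cst.
rewrite big_cons -Ex_disjoint.
suff : Ex t s (fun A => (all (fun C => ~~ disj A C) Cs)%:R) <=
    Ex t s (fun A => (disj A C)%:R) +
    Ex t s (fun A => (~~ disj A C && all (fun C => ~~ disj A C) Cs)%:R) by lra.
rewrite -ExD; apply: Ex_le => // A _.
by case: (disj A C) => /=; case: (all _ _); rewrite ?addr0 ?add0r ?lexx ?ler01.
Qed.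

(** Exponential Markov inequality with weight 2 per site. For a mean of at most N^d and [m] equal to
    2 N^d it gives (e / 4)^(N^d). *)
Lemma Ex_card t s (m : nat) : (forall i, 0 <= t i) ->
  Ex t s (fun A => (m < #|A|)%N%:R) <= expR (\sum_(i <- s) t i) / 2 ^+ m.
Proof.
move=> t0.
have H : Ex t s (fun A => 2 ^+ #|A|) <= expR (\sum_(i <- s) t i).
  elim: s => [|i s IH] /=; first by rewrite big_nil finset.cards0 expr0 expR0.
  have q1 : expR (- t i) <= 1 by rewrite -expR0 ler_expR oppr_le0.
  rewrite big_cons expRD.
  apply: (@le_trans _ _ ((1 + t i) * expR (\sum_(j <- s) t j))); last first.
    by apply: ler_wpM2r; rewrite ?expR_ge0// expR_ge1Dx.
  apply: (@le_trans _ _ ((1 + (1 - expR (- t i))) * Ex t s (fun A => 2 ^+ #|A|))).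
    have -> : (1 + (1 - expR (- t i))) * Ex t s (fun A => 2 ^+ #|A|) =
      expR (- t i) * Ex t s (fun A => 2 ^+ #|A|) +
      (1 - expR (- t i)) * Ex t s (fun A => 2 * 2 ^+ #|A|) by rewrite ExZ; ring.
    rewrite lerD2l; apply: ler_wpM2l; first by rewrite subr_ge0.
    apply: Ex_le => // A _; rewrite -exprS ler_eXn2l ?ltr1n//.
    by rewrite finset.cardsU1; case: (_ \notin _) => //=; rewrite ltnW.
  have h1 := expR_ge1Dx (- t i).
  have E0 : 0 <= Ex t s (fun A => 2 ^+ #|A|).
    by apply: Ex_ge0 => // A; rewrite exprn_ge0.
  apply: ler_pM => //; [lra|lra].
rewrite ler_pdivlMr ?exprn_gt0// mulrC -ExZ.
apply: le_trans H; apply: Ex_le => // A _.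
case: ltnP => mA /=; last by rewrite mulr0 exprn_ge0.
by rewrite mulr1 ler_eXn2l ?ltr1n// ltnW.
Qed.

Lemma ExB t s f g : Ex t s (fun A => f A - g A) = Ex t s f - Ex t s g.
Proof. by rewrite ExD ExN. Qed.

(* [u] is evaluated on the old sprinkles and [w] on the new ones: both can be
   coupled so as never to be empty simultaneously. *)
Lemma Ex_swap t s (u w : {set I} -> bool) : (forall i, 0 <= t i) ->
  expR (- \sum_(i <- s) t i) <= 2^-1 ->
  (forall A B, A \subset [set i in s | t i != 0]%SET -> B \subset [set i in s | t i != 0]%SET ->
     (A != finset.set0) || (B != finset.set0) -> u A -> w B) ->
  Ex t s (fun A => (u A)%:R) <= Ex t s (fun B => (w B)%:R).
Proof.
move=> t0 e2 uw; set S := [set i in s | t i != 0]%SET in uw.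
have Ee : Ex t s (fun A => (A == finset.set0)%:R) = expR (- \sum_(i <- s) t i).
  transitivity (Ex t s (fun A => (disj A [set: I]%SET)%:R)).
    by apply: eq_Ex => A; rewrite finset.disjoints_subset finset.setCT finset.subset0.
  by rewrite Ex_disjoint; congr expR; congr (- _); apply: eq_bigl => i; rewrite inE.
(* Three cases replace the coupling. If [w] fails on a nonempty set, [u] never holds; if [w] always
   holds, nothing is left to prove; if it fails on the empty set only, [u] can hold only there, and
   the empty set has probability at most 1/2. *)
have [wall|] := pselect (forall B, B \subset S -> B != finset.set0 -> w B); last first.
  move=> /existsNP[B /not_implyP[BS /not_implyP[B0 wB]]].
  apply: (@le_trans _ _ 0); last by apply: Ex_ge0.
  rewrite -(Ex_cst t s 0); apply: Ex_le => // A AS.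
  have [uA|//] := boolP (u A); exfalso; apply: wB; apply: (uw A B) => //.
  by rewrite B0 orbT.
have [w0|w0] := boolP (w finset.set0).
  apply: Ex_le => // A AS; have -> : w A.
    by have [->//|A0] := eqVneq A finset.set0; apply: wall.
  by case: (u A).
apply: (@le_trans _ _ (Ex t s (fun A => (A == finset.set0)%:R))).
  apply: Ex_le => // A AS; have [->|A0] := eqVneq A finset.set0; first by case: (u _).
  have [uA|//] := boolP (u A); exfalso; move/negP: w0; apply.
  by apply: (uw A) => //; rewrite ?finset.sub0set// A0.
apply: (@le_trans _ _ (Ex t s (fun A => 1 - (A == finset.set0)%:R))).
  rewrite ExB Ex_cst Ee; lra.
apply: Ex_le => // A AS; have [->|A0] := eqVneq A finset.set0; first by rewrite subrr.
by rewrite wall// subr0.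
Qed.

(** Open sites [a] and closed sites [b] come from a Poisson process of intensity 1 in cells of
    volume [v], each point being open with a probability [lam] that may vary from cell to cell. *)
Definition Epair (v : R) (lam : I -> R) (F : {set I} -> {set I} -> bool) : R :=
  Ex (fun i => v * lam i) (index_enum I) (fun a =>
    Ex (fun i => v * (1 - lam i)) (index_enum I) (fun b => (F a b)%:R)).

Definition mono_event (F : {set I} -> {set I} -> bool) :=
  forall a a' b b' : {set I}, a \subset a' -> b' \subset b -> F a b -> F a' b'.

Lemma Epair_le (v : R) (lam lam' : I -> R) F : 0 <= v ->
  (forall i, 0 <= lam i <= lam' i) -> (forall i, lam' i <= 1) ->
  mono_event F -> Epair v lam F <= Epair v lam' F.
Proof.
move=> v0 ll l1 mF.
have l0 i : 0 <= lam i by case/andP: (ll i).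
have l'0 i : 0 <= lam' i by have /andP[a b] := ll i; exact: le_trans a b.
apply: (@le_trans _ _ (Ex (fun i => v * lam i) (index_enum I) (fun a =>
    Ex (fun i => v * (1 - lam' i)) (index_enum I) (fun b => (F a b)%:R)))).
  apply: Ex_le => [i|A _]; first by rewrite mulr_ge0.
  apply: Ex_decr_rate => [i|B B' BB].
    have /andP[a b] := ll i.
    by rewrite mulr_ge0 ?subr_ge0//= ler_wpM2l// lerB.
  by rewrite ler_nat; have := mF _ _ _ _ (fintype.subxx A) BB; do 2 case: (F _ _) => //; move=> /(_ isT).
apply: Ex_incr_rate => [i|A A' AA].
  by have /andP[a b] := ll i; rewrite mulr_ge0//= ler_wpM2l.
apply: Ex_le => [i|B _]; first by rewrite mulr_ge0 ?subr_ge0.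
by rewrite ler_nat; have := mF _ _ _ _ AA (fintype.subxx B); do 2 case: (F _ _) => //; move=> /(_ isT).
Qed.

Lemma Ex_split t s (P : pred I) f :
  Ex t s f = Ex (fun i => t i * (~~ P i)%:R) s (fun A => Ex (fun i => t i * (P i)%:R) s (fun B => f (A :|: B)%SET)).
Proof.
rewrite -Ex_conv; congr (Ex _ s f); apply/funext => i.
by case: (P i) => /=; rewrite ?mulr1 ?mulr0 ?addr0 ?add0r.
Qed.

Definition bump (lam : I -> R) (e : R) (B : {set I}) i := lam i + e * (i \in B)%:R.

(** The rate v e that the closed sites of [B] lose is the old sprinkle [s'], and the rate that the
    open sites gain is the new sprinkle [s]. With everything else frozen, [Ex_swap] compares
    them. *)
Lemma void_step (v : R) (lam : I -> R) (e : R) (B : {set I}) (Fo Fn : {set I} -> {set I} -> bool) :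
  0 <= v -> 0 <= e -> (forall i, 0 <= lam i) -> (forall i, bump lam e B i <= 1) ->
  expR (- (v * e * #|B|%:R)) <= 2^-1 ->
  (forall a b s s' : {set I}, s \subset B -> s' \subset B ->
    (s' != finset.set0) || (s != finset.set0) ->
    Fo a (b :|: s')%SET -> Fn (a :|: s)%SET b) ->
  Epair v lam Fo <= Epair v (bump lam e B) Fn.
Proof.
move=> v0 e0 l0 l1 eB FF; rewrite /Epair.
have -> : (fun i => v * (1 - lam i)) =
  (fun i => v * (1 - bump lam e B i) + v * e * (i \in B)%:R).
  by apply/funext => i; rewrite /bump; ring.
have -> : (fun i => v * bump lam e B i) = (fun i => v * lam i + v * e * (i \in B)%:R).
  by apply/funext => i; rewrite /bump; ring.
rewrite Ex_conv; apply: Ex_le => [i|a _]; first by rewrite mulr_ge0.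
rewrite Ex_exchange Ex_conv; apply: Ex_le => [i|b _]; first by rewrite mulr_ge0 ?subr_ge0.
have sB A : A \subset [set i in index_enum I | v * e * (i \in B)%:R != 0]%SET -> A \subset B.
  move=> /fintype.subset_trans; apply; apply/fintype.subsetP => i.
  by rewrite inE; case: (i \in B) => //; rewrite mulr0 eqxx andbF.
apply: Ex_swap => [i||A A' /sB AB /sB A'B AA]; first by rewrite !mulr_ge0.
  apply: le_trans eB; rewrite ler_expR lerN2 -mulr_sumr ler_wpM2l ?mulr_ge0//.
  by rewrite sumr_mem.
exact: FF.
Qed.

(** [B] is the wall, [L] the box, and [Fb] the old event with the box closed. Freeze the open sites
    off the wall and the closed sites off the box. Either [Fb] holds, and then so does [Fn]; or [Fo]
    needs an open site in the wall whenever the closed sprinkle satisfies [H]. In the second case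
    [Ex_gain] wins a factor that pays for the event that the box contains more than [m] closed
    sites. *)
Lemma trunc_step (v : R) (lam : I -> R) (e th : R) (B L : {set I}) (m : nat)
    (H : pred {set I}) (Fo Fn Fb : {set I} -> {set I} -> bool) :
  0 <= v -> 0 <= e -> (forall i, 0 <= lam i) -> (forall i, bump lam e B i <= 1) ->
  0 <= th <= 1 ->
  (forall i, i \in B -> 1 - expR (- (v * lam i)) <= th * (1 - expR (- (v * (lam i + e))))) ->
  2^-1 <= Ex (fun i => v * e * (i \in B)%:R) (index_enum I) (fun A => (H A)%:R) ->
  expR (v * #|L|%:R) / 2 ^+ m <= 2^-1 * ((1 - th) * expR (- (v * #|B|%:R))) ->
  mono_event Fo -> mono_event Fb ->
  (forall a b c : {set I}, c \subset L -> Fb a b -> Fb a (b :|: c)%SET) ->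
  (forall a b : {set I}, Fb a b -> Fn a b) ->
  (forall a b : {set I}, (#|b :&: L|%SET <= m)%N -> Fo a b -> Fn a b) ->
  (forall a b s : {set I}, disj a B -> H s -> s \subset B ->
     Fo a (b :|: s)%SET -> Fb a (b :|: s)%SET) ->
  Epair v lam Fo <= Epair v (bump lam e B) Fn.
Proof.
move=> v0 e0 l0 l1 th01 hth hH beta mFo mFb FbL Fbn Fon FoW; rewrite /Epair.
set lam' := bump lam e B.
have l'0 i : 0 <= lam' i by rewrite /lam' /bump addr_ge0// mulr_ge0.
have -> : (fun i => v * (1 - lam i)) =
  (fun i => v * (1 - lam' i) + v * e * (i \in B)%:R).
  by apply/funext => i; rewrite /lam' /bump; ring.
set tL := fun i => v * (1 - lam' i).
have tL0 i : 0 <= tL i by rewrite /tL mulr_ge0 ?subr_ge0// l1.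
rewrite (Ex_split (fun i => v * lam i) _ (mem B)) (Ex_split (fun i => v * lam' i) _ (mem B)).
have -> : (fun i => v * lam' i * (~~ mem B i)%:R) = (fun i => v * lam i * (~~ mem B i)%:R).
  by apply/funext => i; rewrite /lam' /bump inE; case: (i \in B); rewrite /= ?mulr0// addr0.
set tB := fun i => v * lam i * (mem B i)%:R; set tB' := fun i => v * lam' i * (mem B i)%:R.
have tB0 i : 0 <= tB i by rewrite /tB !mulr_ge0.
have tB'0 i : 0 <= tB' i by rewrite /tB' !mulr_ge0.
have le_b i : tB i <= tB' i.
  by rewrite /tB /tB' ler_wpM2r// ler_wpM2l// /lam' /bump lerDl mulr_ge0.
apply: Ex_le => [i|aO aOB]; first by rewrite !mulr_ge0.
have {}aOB : (disj aO B).
  rewrite finset.disjoints_subset; apply: (fintype.subset_trans aOB).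
  apply/fintype.subsetP => i; rewrite !inE /=.
  by case: (i \in B) => //=; rewrite mulr0 eqxx andbF.
under eq_Ex do rewrite Ex_conv (Ex_split tL _ (mem L)).
rewrite Ex_exchange.
under [leRHS]eq_Ex do rewrite (Ex_split tL _ (mem L)).
rewrite [leRHS]Ex_exchange.
apply: Ex_le => [i|bO bOL]; first by rewrite mulr_ge0.
have {}bOL : (bO :&: L)%SET = finset.set0.
  apply/eqP; rewrite finset.setI_eq0 finset.disjoints_subset; apply: (fintype.subset_trans bOL).
  apply/fintype.subsetP => i; rewrite !inE /=.
  by case: (i \in L) => //=; rewrite mulr0 eqxx andbF.
set tLL := fun i => tL i * (mem L i)%:R.
have tLL0 i : 0 <= tLL i by rewrite /tLL mulr_ge0.
have sL A : A \subset [set i in index_enum I | tLL i != 0]%SET -> A \subset L.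
  move=> /fintype.subset_trans; apply; apply/fintype.subsetP => i.
  by rewrite inE /tLL inE; case: (i \in L) => //; rewrite mulr0 eqxx andbF.
(* If the event with the box closed holds without open sites in the wall, neither these nor closed
   sites of the box can spoil it: [Fn] is certain. *)
have [m1|m0] := boolP (Fb aO bO).
  apply: (@le_trans _ _ 1).
    rewrite -[leRHS](Ex_cst tB (index_enum I)); apply: Ex_le => // aB _.
    rewrite -[leRHS](Ex_cst tLL (index_enum I)); apply: Ex_le => // bL _.
    rewrite -[leRHS](Ex_cst (fun i => v * e * (i \in B)%:R) (index_enum I)).
    apply: Ex_le => [i|s _]; first by rewrite !mulr_ge0.
    by case: (Fo _ _).
  rewrite -[leLHS](Ex_cst tB' (index_enum I)); apply: Ex_le => // aB _.
  rewrite -[leLHS](Ex_cst tLL (index_enum I)); apply: Ex_le => // bL /sL bLL.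
  rewrite Fbn//; apply: (mFb aO _ (bO :|: bL)%SET) => //.
    exact: finset.subsetUl.
  exact: FbL.
set ts := fun i => v * e * (i \in B)%:R.
have ts0 i : 0 <= ts i by rewrite /ts !mulr_ge0.
pose G bL := Ex tB' (index_enum I) (fun aB => (Fo (aO :|: aB)%SET (bO :|: bL)%SET)%:R : R).
have dG : setdecr G.
  move=> b b' bb; apply: Ex_le => // A _; rewrite ler_nat.
  have := mFo (aO :|: A)%SET (aO :|: A)%SET (bO :|: b')%SET (bO :|: b)%SET (fintype.subxx _) (finset.setUS bO bb).
  by do 2 case: (Fo _ _) => //; move=> /(_ isT).
have G0 b : 0 <= G b by apply: Ex_ge0.
set c := (1 - th) * expR (- (v * #|B|%:R)) in beta.
have /andP[th0 th1] := th01.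
have c0 : 0 <= c by rewrite /c mulr_ge0 ?subr_ge0// expR_ge0.
have vB : 0 <= v * #|B|%:R by rewrite mulr_ge0.
have c1 : c <= 1.
  have P0 := expR_ge0 (- (v * #|B|%:R)).
  have P1 : expR (- (v * #|B|%:R)) <= 1 by rewrite -[leRHS]expR0 ler_expR oppr_le0.
  by rewrite /c; apply: mulr_ile1 => //; lra.
have cle : c <= (1 - th) * expR (- \sum_i tB i).
  rewrite /c ler_wpM2l ?subr_ge0// ler_expR lerN2.
  apply: (@le_trans _ _ (\sum_i v * (i \in B)%:R)); last first.
    by rewrite -mulr_sumr sumr_mem.
  apply: ler_sum => i _; rewrite /tB inE ler_wpM2r// ler_piMr//.
  by apply: le_trans (l1 i); rewrite /bump lerDl mulr_ge0.
rewrite Ex_exchange.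
under eq_Ex do rewrite Ex_exchange.
(* The gain [c] is available when the sprinkle satisfies [H], which has probability at least 1/2. *)
apply: (@le_trans _ _ (Ex tLL (index_enum I) (fun bL => (1 - c / 2) * G bL))).
  apply: Ex_le => // bL bLL.
  apply: (@le_trans _ _ (Ex ts (index_enum I) (fun s : {set I} => (1 - c * (H s)%:R) * G bL))).
    apply: Ex_le => // s sB.
    have {}sB : s \subset B.
      apply: (fintype.subset_trans sB); apply/fintype.subsetP => i.
      by rewrite inE /ts; case: (i \in B) => //; rewrite mulr0 eqxx andbF.
    apply: (@le_trans _ _ ((1 - c * (H s)%:R) * Ex tB' (index_enum I)
       (fun aB => (Fo (aO :|: aB)%SET (bO :|: bL :|: s)%SET)%:R))); last first.
      apply: ler_wpM2l.
        by case: (H s); rewrite /= ?mulr1 ?mulr0 subr_ge0.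
      apply: Ex_le => // aB _; rewrite ler_nat.
      have := mFo (aO :|: aB)%SET (aO :|: aB)%SET (bO :|: bL :|: s)%SET (bO :|: bL)%SET (fintype.subxx _) (finset.subsetUl _ _).
      by do 2 case: (Fo _ _) => //; move=> /(_ isT).
    have iF : setincr (fun aB => (Fo (aO :|: aB)%SET (bO :|: bL :|: s)%SET)%:R : R).
      move=> A A' AA; rewrite ler_nat.
      have := mFo (aO :|: A)%SET (aO :|: A')%SET (bO :|: bL :|: s)%SET (bO :|: bL :|: s)%SET (finset.setUS _ AA) (fintype.subxx _).
      by do 2 case: (Fo _ _) => //; move=> /(_ isT).
    have [Hs|Hs] /= := boolP (H s); last first.
      by rewrite mulr0 subr0 mul1r; apply: Ex_incr_rate => // i; rewrite tB0 le_b.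
    rewrite mulr1; apply: le_trans (Ex_gain (u := tB') (th := th) _ _ _ iF _) _ => //.
    - by move=> i; rewrite tB0 le_b.
    - move=> i _; rewrite /tB /tB' /lam' /bump inE; case: (boolP (i \in B)) => iB.
        by rewrite !mulr1; exact: hth.
      by rewrite !mulr0 oppr0 expR0 subrr mulr0.
    - rewrite finset.setU0; have [F1|//] := boolP (Fo _ _).
      (* An empty wall together with [H] would give [Fb], against [m0]; this is the vanishing at the
         empty set that [Ex_gain] asks for. *)
      have Fb1 := FoW _ _ _ aOB Hs sB F1.
      have sbO : bO \subset (bO :|: bL :|: s)%SET.
        by rewrite -finset.setUA finset.subsetUl.
      by rewrite (mFb _ _ _ _ (fintype.subxx _) sbO Fb1) in m0.
    apply: ler_wpM2r; first by apply: Ex_ge0.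
    by rewrite lerB.
  under eq_Ex do rewrite mulrC.
  rewrite ExZ mulrC; apply: ler_wpM2r => //.
  rewrite ExB Ex_cst ExZ; nra.
rewrite ExZ.
apply: (@le_trans _ _ (Ex tLL (index_enum I) (fun bL => (#|bL| <= m)%N%:R * G bL))); last first.
  rewrite [leRHS]Ex_exchange; apply: Ex_le => // bL /sL bLL.
  rewrite -ExZ; apply: Ex_le => // aB _.
  case: leqP => bm /=; last by rewrite mul0r.
  rewrite mul1r ler_nat; have := Fon (aO :|: aB)%SET (bO :|: bL)%SET.
  rewrite finset.setIUl bOL finset.set0U (finset.setIidPl bLL) => /(_ bm).
  by do 2 case: (_ (aO :|: aB)%SET _) => //; move=> /(_ isT).
(* [G] and the event that the box is not overcrowded both decrease in the closed sites, so they are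
   positively correlated. *)
apply: le_trans (Ex_harris _ _ _ _) => //; last first.
  move=> A A' AA; rewrite ler_nat; have [A'm|//] := boolP (#|A'| <= m)%N.
  by rewrite (leq_trans (subset_leq_card AA) A'm).
apply: ler_wpM2r; first by apply: Ex_ge0.
apply: (@le_trans _ _ (Ex tLL (index_enum I) (fun A => 1 - (m < #|A|)%N%:R))); last first.
  by apply: Ex_le => // A _; case: ltnP; rewrite ?subrr ?subr0.
rewrite ExB Ex_cst lerB//.
apply: le_trans (Ex_card _ _ tLL0) _.
rewrite [leRHS]mulrC; apply: le_trans beta.
apply: ler_wpM2r; first by rewrite invr_ge0 exprn_ge0.
rewrite ler_expR; apply: (@le_trans _ _ (\sum_i v * (i \in L)%:R)); last first.
  by rewrite -mulr_sumr sumr_mem.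
apply: ler_sum => i _; rewrite /tLL /tL inE ler_wpM2r// ler_piMr// gerBl//.
Qed.

End bernoulli_events.

(** * Connections in compact sets *)

Section continua.
Context {R : realType} {X : pseudoMetricType R}.
Implicit Types (A B C K S P : set X).

Definition directed_sets (J : Type) (D : set J) (F : J -> set X) :=
  (exists i, D i) /\
  forall i j, D i -> D j -> exists2 k, D k & F k `<=` F i `&` F j.

(** The traces of the [F i] on [C] generate a proper filter, and a cluster point of it belongs to
    every closed [F i]. *)
Lemma directed_compact (J : Type) (D : set J) (F : J -> set X) C :
  compact C -> directed_sets D F -> (forall i, D i -> closed (F i)) ->
  (forall i, D i -> F i `&` C !=set0) ->
  exists2 x, C x & forall i, D i -> F i x.
Proof.
move=> cC [D0 dF] clF FC.
have fF : Filter (filter_from D (fun i => F i `&` C)).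
  apply: filter_from_filter => // i j Di Dj.
  have [k Dk kij] := dF _ _ Di Dj; exists k => // x [Fk Cx].
  by have [? ?] := kij _ Fk.
have pF : ProperFilter (filter_from D (fun i => F i `&` C)).
  exact: filter_from_proper.
have [|x [Cx clx]] := cC _ pF.
  by have [i Di] := D0; exists i => // y [].
exists x => // i Di; apply: (clF i Di) => U Ux.
have [|y [[Fy _] Uy]] := clx (F i `&` C) U _ Ux; first by exists i.
by exists y.
Qed.

Lemma separated_closed A B C : closed C -> C = A `|` B -> separated A B ->
  closed A.
Proof.
move=> cC CAB [AB _] x cAx.
have : C x by apply: cC; apply: closureS cAx => y Ay; rewrite CAB; left.
rewrite CAB => -[//|Bx]; exfalso.
by have : (closure A `&` B) x by []; rewrite AB.
Qed.

Lemma closed_separated A B : closed A -> closed B -> A `&` B = set0 ->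
  separated A B.
Proof. by move=> cA cB AB; split; rewrite -((closure_id _).1 _). Qed.

(** Two separated pieces of the intersection lie in disjoint open sets. By compactness some [F i] is
    already covered by these two sets, hence contained in one of them. *)
Lemma directed_connected (J : Type) (D : set J) (F : J -> set X) K :
  compact K -> closed K -> directed_sets D F ->
  (forall i, D i -> closed (F i)) -> (forall i, D i -> F i `<=` K) ->
  (forall i, D i -> connected (F i)) -> connected (\bigcap_(i in D) F i).
Proof.
move=> cK clK dF clF FK coF.
have clI : closed (\bigcap_(i in D) F i) by apply: closed_bigI.
apply/connectedP => E [E0 EU sE].
have cl0 := separated_closed clI EU sE.
have cl1 : closed (E true).
  by apply: (@separated_closed _ (E false) _ clI); rewrite 1?setUC// separatedC.
have /(@normal_openP R) nX := @pseudometric_normal R X.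
have [U [V [oU oV EU0 EV UV]]] := nX _ _ cl0 cl1 (separated_disjoint sE).
have [i Di iUV] : exists2 i, D i & F i `<=` U `|` V.
  apply: contrapT => /forall2NP h.
  have [||x [Kx xUV] Fx] := @directed_compact J D F (K `&` ~` (U `|` V)) _ dF clF _.
  - by apply: compact_closedI => //; apply: open_closedC; exact: openU.
  - move=> i Di; case: (h i) => // /existsNP[x /not_implyP[Fix xUV]].
    by exists x; split=> //; split=> //; exact: FK Fix.
  have : (\bigcap_(i in D) F i) x by [].
  by rewrite EU => -[/EU0|/EV] ?; apply: xUV; [left|right].
have sUV : separated U V.
  split; apply/seteqP; split=> // x [].
    move=> cU Vx; have [|y [Uy Vy]] := cU V; first exact: open_nbhs_nbhs.
    by have : (U `&` V) y by []; rewrite UV.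
  move=> Ux cV; have [|y [Vy Uy]] := cV U; first exact: open_nbhs_nbhs.
  by have : (U `&` V) y by []; rewrite UV.
have [x Ex] := E0 false; have [y Ey] := E0 true.
have Fx : F i x by have : (\bigcap_(i in D) F i) x by [rewrite EU; left]; apply.
have Fy : F i y by have : (\bigcap_(i in D) F i) y by [rewrite EU; right]; apply.
have [/(_ _ Fy)|/(_ _ Fx)] := connected_subset sUV iUV (coF i Di) => h.
  by have : (U `&` V) y by [split=> //; exact: EV]; rewrite UV.
by have : (U `&` V) x by [split=> //; exact: EU0]; rewrite UV.
Qed.

(** In a compact set the intersection of all clopen pieces around [x] is connected, so it is
    contained in the component of [x] and misses [S]. By compactness a single piece already misses
    [S]. *)
Lemma clopen_separation K S x : compact K -> closed K -> closed S -> K x ->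
  connected_component K x `&` S = set0 ->
  exists A, [/\ A `<=` K, closed A, closed (K `\` A), A x & A `&` S = set0].
Proof.
move=> cK clK clS Kx xS.
pose D := [set A | [/\ A `<=` K, closed A, closed (K `\` A) & A x]].
have DI A B : D A -> D B -> D (A `&` B).
  move=> [AK cA cKA Ax] [BK cB cKB Bx]; split=> //.
  - by move=> y [/AK].
  - exact: closedI.
  - by rewrite setDIr; exact: closedU.
have dD : directed_sets D id.
  split; first by exists K; split=> //; rewrite setDv; exact: closed0.
  by move=> A B DA DB; exists (A `&` B) => //; exact: DI.
have cQ : connected (\bigcap_(A in D) A).
  have clQ : closed (\bigcap_(A in D) A) by apply: closed_bigI => A [].
  apply/connectedP => E [E0 EU sE].
  wlog Ex : E E0 EU sE / E false x.
    move=> G; have : (\bigcap_(A in D) A) x by move=> A [].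
    rewrite EU => -[E0x|E1x]; first exact: G.
    by apply: (G (E \o negb)) => //;
      [case => /=|rewrite EU setUC|rewrite separatedC].
  have cl0 := separated_closed clQ EU sE.
  have cl1 : closed (E true).
    by apply: (@separated_closed _ (E false) _ clQ); rewrite 1?setUC// separatedC.
  have /(@normal_openP R) nX := @pseudometric_normal R X.
  have [U [V [oU oV EU0 EV UV]]] := nX _ _ cl0 cl1 (separated_disjoint sE).
  have [A [AK cA cKA Ax] AUV] : exists2 A, D A & A `<=` U `|` V.
    apply: contrapT => /forall2NP h.
    have [||||y [Ky yUV] Fy] := @directed_compact _ D id (K `&` ~` (U `|` V)).
    - by apply: compact_closedI => //; apply: open_closedC; exact: openU.
    - exact: dD.
    - by move=> A [].
    - move=> A DA; case: (h A) => // /existsNP[y /not_implyP[Ay yUV]].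
      by exists y; split=> //; split=> //; case: DA => + _ _ _; exact.
    have : (\bigcap_(i in D) i) y by [].
    by rewrite EU => -[/EU0|/EV] ?; apply: yUV; [left|right].
  have AUE : A `&` U = A `\` V.
    apply/seteqP; split=> y [Ay].
      by move=> Uy; split=> // Vy; have : (U `&` V) y by []; rewrite UV.
    by move=> nV; split=> //; case: (AUV _ Ay).
  have DAU : D (A `&` U).
    split=> //.
    - by move=> y [/AK].
    - by rewrite AUE setDE; apply: closedI => //; exact: open_closedC.
    - rewrite setDIr; apply: closedU => //.
      rewrite (_ : K `\` U = K `&` ~` U) -?setDE//.
      by rewrite setDE; apply: closedI => //; exact: open_closedC.
    - by split=> //; exact: EU0.
  have [y Ey] := E0 true.
  have : (\bigcap_(A in D) A) y by rewrite EU; right.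
  move=> /(_ _ DAU)[_ Uy].
  by have : (U `&` V) y by [split=> //; exact: EV]; rewrite UV.
have Qcomp : \bigcap_(A in D) A `<=` connected_component K x.
  apply: connected_component_max => //; first by move=> A [].
  by move=> y; apply; split=> //; rewrite setDv; exact: closed0.
apply: contrapT => h.
have [||||y [Ky Sy] Fy] := @directed_compact _ D id (K `&` S).
- exact: compact_closedI.
- exact: dD.
- by move=> A [].
- move=> A DA; apply/set0P/eqP => AS; apply: h; case: DA => AK cA cKA Ax.
  exists A; split=> //; rewrite -subset0 -AS => y [Ay Sy].
  by split=> //; split=> //; exact: AK.
by have : (connected_component K x `&` S) y by [split=> //; exact: Qcomp]; rewrite xS.
Qed.

(** An arbitrary connected witness is easier to carry from one set to another than the component
    used by [connects]. *)
Definition joins P S V := exists C, [/\ connected C, C `<=` V, C `&` P !=set0 & C `&` S !=set0].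

(** If a limit point [x] were not joined to [S], a clopen piece around it would miss [S]. All joined
    points lie in the complement of this piece in [K], which is closed, so [x] would lie there
    too. *)
Lemma closed_joined K P S : compact K -> closed K -> closed P -> closed S ->
  closed [set x | [/\ K x, P x & connected_component K x `&` S !=set0]].
Proof.
move=> cK clK clP clS x clx.
have Kx : K x by apply: clK; apply: closureS clx => y [].
have Px : P x by apply: clP; apply: closureS clx => y [].
split=> //; apply/set0P/eqP => xS.
have [A [AK clA clKA Ax AS]] := clopen_separation cK clK clS Kx xS.
suff : (K `\` A) x by case.
apply: (clKA); apply: closureS clx => y [Ky Py [z [[C [Cy CK coC] Cz] Sz]]].
split=> // Ay.
have sA : separated A (K `\` A).
  exact: (closed_separated clA clKA (setDIK _ _)).
have CA : C `<=` A `|` (K `\` A).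
  by move=> w /CK Kw; have [?|?] := pselect (A w); [left|right].
have [/(_ _ Cz) Az|/(_ _ Cy)[]//] := connected_subset sA CA coC.
by have : (A `&` S) z by []; rewrite AS.
Qed.

(** The sets of starting points in [P] are compact and decrease with [F], so one point [x] starts a
    connection in every [F i]; its components decrease to a continuum that still meets [S]. This is
    what lets the mesh tend to 0. *)
Lemma joins_directed (J : Type) (D : set J) (F : J -> set X) K P S :
  compact K -> closed K -> directed_sets D F ->
  (forall i, D i -> closed (F i)) -> (forall i, D i -> F i `<=` K) ->
  closed P -> closed S -> (forall i, D i -> joins P S (F i)) ->
  joins P S (\bigcap_(i in D) F i).
Proof.
move=> cK clK dF clF FK clP clS jF.
have cF i : D i -> compact (F i).
  by move=> Di; apply: subclosed_compact (FK i Di) => //; exact: clF.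
pose G i := [set x | [/\ F i x, P x & connected_component (F i) x `&` S !=set0]].
have mono i j x : F j `<=` F i -> connected_component (F j) x `<=` connected_component (F i) x.
  by move=> ji y [C [Cx CF coC] Cy]; exists C => //; split=> // z /CF/ji.
have GS i k : F k `<=` F i -> G k `<=` G i.
  move=> ki x [Fx Px [y [xy Sy]]]; split=> //; first exact: ki.
  by exists y; split=> //; exact: mono xy.
have dG : directed_sets D G.
  split; first exact: dF.1.
  move=> i j Di Dj; have [k Dk kij] := dF.2 _ _ Di Dj; exists k => // x Gx.
  by split; apply: GS Gx => y /kij[].
have [||x Kx Gx] := directed_compact cK dG.
- by move=> i Di; apply: closed_joined => //; [exact: cF|exact: clF].
- move=> i Di; have [C [coC CF [x [Cx Px]] [y [Cy Sy]]]] := jF i Di.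
  exists x; split; last by apply: (FK i Di); exact: CF.
  split=> //; first exact: CF.
  by exists y; split=> //; exists C.
pose H i := connected_component (F i) x.
have dH : directed_sets D H.
  split; first exact: dF.1.
  move=> i j Di Dj; have [k Dk kij] := dF.2 _ _ Di Dj; exists k => // y Hy.
  by split; apply: mono Hy => z /kij[].
have clH i : D i -> closed (H i) by move=> Di; apply: component_closed; exact: clF.
have HF i : H i `<=` F i by exact: connected_component_sub.
exists (\bigcap_(i in D) H i); split.
- apply: (directed_connected cK clK dH clH) => [i Di|i Di].
    by apply: subset_trans (FK i Di); exact: HF.
  exact: component_connected.
- by move=> y Hy i Di; exact/HF/Hy.
- have [i Di] := dF.1; exists x; split; last by case: (Gx i Di).
  by move=> j Dj; apply: connected_component_refl; case: (Gx j Dj).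
- have [||||y [Ky Sy] Hy] := @directed_compact _ D H (K `&` S).
  + exact: compact_closedI.
  + exact: dH.
  + exact: clH.
  + move=> i Di; have [_ _ [y [Hy Sy]]] := Gx i Di.
    by exists y; split=> //; split=> //; apply: (FK i Di); exact: HF.
  by exists y.
Qed.

(* The clopen piece of [V `&` B] around [x], if it misses the frontier [S],
   would disconnect [C]. *)
Lemma boundary_bumping V B O C S x : closed V -> compact (V `&` B) -> closed B ->
  closed O -> closed S -> [set: X] = B `|` O -> B `&` O = S ->
  connected C -> C `<=` V -> C x -> B x -> C `&` O !=set0 ->
  connected_component (V `&` B) x `&` S !=set0.
Proof.
move=> clV cVB clB clO clS BO BOS coC CV Cx Bx [y [Cy Oy]].
apply/set0P/eqP => xS.
have clVB : closed (V `&` B) by exact: closedI.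
have [|A [AK clA clKA Ax AS]] := clopen_separation cVB clVB clS _ xS.
  by split=> //; exact: CV.
have VA : V `\` A = (V `&` B `\` A) `|` (V `&` O).
  apply/seteqP; split=> z.
    move=> [Vz Az]; have : (B `|` O) z by rewrite -BO.
    by case=> ?; [left|right].
  move=> [[[Vz Bz] Az]//|[Vz Oz]]; split=> // Az.
  have [_ Bz] := AK _ Az.
  have : (A `&` S) z by split=> //; rewrite -BOS.
  by rewrite AS.
have clVA : closed (V `\` A) by rewrite VA; apply: closedU => //; exact: closedI.
have sA : separated A (V `\` A).
  exact: (closed_separated clA clVA (setDIK _ _)).
have CA : C `<=` A `|` (V `\` A).
  by move=> w /CV Vw; have [?|?] := pselect (A w); [left|right].
have [/(_ _ Cy) Ay|/(_ _ Cx)[]//] := connected_subset sA CA coC.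
have [_ By] := AK _ Ay.
have : (A `&` S) y by split=> //; rewrite -BOS.
by rewrite AS.
Qed.

End continua.

(** * Euclidean geometry *)

Section euclid.
Context {R : realType} {d : nat}.
Implicit Types (x y z u : 'rV[R]_d).

Lemma enorm_ge0 x : 0 <= enorm x. Proof. exact: sqrtr_ge0. Qed.

Lemma enorm_sqr x : enorm x ^+ 2 = \sum_i x ord0 i ^+ 2.
Proof. by rewrite sqr_sqrtr// sumr_ge0// => i _; exact: sqr_ge0. Qed.

Lemma enormN x : enorm (- x) = enorm x.
Proof. by rewrite /enorm; congr Num.sqrt; apply: eq_bigr => i _; rewrite mxE sqrrN. Qed.

Lemma enormB x y : enorm (x - y) = enorm (y - x).
Proof. by rewrite -enormN opprB. Qed.

Lemma enorm0 : enorm (0 : 'rV[R]_d) = 0.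
Proof.
by rewrite /enorm big1 ?sqrtr0// => i _; rewrite mxE expr0n.
Qed.

Lemma enorm_le x (c : R) : 0 <= c -> (enorm x <= c) = (\sum_i x ord0 i ^+ 2 <= c ^+ 2).
Proof.
by move=> c0; rewrite -enorm_sqr ler_sqr ?nnegrE// enorm_ge0.
Qed.

Lemma ge_enorm x (c : R) : 0 <= c -> (c <= enorm x) = (c ^+ 2 <= \sum_i x ord0 i ^+ 2).
Proof.
by move=> c0; rewrite -enorm_sqr ler_sqr ?nnegrE// enorm_ge0.
Qed.

Lemma coord_le_enorm x i : `|x ord0 i| <= enorm x.
Proof.
rewrite ge_enorm// (bigD1 i)//= -normrX ger0_norm ?sqr_ge0// lerDl.
by rewrite sumr_ge0// => j _; exact: sqr_ge0.
Qed.

Lemma dot_sqr_le x y :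
  (\sum_i x ord0 i * y ord0 i) ^+ 2 <= (\sum_i x ord0 i ^+ 2) * (\sum_i y ord0 i ^+ 2).
Proof.
set A := \sum_i x ord0 i ^+ 2; set B := \sum_i y ord0 i ^+ 2; set C := \sum_i _ * _.
have A0 : 0 <= A by rewrite sumr_ge0// => i _; exact: sqr_ge0.
have B0 : 0 <= B by rewrite sumr_ge0// => i _; exact: sqr_ge0.
have Q t : 0 <= A - 2 * t * C + t ^+ 2 * B.
  rewrite (_ : _ + _ = \sum_i (x ord0 i - t * y ord0 i) ^+ 2).
    by rewrite sumr_ge0// => i _; exact: sqr_ge0.
  rewrite /A /B /C !mulr_sumr -sumrB -big_split/=; apply: eq_bigr => i _; ring.
have [B00|Bn0] := eqVneq B 0.
  have := Q ((A + 1) / (2 * C)); rewrite B00 !mulr0 addr0.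
  have [->|C0] := eqVneq C 0; first by rewrite expr0n lexx.
  rewrite (_ : 2 * _ * C = A + 1); last by field.
  lra.
have {}Bn0 : 0 < B by rewrite lt_def Bn0.
have := Q (C / B).
rewrite (_ : A - _ + _ = (A * B - C ^+ 2) / B); last by field; rewrite gt_eqF.
by rewrite pmulr_lge0 ?invr_gt0// subr_ge0.
Qed.

Lemma enormD x y : enorm (x + y) <= enorm x + enorm y.
Proof.
have x0 := enorm_ge0 x; have y0 := enorm_ge0 y.
rewrite enorm_le ?addr_ge0//.
have -> : \sum_i (x + y) ord0 i ^+ 2 =
    enorm x ^+ 2 + 2 * (\sum_i x ord0 i * y ord0 i) + enorm y ^+ 2.
  rewrite !enorm_sqr mulr_sumr -!big_split/=.
  by apply: eq_bigr => i _; rewrite mxE; ring.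
have : \sum_i x ord0 i * y ord0 i <= enorm x * enorm y.
  rewrite (le_trans (ler_norm _))// -ler_sqr ?nnegrE ?mulr_ge0//.
  by rewrite -normrX ger0_norm ?sqr_ge0// exprMn !enorm_sqr dot_sqr_le.
lra.
Qed.

Lemma enorm_triangle x y z : enorm (x - z) <= enorm (x - y) + enorm (y - z).
Proof. by rewrite (le_trans _ (enormD _ _))// addrA subrK. Qed.

Lemma enorm_le_sup x (c : R) : 0 <= c -> (forall i, `|x ord0 i| <= c) ->
  enorm x <= d%:R * c.
Proof.
move=> c0 xc; rewrite enorm_le ?mulr_ge0//.
apply: (@le_trans _ _ (\sum_(i < d) c ^+ 2)).
  by apply: ler_sum => i _; rewrite -[leLHS]ger0_norm ?sqr_ge0// normrX ler_sqr ?nnegrE.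
rewrite sumr_const card_ord -[leLHS]mulr_natl exprMn ler_wpM2r ?sqr_ge0//.
by rewrite -natrX ler_nat; case: (d) => // m; rewrite expnS expn1 leq_pmulr.
Qed.

Lemma enorm_le_norm x : enorm x <= d%:R * `|x|.
Proof.
apply: enorm_le_sup => // i.
by rewrite -[leRHS]/(mx_norm x) mx_normrE; apply: le_bigmax (ord0, i) => //.
Qed.

Lemma norm_le_enorm x : `|x| <= enorm x.
Proof.
rewrite -[leLHS]/(mx_norm x) mx_normrE.
apply/bigmax_leP; split; first exact: enorm_ge0.
by move=> [i j] _ /=; rewrite (ord1 i) coord_le_enorm.
Qed.

Lemma continuous_enorm : continuous (@enorm R d).
Proof.
move=> x; have FF : Filter (nbhs x) by exact: nbhs_filter.
apply/(@cvgrPdist_lt _ _ _ (nbhs x) FF) => e e0.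
have d0 : 0 < e / (d%:R + 1) by rewrite divr_gt0// ltr_wpDl.
apply/nbhs_ballP; exists (e / (d%:R + 1)) => // y; rewrite mx_norm_ball /= => xy.
apply: (@le_lt_trans _ _ (enorm (x - y))).
  rewrite ler_norml; have := enorm_triangle x y 0; have := enorm_triangle y x 0.
  by rewrite !subr0 (enormB y x); lra.
apply: le_lt_trans (enorm_le_norm _) _.
apply: (@le_lt_trans _ _ (d%:R * (e / (d%:R + 1)))); first by rewrite ler_wpM2l// ltW.
have dge0 : 0 <= d%:R :> R by []. by rewrite mulrCA gtr_pMr// ltr_pdivrMr ?mul1r; lra.
Qed.

Lemma closed_closed_eball (r : R) : closed (closed_eball r : set 'rV[R]_d).
Proof.
rewrite (_ : closed_eball r = @enorm R d @^-1` [set x | x <= r]) //.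
by apply: closed_comp; [move=> x _; exact: continuous_enorm|exact: closed_le].
Qed.

Definition outer_eball (r : R) : set 'rV[R]_d := [set x | r <= enorm x].

Lemma closed_outer_eball (r : R) : closed (outer_eball r).
Proof.
rewrite (_ : outer_eball r = @enorm R d @^-1` [set x | r <= x]) //.
by apply: closed_comp; [move=> x _; exact: continuous_enorm|exact: closed_ge].
Qed.

Lemma closed_esphere (r : R) : closed (esphere r : set 'rV[R]_d).
Proof.
rewrite (_ : esphere r = closed_eball r `&` outer_eball r).
  by apply: closedI; [exact: closed_closed_eball|exact: closed_outer_eball].
apply/seteqP; split=> x /=; rewrite /esphere /closed_eball /outer_eball /=; first by move=> ->.
by move=> [a b]; apply/eqP; rewrite eq_le a b.
Qed.

Lemma compact_closed_eball (r : R) : compact (closed_eball r : set 'rV[R]_d).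
Proof.
apply: bounded_closed_compact; last exact: closed_closed_eball.
exists r; split; first exact: num_real.
by move=> M rM x /= xr; apply: le_trans (norm_le_enorm _) _; apply: le_trans xr (ltW rM).
Qed.

Lemma connectsP (r s : R) (V : set 'rV[R]_d) :
  connects r s V <-> joins (closed_eball r) (esphere s) V.
Proof.
split=> [[x Vx [h1 h2]]|[C [coC CV [x [Cx Bx]] [y [Cy Sy]]]]].
  exists (connected_component V x); split=> //; first exact: component_connected.
  exact: connected_component_sub.
exists x; first exact: CV.
split; [exists x|exists y]; split=> //; by exists C.
Qed.

Lemma connected_esphere C (r s : R) : connected C -> C `&` closed_eball r !=set0 ->
  C `&` outer_eball s !=set0 -> r <= s -> forall q, r <= q <= s -> C `&` esphere q !=set0.
Proof.
move=> coC [x [Cx Bx]] [y [Cy Oy]] rs q /andP[rq qs].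
have : connected (@enorm R d @` C).
  apply: connected_continuous_connected => //.
  by apply: continuous_subspaceT => z; exact: continuous_enorm.
move/connected_intervalP => h.
have [z Cz zq] : (@enorm R d @` C) q.
  apply: (h (enorm x) (enorm y)); [by exists x|by exists y|].
  by rewrite (le_trans Bx rq) (le_trans qs Oy).
by exists z.
Qed.

Lemma joins_ball (r s : R) (V : set 'rV[R]_d) x : closed V -> r <= s ->
  closed_eball r x -> V x -> connected_component V x `&` outer_eball s !=set0 ->
  connected_component (V `&` closed_eball s) x `&` esphere s !=set0.
Proof.
move=> clV rs Bx Vx xS.
apply: (@boundary_bumping _ _ V (closed_eball s) (outer_eball s) (connected_component V x)) => //.
- by rewrite setIC; apply: compact_closedI => //; exact: compact_closed_eball.
- exact: closed_closed_eball.
- exact: closed_outer_eball.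
- exact: closed_esphere.
- by apply/seteqP; split=> y // _; have [h|h] := leP (enorm y) s; [left|right; exact: ltW].
- apply/seteqP; split=> y /=; rewrite /esphere /closed_eball /outer_eball /=; last by move=> ->.
  by move=> [a b]; apply/eqP; rewrite eq_le a b.
- exact: component_connected.
- exact: connected_component_sub.
- exact: connected_component_refl.
- exact: le_trans Bx rs.
Qed.

(** Boundary bumping cuts the connection at the sphere of radius [s]. Everything then takes place in
    a compact ball, where limits and finite windows are available. *)
Lemma connects_ball (r s : R) (V : set 'rV[R]_d) : closed V -> r <= s ->
  connects r s V -> joins (closed_eball r) (esphere s) (V `&` closed_eball s).
Proof.
move=> clV rs [x Vx [[y [xy By]] [z [xz Sz]]]].
have Vy : V y by exact: connected_component_sub xy.
have [u [yu Su]] : connected_component (V `&` closed_eball s) y `&` esphere s !=set0.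
  apply: joins_ball By Vy _ => //; exists z; split; last by rewrite /outer_eball /= Sz.
  by rewrite -(same_connected_component xy).
exists (connected_component (V `&` closed_eball s) y); split.
- exact: component_connected.
- exact: connected_component_sub.
- exists y; split=> //; apply: connected_component_refl; split=> //.
  exact: le_trans By rs.
- by exists u.
Qed.

Lemma connects_le (r s s' : R) (V : set 'rV[R]_d) : r <= s <= s' ->
  connects r s' V -> connects r s V.
Proof.
move=> /andP[rs ss] /connectsP[C [coC CV CB [y [Cy Sy]]]]; apply/connectsP.
exists C; split=> //.
apply: (connected_esphere coC CB _ (le_trans rs ss)); last by rewrite rs.
by exists y; split=> //; rewrite /outer_eball /= Sy.
Qed.

Lemma percolates_mono (V W : set 'rV[R]_d) : V `<=` W -> percolates V -> percolates W.
Proof.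
move=> VW [x Vx h]; exists x; first exact: VW.
apply: contra_not h => -[M [Mr hM]]; exists M; split=> // y My z.
move=> [C [Cx CV coC] Cz]; apply: hM My _ _; exists C => //; split=> //.
exact: subset_trans VW.
Qed.

(** For the converse, the points of the small ball joined to the sphere of radius [s] within the
    ball of radius [s] form nonempty compact sets that decrease in [s]; a common point has an
    unbounded component. Percolation thus becomes a countable combination of connection events. *)
Lemma percolatesP (V : set 'rV[R]_d) : closed V ->
  percolates V <-> exists r : nat, forall s : nat, (r < s)%N -> connects r%:R s%:R V.
Proof.
move=> clV; split=> [[x Vx ub]|[r rs]].
  exists (Num.bound (enorm x)) => s rs.
  have xr : enorm x <= (Num.bound (enorm x))%:R.
    by apply: ltW; apply: archi_boundP; exact: enorm_ge0.
  apply/connectsP; exists (connected_component V x); split.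
  - exact: component_connected.
  - exact: connected_component_sub.
  - by exists x; split=> //; exact: connected_component_refl.
  - apply: (@connected_esphere _ (Num.bound (enorm x))%:R s%:R _ _ _ _ s%:R).
    + exact: component_connected.
    + by exists x; split=> //; exact: connected_component_refl.
    + apply: contrapT => h; apply: ub; exists s%:R; split; first exact: num_real.
      move=> M sM y xy; apply: le_trans (norm_le_enorm _) _; apply: le_trans (ltW sM).
      by rewrite leNgt; apply/negP => sy; apply: h; exists y; split=> //; exact: ltW.
    + by rewrite ler_nat ltnW.
    + by rewrite ler_nat lexx ltnW.
have cB : compact (closed_eball r%:R : set 'rV[R]_d) by exact: compact_closed_eball.
pose G (s : nat) : set 'rV[R]_d := [set x | [/\ (V `&` closed_eball s%:R) x, closed_eball r%:R x &
   connected_component (V `&` closed_eball s%:R) x `&` esphere s%:R !=set0]].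
have Gdown s t : (r < s)%N -> (s <= t)%N -> G t `<=` G s.
  move=> rs' st x [[Vx Bt] Br [y [xy Sy]]].
  have rsR : r%:R <= s%:R :> R by rewrite ler_nat ltnW.
  split=> //; first by split=> //; exact: le_trans Br rsR.
  apply: joins_ball Br Vx _ => //.
  exists y; split.
    by move: xy => [C [Cx CV coC] Cy]; exists C => //; split=> // z /CV[].
  by rewrite /outer_eball /= Sy ler_nat.
have [||||x Br Gx] := @directed_compact _ _ nat [set s | (r < s)%N] G (closed_eball r%:R).
- exact: cB.
- split; first by exists r.+1 => /=.
  move=> i j ri rj; exists (maxn i j); first by rewrite /= (leq_trans ri)// leq_maxl.
  by move=> x Gx; split; apply: Gdown Gx; rewrite ?leq_maxl ?leq_maxr.
- move=> s rs'; apply: closed_joined.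
  + by rewrite setIC; apply: compact_closedI => //; exact: compact_closed_eball.
  + by apply: closedI => //; exact: closed_closed_eball.
  + exact: closed_closed_eball.
  + exact: closed_esphere.
- move=> s rs'; have rsR : r%:R <= s%:R :> R by rewrite ler_nat ltnW.
  have [C [coC CV [x [Cx Bx]] [y [Cy Sy]]]] := connects_ball clV rsR (rs s rs').
  exists x; split=> //; split=> //; first exact: CV.
  by exists y; split=> //; exists C.
exists x; first by have [[]] := Gx r.+1 (ltnSn r).
move=> [M [_ hM]].
pose s := (maxn r.+1 (Num.bound (d%:R * (`|M| + 1)))).
have [_ _ [y [[C [Cx CV coC] Cy] Sy]]] := Gx s (leq_maxl _ _).
have yM : `|y| <= `|M| + 1.
  apply: hM; first by rewrite (le_lt_trans (ler_norm M))// ltrDl.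
  by exists C => //; split=> // z /CV[].
have := enorm_le_norm y; rewrite Sy leNgt => /negP; apply.
apply: (@le_lt_trans _ _ (d%:R * (`|M| + 1))); first by rewrite ler_wpM2l.
have h : 0 <= d%:R * (`|M| + 1) by rewrite mulr_ge0// addr_ge0.
apply: lt_le_trans (archi_boundP h) _.
by rewrite ler_nat /s leq_max leqnn orbT.
Qed.

End euclid.

Lemma rowBE {R : zmodType} {d : nat} (x y : 'rV[R]_d) k :
  (x - y) ord0 k = x ord0 k - y ord0 k.
Proof. by rewrite !mxE. Qed.

Lemma coord_le_norm {R : realType} {d : nat} (x : 'rV[R]_d) k : `|x ord0 k| <= `|x|.
Proof.
by rewrite -[leRHS]/(mx_norm x) mx_normrE; apply: le_bigmax (ord0, k).
Qed.

(** * Walls around closed boxes *)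

Section macrocells.
Context {R : realType} {d : nat}.
Variables (sg : R) (K N : nat).
Hypotheses (sg0 : 0 < sg) (NE : N%:R = sg * K%:R).
Implicit Types (x y u : 'rV[R]_d) (z m : 'rV[int]_d).

Definition macrocell y : 'rV[int]_d := \row_k Num.floor (y ord0 k / sg).

Lemma macrocell_itv y k :
  sg * (macrocell y ord0 k)%:~R <= y ord0 k < sg * (macrocell y ord0 k)%:~R + sg.
Proof.
have := floor_itv (y ord0 k / sg); rewrite mxE intrD1.
rewrite ler_pdivlMr// ltr_pdivrMr// mulrDl mul1r => /andP[h1 h2].
by rewrite mulrC h1.
Qed.

Lemma macrocell_dist x y k : macrocell x = macrocell y ->
  `|x ord0 k - y ord0 k| <= sg.
Proof.
move=> xy; have := macrocell_itv x k; have := macrocell_itv y k; rewrite xy.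
move=> /andP[h1 h2] /andP[h3 h4]; rewrite ler_norml; lra.
Qed.

Lemma grid_boxE z y : grid_box N z y <->
  forall k, (K%:Z * z ord0 k <= macrocell y ord0 k < K%:Z * z ord0 k + K%:Z)%R.
Proof.
have H k : (N%:R * (z ord0 k)%:~R <= y ord0 k < N%:R * (z ord0 k)%:~R + N%:R) =
  (K%:Z * z ord0 k <= macrocell y ord0 k < K%:Z * z ord0 k + K%:Z)%R :> bool.
  rewrite mxE floor_ge_int floor_lt_int ler_pdivlMr// ltr_pdivrMr// NE.
  rewrite rmorphD rmorphM /= -!pmulrn; congr (_ && _).
    by congr (_ <= _); ring.
  by congr (_ < _); ring.
by split=> h k; have := h k; rewrite H.
Qed.

(* [2 d + 7] layers of macro-cells: the barrier lies at distance
   [(d + 4) sg] from the box and is protected by [d + 2] layers on both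
   sides. *)
Definition shell_width : nat := (2 * d + 7)%N.

Definition in_box z m :=
  [forall k : 'I_d, K%:Z * z ord0 k <= m ord0 k < K%:Z * z ord0 k + K%:Z].

Definition near_shell z m :=
  [forall k : 'I_d, K%:Z * z ord0 k - shell_width%:Z <= m ord0 k <
                    K%:Z * z ord0 k + K%:Z + shell_width%:Z].

Definition near_sphere (r : R) m := exists2 x : 'rV[R]_d, enorm x = r &
  forall k, `|sg * (m ord0 k)%:~R - x ord0 k| <= (d + 2)%:R * sg.

(** Cells of the box itself are included only near the sphere of radius [r]; otherwise the wall
    would be as large as the box and too costly to open. *)
Definition wall (r : R) z m : Prop :=
  near_shell z m /\ (~~ in_box z m \/ near_sphere r m).

Variables (kap : R).
Hypothesis kap_le : 0 <= kap <= sg.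

(* discretised truncated Voronoi set, for open points [O] and closed region
   [C] *)
Definition slack_voronoi (s : R) (O C : set 'rV[R]_d) : set 'rV[R]_d :=
  [set y | [/\ enorm y <= s, exists2 o, O o & enorm (y - o) <= N%:R + kap &
     forall u, C u -> exists2 o, O o & enorm (y - o) <= enorm (y - u) + kap]].

Lemma slack_voronoi_mono s O O' C C' : O `<=` O' -> C' `<=` C ->
  slack_voronoi s O C `<=` slack_voronoi s O' C'.
Proof.
move=> OO CC y [ys [p /OO Op yp] h]; split=> //; first by exists p.
by move=> u /CC /h [p' /OO Op' yp']; exists p'.
Qed.

Section wall_argument.
Variables (r s : R) (z : 'rV[int]_d) (O C : set 'rV[R]_d).
Hypotheses (rs : r <= s).
Hypothesis O_wall : forall o, O o -> ~ wall r z (macrocell o).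
Hypothesis C_wall : forall m, wall r z m -> exists2 u, C u & macrocell u = m.
Let V := slack_voronoi s O C.

(** The macro-cell of [y] holds a closed point within d sg of [y], so [y] in [V] would require an
    open point within (d + 1) sg. One more [sg] reaches the corner of the macro-cell of that open
    point, which is thus a wall cell, where no point is open. *)
Lemma deep_in_wall y :
  (forall m, (forall k, `|sg * (m ord0 k)%:~R - y ord0 k| <= (d + 2)%:R * sg) ->
     wall r z m) -> ~ V y.
Proof.
move=> yw [_ _ Cy].
have sd : sg <= (d + 2)%:R * sg by rewrite ler_peMl ?ler1n ?addn2// ltW.
have my k : `|sg * (macrocell y ord0 k)%:~R - y ord0 k| <= sg.
  have /andP[h1 h2] := macrocell_itv y k; rewrite ler_norml; lra.
have [u Cu uy] : exists2 u, C u & macrocell u = macrocell y.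
  by apply: C_wall; apply: yw => k; exact: le_trans (my k) sd.
have [p Op yp] := Cy u Cu; apply: (O_wall Op); apply: yw => k.
have yu : enorm (y - u) <= d%:R * sg.
  apply: enorm_le_sup => [|i]; first exact: ltW.
  by rewrite !mxE; apply: macrocell_dist.
have h1 : `|y ord0 k - p ord0 k| <= (d + 1)%:R * sg.
  have := coord_le_enorm (y - p) k; rewrite !mxE => /le_trans; apply.
  rewrite natrD mulrDl mul1r; apply: le_trans yp _; apply: lerD => //.
  by case/andP: kap_le.
have /andP[h2 h3] := macrocell_itv p k.
move: h1; rewrite !ler_norml !natrD !mulrDl; lra.
Qed.

(* Projecting [y] on the box enlarged by [d sg] gains [d sg], which pays for
   moving to a closed point in the macro-cell of the projection. *)
Lemma far_from_box y :
  (exists k, N%:R / 2 + d%:R * sg < `|y ord0 k - (N%:R * (z ord0 k)%:~R + N%:R / 2)|) ->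
  V y -> slack_voronoi s O (C `|` grid_box N z) y.
Proof.
move=> [k0 yk0] [ys yO yC]; split=> // u [/yC//|zu].
pose lo k : R := N%:R * (z ord0 k)%:~R.
pose c : R := d%:R * sg.
have c0 : 0 <= c by rewrite mulr_ge0// ltW.
pose q : 'rV[R]_d := \row_k Num.max (lo k - c) (Num.min (y ord0 k) (lo k + N%:R + c)).
have N0 : 0 <= N%:R :> R by [].
have cp : 0 < c by rewrite mulr_gt0// ltr0n (leq_ltn_trans _ (ltn_ord k0)).
have qP k : [\/ y ord0 k < lo k - c /\ q ord0 k = lo k - c,
   lo k - c <= y ord0 k <= lo k + N%:R + c /\ q ord0 k = y ord0 k |
   lo k + N%:R + c < y ord0 k /\ q ord0 k = lo k + N%:R + c].
  rewrite mxE; have [h1|h1] := ltP (y ord0 k) (lo k - c).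
    by apply: Or31; split=> //; rewrite min_l ?max_l//; [exact: ltW|lra].
  have [h2|h2] := ltP (lo k + N%:R + c) (y ord0 k).
    by apply: Or33; split=> //; rewrite max_r//; lra.
  by apply: Or32; split; [apply/andP|rewrite max_r].
have q_wall : wall r z (macrocell q).
  have dR : c = sg * (d%:Z)%:~R by rewrite /c mulrC pmulrn.
  have loE k : lo k = sg * (K%:Z * z ord0 k)%:~R by rewrite /lo NE rmorphM /= -pmulrn; ring.
  have NE' : N%:R = sg * (K%:Z)%:~R by rewrite NE pmulrn.
  split.
    apply/forallP => k; rewrite [X in _ <= X < _]mxE floor_ge_int floor_lt_int.
    rewrite ler_pdivlMr// ltr_pdivrMr//.
    have h : lo k - c <= q ord0 k <= lo k + N%:R + c by case: (qP k) => -[h ->]; lra.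
    have tau : c + sg <= sg * shell_width%:Z%:~R.
      rewrite -pmulrn /shell_width natrD natrM /c.
      have : 0 <= d%:R * sg by [].
      have -> : sg * (2 * d%:R + 7) = 2 * (d%:R * sg) + 7 * sg by ring.
      move: (d%:R * sg) => e e0; have := sg0; lra.
    have -> : (K%:Z * z ord0 k - shell_width%:Z)%:~R * sg = lo k - sg * shell_width%:Z%:~R.
      by rewrite loE rmorphB /=; ring.
    have -> : (K%:Z * z ord0 k + K%:Z + shell_width%:Z)%:~R * sg = lo k + N%:R + sg * shell_width%:Z%:~R.
      by rewrite loE NE' !rmorphD /=; ring.
    move: h tau; have := sg0; move: (sg * _) (lo k) => w l; lra.
  left; apply/forallPn; exists k0; apply/negP => /andP[].
  rewrite !mxE floor_ge_int floor_lt_int ler_pdivlMr// ltr_pdivrMr//.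
  have -> : (K%:Z * z ord0 k0)%:~R * sg = lo k0 by rewrite loE mulrC.
  rewrite rmorphD /= mulrDl -[(K%:Z * z ord0 k0)%:~R * sg]mulrC -loE -pmulrn [K%:R * sg]mulrC -NE.
  have := qP k0; rewrite [q ord0 k0]mxE.
  move: yk0; rewrite -/(lo k0) -/c => yk0.
  move: (lo k0) yk0 => l yk0;
  case=> -[h ->]; first lra.
    by move: yk0 h; rewrite ltr_normr => /orP[] ? /andP[]; lra.
  lra.
have [v Cv vpi] := C_wall q_wall; have [p Op yp] := yC v Cv.
exists p => //; apply: le_trans yp _; rewrite lerD2r.
apply: (@le_trans _ _ (enorm (y - q) + c)).
  apply: le_trans (enorm_triangle _ q _) _; rewrite lerD2l.
  apply: enorm_le_sup => [|i]; first exact: ltW.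
  by rewrite rowBE; apply: macrocell_dist; rewrite vpi.
rewrite ge_enorm ?addr_ge0 ?enorm_ge0//.
have -> : \sum_i (y - u) ord0 i ^+ 2 = \sum_i (y - q) ord0 i ^+ 2 +
   \sum_i (2 * ((y - q) ord0 i * (q - u) ord0 i) + (q - u) ord0 i ^+ 2).
  by rewrite -big_split/=; apply: eq_bigr => i _; rewrite !rowBE; ring.
rewrite big_split/= -mulr_sumr.
have zu' k : lo k <= u ord0 k < lo k + N%:R := zu k.
(* Where [y - q] is nonzero in coordinate [k], [q - u] has the same sign and size at least [c]. *)
have h1 k : c * `|(y - q) ord0 k| <= (y - q) ord0 k * (q - u) ord0 k.
  have /andP[u1 u2] := zu' k; rewrite !rowBE.
  case: (qP k) => -[h ->].
  - rewrite ler0_norm; last by lra.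
    nra.
  - by rewrite subrr normr0 mulr0 mul0r.
  - rewrite ger0_norm; last by lra.
    nra.
have h2 : c ^+ 2 <= \sum_i (q - u) ord0 i ^+ 2.
  rewrite (bigD1 k0)//=; apply: ler_wpDr; first by rewrite sumr_ge0// => i _; exact: sqr_ge0.
  have /andP[u1 u2] := zu' k0; rewrite rowBE.
  move: yk0 (qP k0) u1 u2; rewrite -/(lo k0) -/c.
  move: (lo k0) (q ord0 k0) (u ord0 k0) => l qk uk yk0.
  case=> -[h ->]; [nra| |nra].
  by move: yk0 h; rewrite ltr_normr => /orP[] ? /andP[]; lra.
have h3 : c * enorm (y - q) <= \sum_i (y - q) ord0 i * (q - u) ord0 i.
  apply: le_trans (ler_sum _ (fun k _ => h1 k)); rewrite -mulr_sumr ler_wpM2l//.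
  rewrite enorm_le; last by rewrite sumr_ge0.
  rewrite expr2 mulr_suml; apply: ler_sum => i _.
  rewrite -[leLHS]ger0_norm ?sqr_ge0// normrX expr2 ler_wpM2l//.
  by rewrite (bigD1 i)//= lerDl sumr_ge0.
rewrite sqrrD enorm_sqr -addrA lerD2l addrC.
move: h2 h3; rewrite -[_ *+ 2]mulr_natl mulrC; nra.
Qed.

Let ctr : 'rV[R]_d := \row_k (N%:R * (z ord0 k)%:~R + N%:R / 2).
Let T : R := N%:R / 2 + (d + 4)%:R * sg.

Let dsg2 : (d + 2)%:R * sg = d%:R * sg + 2 * sg. Proof. by rewrite natrD mulrDl. Qed.
Let dsg4 : (d + 4)%:R * sg = d%:R * sg + 4 * sg. Proof. by rewrite natrD mulrDl. Qed.

Let near_ctr x : `|x - ctr| <= T -> forall m,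
  (forall k, `|sg * (m ord0 k)%:~R - x ord0 k| <= (d + 2)%:R * sg) ->
  near_shell z m.
Proof.
move=> xT m mx; apply/forallP => k.
have := le_trans (coord_le_norm _ k) xT; rewrite rowBE mxE /T => h.
have NE' : N%:R = sg * (K%:Z)%:~R by rewrite NE pmulrn.
have sw : shell_width%:Z%:~R = 2 * d%:R + 7 :> R by rewrite -pmulrn natrD natrM.
rewrite -!(ler_int R, ltr_int R) -(ler_pM2l sg0) -(ltr_pM2l sg0).
have -> : sg * (K%:Z * z ord0 k - shell_width%:Z)%:~R =
    N%:R * (z ord0 k)%:~R - sg * (2 * d%:R + 7).
  by rewrite NE' -sw rmorphB rmorphM /=; ring.
have -> : sg * (K%:Z * z ord0 k + K%:Z + shell_width%:Z)%:~R =
    N%:R * (z ord0 k)%:~R + N%:R + sg * (2 * d%:R + 7).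
  by rewrite NE' -sw !rmorphD rmorphM /=; ring.
have := mx k; move: h; rewrite dsg2 dsg4.
have -> : sg * (2 * d%:R + 7) = 2 * (d%:R * sg) + 7 * sg by ring.
move: (d%:R * sg) (sg * _) (N%:R * _) (x ord0 k) => e w l xk.
rewrite !ler_norml => /andP[h1 h2] /andP[h3 h4]; have := sg0; lra.
Qed.

(** No point of [V] lies at sup distance exactly [T] from the centre of the box, so [A] stays on one
    side of this barrier. Outside, [far_from_box] shows that closing the box changes nothing;
    inside, [A] would have to cross the sphere of radius [r] deep in the wall. *)
Lemma wall_joins :
  joins (closed_eball r) (esphere s) V ->
  joins (closed_eball r) (esphere s) (slack_voronoi s O (C `|` grid_box N z)).
Proof.
move=> [A [coA AV [x [Ax Bx]] [y [Ay Sy]]]].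
have N0 : 0 <= N%:R :> R by [].
have T0 : 0 < T by rewrite ltr_wpDl ?divr_ge0// mulr_gt0// ltr0n addn4.
have NE' : N%:R = sg * (K%:Z)%:~R by rewrite NE pmulrn.
have noT w : V w -> `|w - ctr| != T.
  move=> Vw; apply/eqP => wT; apply: (deep_in_wall _ Vw) => m mw; split.
    by apply: (near_ctr _ mw); rewrite wT.
  left; apply/forallPn.
  have [[i k] /= ik] : exists i, mx_norm (w - ctr) = `|(w - ctr) i.1 i.2|.
    by apply: mx_norm_neq0; rewrite -[mx_norm _]/(`|w - ctr|) wT gt_eqF.
  exists k; apply/negP => /andP[].
  move: ik; rewrite -[mx_norm _]/(`|w - ctr|) wT (ord1 i) rowBE mxE /T => h.
  rewrite -(ler_int R) -(ltr_int R) -(ler_pM2l sg0) -(ltr_pM2l sg0).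
  have -> : sg * (K%:Z * z ord0 k)%:~R = N%:R * (z ord0 k)%:~R.
    by rewrite NE' rmorphM /= -pmulrn; ring.
  have -> : sg * (K%:Z * z ord0 k + K%:Z)%:~R = N%:R * (z ord0 k)%:~R + N%:R.
    by rewrite NE' rmorphD rmorphM /= -pmulrn; ring.
  have := mw k; move: h; rewrite dsg2 dsg4.
  have e0 : 0 <= d%:R * sg by rewrite mulr_ge0// ltW.
  move: (d%:R * sg) e0 (sg * _) (N%:R * (z ord0 k)%:~R) (w ord0 k) => e e0 g l wk.
  rewrite ler_norml => h /andP[h3 h4] h5 h6; have := sg0.
  by move: h; case: ger0P; lra.
have : connected ((fun w => `|w - ctr|) @` A).
  apply: connected_continuous_connected => //.
  apply: continuous_subspaceT => w; have FF : Filter (nbhs w) by exact: nbhs_filter.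
  apply/(@cvgrPdist_lt _ _ _ (nbhs w) FF) => e e0.
  apply/nbhs_ballP; exists e => // v; rewrite mx_norm_ball /= => wv.
  apply: le_lt_trans wv; apply: le_trans (ler_dist_dist _ _) _.
  by rewrite opprB addrA subrK.
move/connected_intervalP => intA.
have noA u v : A u -> A v -> `|u - ctr| < T -> T < `|v - ctr| -> False.
  move=> Au Av uT Tv.
  have [w Aw wT] : ((fun w => `|w - ctr|) @` A) T.
    apply: (intA `|u - ctr| `|v - ctr|); [by exists u|by exists v|].
    by rewrite !ltW.
  by have := noT w (AV _ Aw); rewrite wT eqxx.
have [[w Aw wT]|inT] := pselect (exists2 w, A w & `|w - ctr| < T).
  (* the component stays close to the box but crosses the sphere [r] *)
  exfalso; have [v [Av Sv]] : A `&` esphere r !=set0.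
    apply: (connected_esphere coA _ _ rs); last by rewrite lexx rs.
      by exists x.
    by exists y; split=> //; rewrite /outer_eball /= Sy.
  have vT : `|v - ctr| <= T.
    by rewrite leNgt; apply/negP => /(noA _ _ Aw Av wT).
  apply: (deep_in_wall _ (AV _ Av)) => m mv; split; first exact: (near_ctr vT).
  by right; exists v.
exists A; split=> //; [|by exists x|by exists y].
move=> w Aw; apply: far_from_box (AV _ Aw).
have Tw : T < `|w - ctr|.
  rewrite lt_neqAle eq_sym (noT _ (AV _ Aw)) /= leNgt; apply/negP => wT.
  by apply: inT; exists w.
have [[i k] /= ik] : exists i, mx_norm (w - ctr) = `|(w - ctr) i.1 i.2|.
  apply: mx_norm_neq0; rewrite -[mx_norm _]/(`|w - ctr|) gt_eqF//.
  exact: lt_trans Tw.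
exists k; move: ik Tw; rewrite -[mx_norm _]/(`|w - ctr|) => ->.
rewrite (ord1 i) rowBE mxE /T; apply: le_lt_trans.
by rewrite lerD2l ler_wpM2r ?(ltW sg0)// ler_nat leq_addr.
Qed.

End wall_argument.

End macrocells.

(** * Volume of the walls *)

Section wall_count.
Context {R : realType} {d : nat}.
Variable sg : R.
Hypotheses (sg0 : 0 < sg) (d0 : (0 < d)%N).
Implicit Types (x y u : 'rV[R]_d) (z m : 'rV[int]_d).

(* Moving outwards in every coordinate strictly increases the norm. *)
Lemma near_sphere_diagonal r m m' : near_sphere sg r m -> near_sphere sg r m' ->
  (forall j, (0 <= m ord0 j) && (m ord0 j + (2 * d + 5)%:Z <= m' ord0 j) ||
             (m ord0 j < 0) && (m' ord0 j <= m ord0 j - (2 * d + 5)%:Z)) -> False.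
Proof.
move=> [x xr mx] [x' x'r mx'] mm.
suff H j : `|x ord0 j| < `|x' ord0 j|.
  have : enorm x ^+ 2 < enorm x' ^+ 2.
    rewrite !enorm_sqr; apply: ltr_sum.
      by rewrite (_ : has _ _) //; apply/hasP; exists (Ordinal d0); rewrite ?mem_index_enum.
    by move=> j _; rewrite -[ltLHS]ger0_norm ?sqr_ge0// -[ltRHS]ger0_norm ?sqr_ge0// !normrX ltr_pXn2r ?nnegrE.
  by rewrite xr x'r ltxx.
have := mx j; have := mx' j.
have -> : (d + 2)%:R * sg = d%:R * sg + 2 * sg by rewrite natrD mulrDl.
have e0 : 0 <= d%:R * sg by rewrite mulr_ge0// ltW.
have c5 : sg * (2 * d + 5)%:Z%:~R = 2 * (d%:R * sg) + 5 * sg.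
  by rewrite -pmulrn natrD natrM; ring.
have /orP[/andP[m0 m1]|/andP[m0 m1]] := mm j.
- have {m1} : sg * (m ord0 j)%:~R + sg * (2 * d + 5)%:Z%:~R <= sg * (m' ord0 j)%:~R.
    by rewrite -mulrDr -rmorphD /= ler_pM2l// ler_int.
  have {m0} : 0 <= sg * (m ord0 j)%:~R by rewrite mulr_ge0 ?ler0z// ltW.
  rewrite c5; move: (sg * (m ord0 j)%:~R) (sg * (m' ord0 j)%:~R) => a a'.
  move: (d%:R * sg) e0 (x ord0 j) (x' ord0 j) => e e0 v v' a0 aa'.
  rewrite !ler_norml => /andP[h1 h2] /andP[h3 h4]; have := sg0 => s0.
  have v'0 : 0 <= v' by lra.
  rewrite (ger0_norm v'0) ltr_norml; lra.
- have {m1} : sg * (m' ord0 j)%:~R <= sg * (m ord0 j)%:~R - sg * (2 * d + 5)%:Z%:~R.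
    by rewrite -mulrBr -rmorphB /= ler_pM2l// ler_int.
  have {m0} : sg * (m ord0 j)%:~R <= 0 by rewrite pmulr_rle0// lerz0 ltW.
  rewrite c5; move: (sg * (m ord0 j)%:~R) (sg * (m' ord0 j)%:~R) => a a'.
  move: (d%:R * sg) e0 (x ord0 j) (x' ord0 j) => e e0 v v' a0 aa'.
  rewrite !ler_norml => /andP[h1 h2] /andP[h3 h4]; have := sg0 => s0.
  have v'0 : v' <= 0 by lra.
  rewrite (ler0_norm v'0) ltr_norml; lra.
Qed.

Definition box_index (K : nat) z (k : {ffun 'I_d -> 'I_K}) : 'rV[int]_d :=
  \row_j (K%:Z * z ord0 j + (k j)%:Z).

Let k0 := (2 * d + 5)%N.

(** Shift the cells near the sphere outwards along a diagonal by [i * k0], for [i < T]. By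
    [near_sphere_diagonal] the shifted families are disjoint, and they fit in a box of side 2 K;
    hence the gain of a factor [T]. *)
Lemma card_near_sphere (T : nat) (r : R) z (K := (T * k0)%N) :
  (#|[set k : {ffun 'I_d -> 'I_K} | `[< near_sphere sg r (box_index z k) >]]%SET| * T
   <= (2 * K) ^ d)%N.
Proof.
set S := [set k | _]%SET.
(* In each coordinate all cells of the box lie on the same side of 0, given by the sign of
   [z ord0 j]. Reversing the index on the negative side makes outwards mean increasing. *)
have fP (k : {ffun 'I_d -> 'I_K}) (i : 'I_T) j :
    ((if (0 <= z ord0 j)%R then k j : nat else (K.-1 - k j)%N) + i * k0 < 2 * K)%N.
  have := ltn_ord (k j); have := ltn_ord i => iT kK.
  have : (i * k0 + k0 <= K)%N by rewrite /K -mulSnr leq_mul2r iT orbT.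
  have : (0 < k0)%N by rewrite /k0 addnS.
  by case: ifP => _; move: kK; rewrite -/K; lia.
pose f (ki : {ffun 'I_d -> 'I_K} * 'I_T) : {ffun 'I_d -> 'I_(2 * K)} :=
  [ffun j => Ordinal (fP ki.1 ki.2 j)].
have -> : (#|S| * T = #|finset.setX S [set: 'I_T]%SET|)%N.
  by rewrite finset.cardsX finset.cardsT card_ord.
have fE k i k' i' : f (k, i) = f (k', i') -> forall j,
    ((if (0 <= z ord0 j)%R then k j : nat else (K.-1 - k j)%N) + i * k0 =
    (if (0 <= z ord0 j)%R then k' j : nat else (K.-1 - k' j)%N) + i' * k0)%N.
  by move=> /ffunP ff j; have := ff j; rewrite !ffunE => -[].
have lt_absurd k i k' i' : f (k, i) = f (k', i') -> (i < i')%N -> k \in S -> k' \in S -> False.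
  move=> /fE ff ii; rewrite !finset.inE => /asboolP kS /asboolP k'S.
  apply: (near_sphere_diagonal k'S kS) => j; rewrite !mxE.
  have := ff j; have := ltn_ord (k j); have := ltn_ord (k' j).
  have : (i * k0 + k0 <= i' * k0)%N by rewrite -mulSnr leq_mul2r ii orbT.
  rewrite -/k0; move: (i * k0)%N (i' * k0)%N (nat_of_ord (k j)) (nat_of_ord (k' j)) => a b u v.
  have [z0|z0] := leP 0 (z ord0 j) => ab vK uK e.
    have : 0 <= K%:Z * z ord0 j by rewrite mulr_ge0.
    by move: (K%:Z * z ord0 j) => w w0; lia.
  have : K%:Z * z ord0 j <= - K%:Z.
    have : z ord0 j + 1 <= 0 by rewrite lezD1.
    move: (z ord0 j) => w w1; nia.
  by move: (K%:Z * z ord0 j) uK vK e => w; lia.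
apply: (@leq_trans #|f @: finset.setX S [set: 'I_T]%SET|%SET); last first.
  by apply: leq_trans (max_card _) _; rewrite card_ffun !card_ord.
rewrite card_in_imset// => -[k i] [k' i'] /finset.setXP[kS _] /finset.setXP[k'S _] ff.
have [ii|ii|ii] := ltngtP i i'.
- by case: (lt_absurd _ _ _ _ ff ii).
- by case: (lt_absurd _ _ _ _ (esym ff) ii).
- move/val_inj: ii => ii; rewrite -ii in ff *; congr pair; apply/ffunP => j.
  have := fE _ _ _ _ ff j; have := ltn_ord (k j); have := ltn_ord (k' j).
  move=> h1 h2 /addIn; case: ifP => _ h; apply: val_inj => //=.
  by move: h1 h2 h; move: (nat_of_ord (k j)) (nat_of_ord (k' j)); lia.
Qed.

Definition shell_index (K : nat) z (k : {ffun 'I_d -> 'I_(K + 2 * @shell_width d)}) : 'rV[int]_d :=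
  \row_j (K%:Z * z ord0 j - (@shell_width d)%:Z + (k j)%:Z).

Lemma near_shell_index (K : nat) z m : near_shell K z m ->
  exists k, m = shell_index (K := K) z k.
Proof.
clear sg0 d0; move=> /forallP mz.
have kP j : (`|(m ord0 j - (K%:Z * z ord0 j - (@shell_width d)%:Z))%R|%N < K + 2 * @shell_width d)%N.
  have := mz j; move: (K%:Z * z ord0 j) (m ord0 j) (@shell_width d) => w a b; lia.
exists [ffun j => Ordinal (kP j)]; apply/rowP => j; rewrite !mxE ffunE /=.
have := mz j; rewrite (ord1 ord0); move: (K%:Z * z ord0 j) (m ord0 j) (@shell_width d) => w a b; lia.
Qed.

Definition wall_indices (K : nat) (r : R) z :=
  [set k | `[< wall sg K r z (shell_index (K := K) z k) >]]%SET.

(** A wall cell is a cell of the shell outside the box or a cell of the box near the sphere. *)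
Lemma card_wall_indices (T : nat) (r : R) z (K := (T * k0)%N) :
  (#|wall_indices K r z| <=
   ((K + 2 * @shell_width d) ^ d - K ^ d) +
   #|[set k : {ffun 'I_d -> 'I_K} | `[< near_sphere sg r (box_index z k) >]]%SET|)%N.
Proof.
clear sg0 d0; set S := [set k | _]%SET.
have gP (k : {ffun 'I_d -> 'I_K}) j : (@shell_width d + k j < K + 2 * @shell_width d)%N.
  by have := ltn_ord (k j); lia.
pose g (k : {ffun 'I_d -> 'I_K}) : {ffun 'I_d -> 'I_(K + 2 * @shell_width d)} :=
  [ffun j => Ordinal (gP k j)].
have gE k : shell_index z (g k) = box_index z k.
  by apply/rowP => j; rewrite !mxE ffunE /=; lia.
have ginj : injective g.
  move=> k k' /ffunP gg; apply/ffunP => j; have := gg j; rewrite !ffunE => -[] /addnI h.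
  exact: val_inj.
have in_boxP k : in_box K z (shell_index z k) -> exists k', k = g k'.
  move=> /forallP h.
  have kP j : (k j - @shell_width d < K)%N.
    have := h j; rewrite mxE; have := ltn_ord (k j).
    move: (K%:Z * z ord0 j) => w; lia.
  exists [ffun j => Ordinal (kP j)]; apply/ffunP => j; apply: val_inj; rewrite !ffunE /=.
  have := h j; rewrite mxE [in RHS]ffunE /=; move: (K%:Z * z ord0 j) => w; lia.
apply: (@leq_trans #|(~: (g @: [set: _])) :|: (g @: S)|%SET).
  apply/subset_leq_card/fintype.subsetP => k; rewrite !finset.inE => /asboolP[_ kw].
  have [|kb] := boolP (k \in (g @: [set: {ffun 'I_d -> 'I_K}])%SET); last by [].
  move=> /imsetP[k' _ kE] /=; apply/imsetP; exists k' => //; rewrite finset.inE; apply/asboolP.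
  rewrite -gE -kE; case: kw => // /negP[]; apply/forallP => j.
  by rewrite kE gE mxE lerDl ltrD2l ltz_nat ltn_ord.
apply: leq_trans (leq_card_setU _ _) _; apply: leq_add; last by rewrite card_imset.
rewrite finset.cardsCs finset.setCK card_imset// finset.cardsT !card_ffun !card_ord.
exact: leqnn.
Qed.

End wall_count.

Lemma shell_arith (F : realFieldType) (a e x y : F) : 0 <= a -> 0 <= x ->
  y <= 1 + (e - 1) * x -> e * x <= 20^-1 -> a * y - a <= a / 20.
Proof.
move=> a0 x0 h x1; have : a * y <= a * (1 + 20^-1) by apply: ler_wpM2l => //; lra.
lra.
Qed.

Lemma sphere_arith (F : realFieldType) (s e k v : F) : 0 <= s -> 1 <= e -> 1 <= v ->
  s * (40 * e * v) <= e * k -> s <= k / 40.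
Proof.
move=> s0 e1 v1 h.
have : e * (s * 40) <= e * k.
  apply: le_trans h; have -> : s * (40 * e * v) = e * (s * 40) * v by ring.
  by rewrite ler_peMr// !mulr_ge0//; lra.
rewrite ler_pM2l; lra.
Qed.

Lemma wall_arith (F : realFieldType) (w c s k : F) : 0 <= k -> w <= c + s ->
  c <= k / 20 -> s <= k / 40 -> 10 * w <= k.
Proof. lra. Qed.

(** The factor 40 * 2 ^ d * w in [T] brings the shell below K^d / 20 and the cells near the sphere
    below K^d / 40. Counts are compared in [rat] because [K] is chosen before the field [R]. *)
Lemma wall_scale_exists (d : nat) : (0 < d)%N -> exists K : nat,
  [/\ (d < K)%N, (@shell_width d <= K)%N &
  forall (R : realType) (sg r : R) (z : 'rV[int]_d), 0 < sg ->
    (10 * #|wall_indices sg K r z| <= K ^ d)%N].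
Proof.
move=> d0; set w := @shell_width d; pose k0 := (2 * d + 5)%N.
pose T := (40 * 2 ^ d * w)%N; pose K := (T * k0)%N.
have w0 : (0 < w)%N by rewrite /w /shell_width addnS.
have X0 : (0 < 2 ^ d)%N by rewrite expn_gt0.
have T0 : (0 < T)%N by rewrite /T !muln_gt0 X0 w0.
have wT : (w <= T)%N by rewrite /T leq_pmull// muln_gt0 X0.
have TK : (T <= K)%N by rewrite /K leq_pmulr// /k0 addnS.
exists K; split.
- by apply: leq_trans TK; apply: leq_trans wT; rewrite /w /shell_width; lia.
- exact: leq_trans wT TK.
move=> R sg r z sg0.
set W := #|wall_indices sg K r z|.
set S := #|[set k : {ffun 'I_d -> 'I_K} | `[< near_sphere sg r (box_index z k) >]]%SET|.
have h1 : (W <= ((K + 2 * w) ^ d - K ^ d) + S)%N := card_wall_indices sg T r z.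
have h2 : (S * T <= (2 * K) ^ d)%N := card_near_sphere sg0 d0 T r z.
rewrite -(ler_nat rat) in h1; rewrite -(ler_nat rat) in h2.
rewrite -(ler_nat rat).
have K0 : (0 < K)%N by exact: leq_trans TK.
have Kq : 0 < K%:R :> rat by rewrite ltr0n.
(* Chord bound for a convex function on [0, 1]. *)
have bern (n : nat) (x : rat) : 0 <= x <= 1 -> (1 + x) ^+ n <= 1 + (2 ^+ n - 1) * x.
  move=> /andP[x0 x1]; elim: n => [|n IH]; first by rewrite !expr0 subrr mul0r addr0.
  rewrite exprS; apply: (@le_trans _ _ ((1 + x) * (1 + (2 ^+ n - 1) * x))).
    by rewrite ler_wpM2l// addr_ge0.
  have : 1 <= 2 ^+ n :> rat by rewrite exprn_ege1// ler1n.
  rewrite exprS; move: (2 ^+ n) => e e1.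
  have : 0 <= (e - 1) * (x * (1 - x)) by rewrite !mulr_ge0 ?subr_ge0.
  lra.
have e2 : (2 ^ d)%:R = 2 ^+ d :> rat by rewrite natrX.
have X1 : 1 <= 2 ^+ d :> rat by rewrite exprn_ege1// ler1n.
have shell : ((K + 2 * w) ^ d - K ^ d)%N%:R <= K%:R ^+ d / 20 :> rat.
  rewrite natrB ?leq_exp2r ?leq_addr// !natrX natrD natrM.
  have -> : K%:R + 2 * w%:R = K%:R * (1 + 2 * w%:R / K%:R) :> rat by field; rewrite gt_eqF.
  have x1 : 2 ^+ d * (2 * w%:R / K%:R) <= 20^-1 :> rat.
    rewrite mulrA ler_pdivrMr// /K /T !natrM e2.
    have k01 : 1 <= k0%:R :> rat by rewrite ler1n /k0 addnS.
    rewrite mulrCA; have : 0 <= 2 ^+ d * w%:R :> rat by rewrite mulr_ge0// ltW.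
    rewrite -[40 * 2 ^+ d * w%:R]mulrA; move: (2 ^+ d * w%:R) => a a0; nra.
  have x0 : 0 <= 2 * w%:R / K%:R :> rat by rewrite divr_ge0// mulr_ge0.
    have xle1 : 2 * w%:R / K%:R <= 1 :> rat.
    by move: x0 x1 X1; move: (2 * w%:R / K%:R) (2 ^+ d) => x y; nra.
  have h : (1 + 2 * w%:R / K%:R) ^+ d <= 1 + (2 ^+ d - 1) * (2 * w%:R / K%:R) :> rat.
    by apply: bern; rewrite x0.
  rewrite exprMn; apply: shell_arith h x1 => //; exact: exprn_ge0.
have sphere : S%:R <= K%:R ^+ d / 40 :> rat.
  rewrite natrM natrX natrM exprMn in h2.
  have w1 : 1 <= w%:R :> rat by rewrite ler1n.
  have TE : T%:R = 40 * 2 ^+ d * w%:R :> rat by rewrite /T !natrM e2.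
  have S0 : 0 <= S%:R :> rat by [].
  by rewrite TE in h2; exact: sphere_arith S0 X1 w1 h2.
rewrite natrM natrX; rewrite natrD in h1.
by apply: wall_arith h1 shell sphere; exact: exprn_ge0.
Qed.

Lemma card_bigcup_le (I J : finType) (P : pred J) (F : J -> {set I}) (c : nat) :
  (forall k, P k -> #|F k| <= c)%N -> (#|\bigcup_(k | P k) F k| <= #|P| * c)%N.
Proof.
move=> Fc; rewrite -sum_nat_const; apply: (@leq_trans (\sum_(k | P k) #|F k|)%N).
  elim/big_rec2: _ => [|k A n _ An]; first by rewrite finset.cards0.
  by apply: leq_trans (leq_card_setU _ _) _; rewrite leq_add2l.
exact: leq_sum.
Qed.

(** * The discretised model *)

Section discrete_model.
Context {R : realType} {d : nat} {I : finType}.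
Variables (pos : I -> 'rV[R]_d) (N K q : nat) (sg v kap r s : R).
Hypotheses (sg0 : 0 < sg) (NE : N%:R = sg * K%:R) (q0 : (0 < q)%N).
Hypotheses (v01 : 0 <= v <= 1) (vq : v * (q ^ d)%:R = sg ^+ d).
Hypotheses (kap_le : 0 <= kap <= sg) (rs : r <= s).
Hypotheses (dK : (d < K)%N) (wK : (@shell_width d <= K)%N).
Hypothesis wall_card : forall z : 'rV[int]_d, (10 * #|wall_indices sg K r z| <= K ^ d)%N.
Implicit Types (a b A B : {set I}) (z m : 'rV[int]_d) (zs us : seq 'rV[int]_d).

Definition cell_sites m := [set i | macrocell sg (pos i) == m]%SET.
Definition box_sites z := [set i | `[< grid_box N z (pos i) >]]%SET.
Definition wall_sites z := [set i | `[< wall sg K r z (macrocell sg (pos i)) >]]%SET.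

Hypothesis cell_sites_le : forall m, (#|cell_sites m| <= q ^ d)%N.

Let v0 : 0 <= v. Proof. by case/andP: v01. Qed.
Let NdE : sg ^+ d * (K ^ d)%:R = (N ^ d)%:R.
Proof. by rewrite !natrX NE exprMn. Qed.

Lemma card_box_sites z : v * #|box_sites z|%:R <= (N ^ d)%:R.
Proof.
have : (#|box_sites z| <= K ^ d * q ^ d)%N.
  have -> : (K ^ d = #|[pred k : {ffun 'I_d -> 'I_K} | true]|)%N.
    by rewrite card_ffun !card_ord.
  apply: leq_trans (card_bigcup_le (F := fun k => cell_sites (box_index z k)) _); last first.
    by move=> k _; exact: cell_sites_le.
  apply/subset_leq_card/fintype.subsetP => i; rewrite finset.inE => /asboolP /(grid_boxE sg0 NE) h.
  have kP j : (`|(macrocell sg (pos i) ord0 j - K%:Z * z ord0 j)%R|%N < K)%N.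
    by have := h j; move: (K%:Z * z ord0 j) (macrocell _ _ _ _) => w a; lia.
  apply/bigcupP; exists [ffun j => Ordinal (kP j)] => //; rewrite finset.inE.
  apply/eqP/rowP => j; rewrite [RHS]mxE ffunE /=.
  by have := h j; move: (K%:Z * z ord0 j) (macrocell _ _ _ _) => w a; lia.
rewrite -(ler_nat R) natrM => h; rewrite -NdE -vq mulrAC -mulrA.
by rewrite ler_wpM2l.
Qed.

Lemma card_wall_sites z : v * #|wall_sites z|%:R <= (N ^ d)%:R / 10.
Proof.
have : (#|wall_sites z| <= #|wall_indices sg K r z| * q ^ d)%N.
  apply: leq_trans (card_bigcup_le (P := mem (wall_indices sg K r z)) (F := fun k => cell_sites (shell_index z k)) _); last first.
    by move=> k _; exact: cell_sites_le.
  apply/subset_leq_card/fintype.subsetP => i; rewrite finset.inE => /asboolP h.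
  have [k kE] := near_shell_index h.1.
  apply/bigcupP; exists k; last by rewrite finset.inE kE.
  by rewrite inE /= finset.inE -kE; apply/asboolP.
rewrite -(ler_nat R) natrM => h; rewrite -NdE -vq mulrAC -!mulrA ler_wpM2l//.
apply: le_trans h _; rewrite mulrC ler_wpM2l//.
by rewrite [leRHS]mulrC ler_pdivlMr// mulrC -natrM ler_nat.
Qed.

Definition sites_at a : set 'rV[R]_d := [set x | exists2 i, i \in a & x = pos i].

(** Restricting the truncation to the boxes of [zs] allows installing it one box at a time. *)
Definition closed_region zs b : set 'rV[R]_d := sites_at b `|`
  [set x | exists z, [/\ z \in zs, (2 * N ^ d < #|b :&: box_sites z|%SET)%N & grid_box N z x]].

Definition joins_event (C : {set I} -> set 'rV[R]_d) a b : bool :=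
  `[< joins (closed_eball r) (esphere s) (slack_voronoi N kap s (sites_at a) (C b)) >].

Lemma sites_atS a a' : a \subset a' -> sites_at a `<=` sites_at a'.
Proof. by move=> /fintype.subsetP aa x [i ia ->]; exists i => //; exact: aa. Qed.

Lemma joinsS (V W : set 'rV[R]_d) : V `<=` W ->
  joins (closed_eball r) (esphere s) V -> joins (closed_eball r) (esphere s) W.
Proof. by move=> VW [C [coC CV CB CS]]; exists C; split=> // x /CV/VW. Qed.

Lemma closed_regionS zs b b' : b' \subset b -> closed_region zs b' `<=` closed_region zs b.
Proof.
move=> bb x [/(sites_atS bb)|[z [zz h zx]]]; [by left|right; exists z; split=> //].
by apply: (leq_trans h); apply/subset_leq_card/finset.setSI.
Qed.

Lemma joins_event_mono C : (forall b b', b' \subset b -> C b' `<=` C b) ->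
  mono_event (joins_event C).
Proof.
move=> CS a a' b b' aa bb /asboolP h; apply/asboolP; apply: joinsS h.
by apply: slack_voronoi_mono; [exact: sites_atS|exact: CS].
Qed.

Lemma disjoint_boxes z z' : z != z' -> (box_sites z :&: box_sites z')%SET = finset.set0.
Proof.
move=> zz; apply/eqP/finset.set0Pn => -[i]; rewrite !finset.inE => /andP[/asboolP h /asboolP h'].
move/eqP: zz; apply; apply/rowP => j.
have /(grid_boxE sg0 NE)/(_ j) := h; have /(grid_boxE sg0 NE)/(_ j) := h'.
have : (0 < K)%N by exact: leq_ltn_trans dK.
rewrite (ord1 ord0); move: (z _ _) (z' _ _) (macrocell _ _ _ _) => a a' m; nia.
Qed.

(** Instance of [trunc_step] in which [H] asks the sprinkle to hit every macro-cell of the wall and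
    [Fb] fills the box whatever its number of closed sites. *)
Lemma trunc_box_step zs z (lam : I -> R) (e : R) :
  z \notin zs -> 0 < e <= 1 -> (forall i, 0 <= lam i) ->
  (forall i, bump lam e (wall_sites z) i <= 1) ->
  (forall m, near_shell K z m -> #|cell_sites m| = q ^ d)%N ->
  expR (N ^ d)%:R / 2 ^+ (2 * N ^ d) <= 2^-1 * (expR (- 2) * e * expR (- ((N ^ d)%:R / 10))) ->
  (K ^ d)%:R * expR (- (e * sg ^+ d)) <= 2^-1 ->
  Epair v lam (joins_event (closed_region zs)) <=
  Epair v (bump lam e (wall_sites z)) (joins_event (closed_region (z :: zs))).
Proof.
move=> zzs /andP[e0 e1] l0 l1 full hb hH.
set B := wall_sites z.
pose wsets := [seq cell_sites (shell_index z k) | k <- enum (wall_indices sg K r z)].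
(* In a cell of volume at most 1, raising the open intensity by [e] increases the occupation
   probability by at least the share e^(-2) e of its new value. *)
pose th := 1 - expR (- 2) * e.
have x20 := expR_gt0 (- 2 : R).
have x21 : expR (- 2) <= 1 :> R by rewrite -[leRHS]expR0 ler_expR oppr_le0.
have xe1 : expR (- 2) * e <= 1 by rewrite mulr_ile1// ltW.
have xe0 : 0 <= expR (- 2) * e by rewrite mulr_ge0// ltW.
apply: (@trunc_step _ _ v lam e th B (box_sites z) (2 * N ^ d)
  (fun A : {set I} => all (fun C : {set I} => ~~ (fintype.disjoint (mem A) (mem C))) wsets)
  _ _ (joins_event (fun b => closed_region zs b `|` grid_box N z))) => //.
- exact: ltW.
- by rewrite /th; lra.
- move=> i iB; rewrite /th.
  have := l1 i; rewrite /bump iB mulr1 => le1; have li := l0 i.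
  have v1 : v <= 1 by case/andP: v01.
  set x := v * lam i; set y := v * e.
  have -> : v * (lam i + e) = x + y by rewrite /x /y; ring.
  have x0 : 0 <= x by rewrite mulr_ge0.
  have y0 : 0 <= y by rewrite mulr_ge0// ltW.
  have xy1 : x + y <= v by rewrite /x /y -mulrDr ler_piMr.
  (* (1 - th) (1 - e^{-x-y}) <= e^{-2} e v <= e^{-x} (1 - e^{-y}) *)
  have h1 : 1 - expR (- (x + y)) <= v.
    by have := expR_ge1Dx (- (x + y)); lra.
  have h2 : expR (- 2) * y <= expR (- x) - expR (- (x + y)).
    have -> : expR (- x) - expR (- (x + y)) = expR (- (x + y)) * (expR y - 1).
      by rewrite mulrBr mulr1 -expRD; congr (expR _ - _); ring.
    have v2 : v <= 2 by lra.
    have := expR_ge1Dx y => ey; apply: ler_pM; [exact: ltW x20|exact: y0| |lra].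
    by rewrite ler_expR lerN2; exact: le_trans xy1 v2.
  have : expR (- 2) * e * (1 - expR (- (x + y))) <= expR (- 2) * e * v.
    by rewrite ler_wpM2l.
  have -> : expR (- 2) * e * v = expR (- 2) * y by rewrite /y; ring.
  rewrite mulrBl mul1r; lra.
- have t0 i : 0 <= v * e * (i \in B)%:R by rewrite !mulr_ge0// ltW.
  apply: le_trans (Ex_hit _ wsets t0).
  rewrite /wsets big_map big_enum /=.
  have -> : \sum_(k in wall_indices sg K r z)
     expR (- \sum_(i <- index_enum I | i \in cell_sites (shell_index z k)) v * e * (i \in B)%:R) =
     \sum_(k in wall_indices sg K r z) expR (- (e * sg ^+ d)).
    apply: eq_bigr => k; rewrite finset.inE => /asboolP kw; congr (expR (- _)).
    rewrite (eq_bigr (fun=> v * e)); last first.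
      move=> i; rewrite finset.inE => /eqP ik; rewrite /B finset.inE ik.
      by rewrite (asboolT kw) mulr1.
    rewrite sumr_const full; last exact: kw.1.
    by rewrite -mulr_natr -vq; ring.
  rewrite sumr_const -[_ *+ #|_|]mulr_natl.
  have : #|wall_indices sg K r z|%:R * expR (- (e * sg ^+ d)) <= (K ^ d)%:R * expR (- (e * sg ^+ d)).
    rewrite ler_wpM2r ?expR_ge0// ler_nat; apply: leq_trans (wall_card z).
    by rewrite leq_pmull.
  lra.
- apply: (@le_trans _ _ (expR (N ^ d)%:R / 2 ^+ (2 * N ^ d))).
    by rewrite ler_wpM2r ?invr_ge0 ?exprn_ge0// ler_expR card_box_sites.
  apply: le_trans hb _; rewrite ler_wpM2l// /th opprB addrC subrK ler_wpM2l//.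
  by rewrite ler_expR lerN2 card_wall_sites.
- by apply: joins_event_mono => b b'; exact: closed_regionS.
- apply: joins_event_mono => b b' bb x [/(closed_regionS bb)|]; [by left|by right].
- move=> a b c cL /asboolP h; apply/asboolP; apply: joinsS h.
  apply: slack_voronoi_mono => // x [[[i]|[z' [z'zs]]]|]; last by right.
    rewrite finset.inE => /orP[ib xi|ic ->]; first by left; left; exists i.
    by right; apply/asboolP; have := fintype.subsetP cL _ ic; rewrite finset.inE.
  (* Boxes are disjoint, so new closed sites in the box of [z] leave the counts of all other boxes
     unchanged. *)
  have zz' : z != z' by apply: contraNneq zzs => ->.
  have -> : ((b :|: c) :&: box_sites z' = b :&: box_sites z')%SET.
    rewrite finset.setIUl; have /finset.setIidPl <- := cL.
    by rewrite -finset.setIA disjoint_boxes// finset.setI0 finset.setU0.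
  by move=> h zx; left; right; exists z'.
- move=> a b /asboolP h; apply/asboolP; apply: joinsS h.
  apply: slack_voronoi_mono => // x [xb|[z' [/[!inE]/orP[/eqP->|z'zs] h zx]]].
  + by left; left.
  + by right.
  + by left; right; exists z'.
- move=> a b bm /asboolP h; apply/asboolP; apply: joinsS h.
  apply: slack_voronoi_mono => // x [xb|[z' [/[!inE]/orP[/eqP->|z'zs] h zx]]].
  + by left.
  + by move: h; rewrite ltnNge bm.
  + by right; exists z'.
- move=> a b c aB /allP cH cB /asboolP h; apply/asboolP.
  apply: (wall_joins sg0 NE kap_le rs _ _ h).
  + move=> x [i ia ->] iw; move: aB; rewrite finset.disjoints_subset => /fintype.subsetP/(_ _ ia).
    by rewrite !finset.inE => /negP; apply; apply/asboolP.
  + move=> m mw; have [k kE] := near_shell_index mw.1.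
    have : ~~ fintype.disjoint (mem c) (mem (cell_sites (shell_index z k))).
      by apply: cH; apply: map_f; rewrite mem_enum finset.inE; apply/asboolP; rewrite -kE.
    rewrite -finset.setI_eq0 => /finset.set0Pn[j]; rewrite finset.inE => /andP[jc].
    rewrite finset.inE -kE => /eqP jm; exists (pos j) => //.
    by left; exists j => //; rewrite finset.inE jc orbT.
Qed.

(* [us]: macro-cells in which a void of radius [N] is still counted as
   belonging to the Voronoi set *)
Definition void_voronoi us a b : set 'rV[R]_d := [set y | enorm y <= s /\
  (slack_voronoi N kap s (sites_at a) (sites_at b) y \/
   macrocell sg y \in us /\ forall j, j \in b -> N%:R <= enorm (y - pos j))].

Definition void_event us a b : bool :=
  `[< joins (closed_eball r) (esphere s) (void_voronoi us a b) >].

Let cell_close y i : macrocell sg (pos i) = macrocell sg y -> enorm (y - pos i) < N%:R.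
Proof.
move=> iy; apply: (@le_lt_trans _ _ (d%:R * sg)).
  apply: enorm_le_sup; first exact: ltW.
  by move=> k; rewrite rowBE; apply: macrocell_dist.
by rewrite NE mulrC ltr_pM2l// ltr_nat.
Qed.

(** If [y] in the macro-cell [m] has no closed site within [N], then no closed site was sprinkled in
    [m], as it would be at distance at most d sg < N. The open sprinkle is then nonempty, and it
    puts [y] in the truncated set. *)
Lemma void_cell_step us m (lam : I -> R) (e : R) :
  0 <= e -> (forall i, 0 <= lam i) -> (forall i, bump lam e (cell_sites m) i <= 1) ->
  #|cell_sites m| = (q ^ d)%N -> expR (- (e * sg ^+ d)) <= 2^-1 ->
  Epair v lam (void_event (m :: us)) <= Epair v (bump lam e (cell_sites m)) (void_event us).
Proof.
move=> e0 l0 l1 full he; apply: void_step => //.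
  by rewrite full -mulrA mulrCA vq.
move=> a b c c' cB c'B cc /asboolP h; apply/asboolP; apply: joinsS h.
move=> y [ys [yV|[my far]]]; split=> //.
  left; apply: slack_voronoi_mono yV; first by apply: sites_atS; exact: finset.subsetUl.
  by apply: sites_atS; exact: finset.subsetUl.
have far' j : j \in b -> N%:R <= enorm (y - pos j).
  by move=> jb; apply: far; rewrite finset.inE jb.
move: my; rewrite inE => /orP[/eqP ym|my]; last by right; split.
left; have [c'0|/finset.set0Pn[j jc]] := eqVneq c' finset.set0; last first.
  have := far j; rewrite finset.inE jc orbT => /(_ isT); rewrite leNgt cell_close//.
  by have := fintype.subsetP c'B _ jc; rewrite finset.inE ym => /eqP.
move: cc; rewrite c'0 eqxx /= => /finset.set0Pn[i ic].
have iy : enorm (y - pos i) < N%:R.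
  by apply: cell_close; have := fintype.subsetP cB _ ic; rewrite finset.inE ym => /eqP.
have k0 : 0 <= kap by case/andP: kap_le.
have ia : sites_at (a :|: c)%SET (pos i) by exists i => //; rewrite finset.inE ic orbT.
split=> //; first by exists (pos i) => //; lra.
move=> u [j jb ->]; exists (pos i) => //; have := far' j jb; lra.
Qed.

(** V(p) as seen from a finite window: up to [kap], closed sites at distance [L] or more impose
    nothing, since an open point outside the window may be closer. *)
Definition old_voronoi (L : R) a b : set 'rV[R]_d := [set y | enorm y <= s /\
  forall j, j \in b -> L <= enorm (y - pos j) + kap \/
    exists2 i, i \in a & enorm (y - pos i) <= enorm (y - pos j) + kap].

Definition old_event (L : R) a b : bool :=
  `[< joins (closed_eball r) (esphere s) (old_voronoi L a b) >].

(** A point with a closed site within [N] has an open site within N + kap; any other point is a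
    void, which [us] tolerates throughout the ball. *)
Lemma old_void L us a b : N%:R + kap <= L ->
  (forall y, enorm y <= s -> macrocell sg y \in us) ->
  old_event L a b -> void_event us a b.
Proof.
move=> NL cov /asboolP h; apply/asboolP; apply: joinsS h => y [ys yV]; split=> //.
have [far|/existsNP[j /not_implyP[jb /negP]]] :=
    pselect (forall j, j \in b -> N%:R <= enorm (y - pos j)).
  by right; split=> //; exact: cov.
rewrite -ltNge => jN; left.
have [|[i ia yi]] := yV j jb; first by lra.
split=> //; first by exists (pos i); [exists i|lra].
move=> u [j' j'b ->]; have [h|h] := ltP (enorm (y - pos j')) N%:R.
  have [|[i' i'a yi']] := yV j' j'b; first by lra.
  by exists (pos i') => //; exists i'.
exists (pos i); [by exists i|lra].
Qed.

Lemma void_cells us (lam : I -> R) (e : R) : 0 <= e ->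
  expR (- (e * sg ^+ d)) <= 2^-1 ->
  (forall m, m \in us -> #|cell_sites m| = q ^ d)%N ->
  (forall i, 0 <= lam i) ->
  (forall i, lam i + e * (\sum_(m <- us) (i \in cell_sites m))%:R <= 1) ->
  Epair v lam (void_event us) <=
  Epair v (fun i => lam i + e * (\sum_(m <- us) (i \in cell_sites m))%:R) (void_event [::]).
Proof.
move=> e0 he; elim: us lam => [|m us IH] lam full l0 l1.
  by rewrite (_ : (fun i => _) = lam)//; apply/funext => i; rewrite big_nil mulr0 addr0.
have bE i : lam i + e * (\sum_(m' <- m :: us) (i \in cell_sites m'))%:R =
    bump lam e (cell_sites m) i + e * (\sum_(m' <- us) (i \in cell_sites m'))%:R.
  by rewrite big_cons natrD /bump; ring.
have b1 i : bump lam e (cell_sites m) i <= 1.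
  by apply: le_trans (l1 i); rewrite bE lerDl mulr_ge0.
apply: le_trans (void_cell_step _ _ _ b1 _ _) _ => //.
  by apply: full; rewrite mem_head.
rewrite (_ : (fun i => lam i + _) = (fun i => bump lam e (cell_sites m) i +
    e * (\sum_(m' <- us) (i \in cell_sites m'))%:R)); last exact/funext.
apply: IH => [m' m'us|i|i]; first by apply: full; rewrite inE m'us orbT.
  by rewrite /bump addr_ge0// mulr_ge0.
by rewrite -bE.
Qed.

Lemma trunc_boxes zs (lam : I -> R) (e : R) : 0 < e <= 1 -> uniq zs ->
  expR (N ^ d)%:R / 2 ^+ (2 * N ^ d) <= 2^-1 * (expR (- 2) * e * expR (- ((N ^ d)%:R / 10))) ->
  (K ^ d)%:R * expR (- (e * sg ^+ d)) <= 2^-1 ->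
  (forall z m, z \in zs -> near_shell K z m -> #|cell_sites m| = q ^ d)%N ->
  (forall i, 0 <= lam i) ->
  (forall i, lam i + e * (\sum_(z <- zs) (i \in wall_sites z))%:R <= 1) ->
  Epair v lam (joins_event (closed_region [::])) <=
  Epair v (fun i => lam i + e * (\sum_(z <- zs) (i \in wall_sites z))%:R)
    (joins_event (closed_region zs)).
Proof.
move=> /andP[e0 e1] + hb hH; elim: zs => [|z zs IH] /= uzs full l0 l1.
  by rewrite (_ : (fun i => _) = lam)//; apply/funext => i; rewrite big_nil mulr0 addr0.
have /andP[zzs {}uzs] := uzs.
pose lam' i := lam i + e * (\sum_(z' <- zs) (i \in wall_sites z'))%:R.
have bE i : lam i + e * (\sum_(z' <- z :: zs) (i \in wall_sites z'))%:R = bump lam' e (wall_sites z) i.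
  by rewrite big_cons natrD /bump /lam'; ring.
have l'1 i : lam' i <= 1.
  by apply: le_trans (l1 i); rewrite bE /bump lerDl mulr_ge0// ltW.
apply: le_trans (IH uzs _ l0 l'1) _.
  by move=> z' m z'zs; apply: full; rewrite inE z'zs orbT.
rewrite (_ : (fun i => lam i + e * (\sum_(z' <- z :: zs) _)%:R) = bump lam' e (wall_sites z)); last exact/funext.
apply: trunc_box_step => //.
- by rewrite e0.
- by move=> i; rewrite /lam' addr_ge0// mulr_ge0// ltW.
- by move=> i; rewrite -bE.
- by move=> m; apply: full; rewrite mem_head.
Qed.

(** Since [shell_width <= K], a wall extends at most one box beyond its own: in each coordinate its
    index differs by at most 1 from that of the box of the site. *)
Lemma wall_multiplicity zs i : uniq zs -> (\sum_(z <- zs) (i \in wall_sites z) <= 3 ^ d)%N.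
Proof.
move=> uzs; rewrite -big_mkcond/= sum1_count -size_filter.
have K0 : (0 < K)%N by exact: leq_ltn_trans dK.
pose w : 'rV[int]_d := \row_j ((macrocell sg (pos i) ord0 j) %/ K%:Z)%Z.
pose f (t : {ffun 'I_d -> 'I_3}) : 'rV[int]_d := \row_j (w ord0 j + (t j)%:Z - 1).
have -> : (3 ^ d = size [seq f t | t <- enum {ffun 'I_d -> 'I_3}])%N.
  by rewrite size_map -cardT card_ffun !card_ord.
apply: uniq_leq_size; first exact: filter_uniq.
move=> z; rewrite mem_filter finset.inE => /andP[/asboolP[/forallP zw _] _].
have tP j : (`|(z ord0 j - w ord0 j + 1)%R|%N < 3)%N /\ 0 <= z ord0 j - w ord0 j + 1.
  have := zw j; rewrite /w mxE.
  have := divz_eq (macrocell sg (pos i) ord0 j) K%:Z.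
  have : (0 <= (macrocell sg (pos i) ord0 j %% K%:Z)%Z < K%:Z).
    by rewrite modz_ge0 ?ltz_pmod// -?lt0n// gt_eqF.
  move: wK K0; move: (macrocell _ _ _ _) (z ord0 j) (_ %/ _)%Z (_ %% _)%Z (@shell_width d) => m zj u t sw.
  move=> swK K0 tK -> h.
  have Kp : 0 < K%:Z by [].
  have a1 : K%:Z * (zj - u) < K%:Z * 2 by lia.
  have a2 : K%:Z * (u - zj) < K%:Z * 2 by lia.
  rewrite !ltr_pM2l// in a1 a2; split; lia.
apply/mapP; exists [ffun j => Ordinal (tP j).1]; first by rewrite mem_enum.
apply/rowP => j; rewrite !mxE ffunE /=; have [] := tP j.
rewrite /w !mxE (ord1 ord0); move: (z _ _) (_ %/ _)%Z => a b; lia.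
Qed.

Lemma cell_multiplicity us i : uniq us -> (\sum_(m <- us) (i \in cell_sites m) <= 1)%N.
Proof.
move=> uus; rewrite -big_mkcond/= sum1_count.
rewrite (eq_count (a2 := pred1 (macrocell sg (pos i)))); last first.
  by move=> m; rewrite finset.inE eq_sym.
by rewrite count_uniq_mem// leq_b1.
Qed.

(** Half of [eps] is spent on the voids, with at most one macro-cell per site, and half on the
    walls, with at most 3 ^ d of them per site; hence the value of [e]. *)
Lemma discrete_comparison us zs (p eps L : R) : 0 < eps -> 0 <= p -> p + eps <= 1 ->
  uniq us -> uniq zs -> N%:R + kap <= L ->
  (forall y, enorm y <= s -> macrocell sg y \in us) ->
  (forall m, m \in us -> #|cell_sites m| = q ^ d)%N ->
  (forall z m, z \in zs -> near_shell K z m -> #|cell_sites m| = q ^ d)%N ->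
  let e := eps / (2 * 3 ^+ d) in
  expR (- (eps / 2 * sg ^+ d)) <= 2^-1 ->
  expR (N ^ d)%:R / 2 ^+ (2 * N ^ d) <= 2^-1 * (expR (- 2) * e * expR (- ((N ^ d)%:R / 10))) ->
  (K ^ d)%:R * expR (- (e * sg ^+ d)) <= 2^-1 ->
  Epair v (fun=> p) (old_event L) <= Epair v (fun=> p + eps) (joins_event (closed_region zs)).
Proof.
move=> eps0 p0 p1 uus uzs NL cov fullu fullz e he hb hH.
have T0 : 0 < 3 ^+ d :> R by rewrite exprn_gt0.
have T1 : 1 <= 3 ^+ d :> R by rewrite exprn_ege1// ler1n.
have e0 : 0 < e by rewrite divr_gt0// mulr_gt0.
have eT : e * 3 ^+ d = eps / 2 by rewrite /e; field; rewrite gt_eqF.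
have e1 : e <= 1.
  have : e <= e * 3 ^+ d by rewrite ler_peMr// ltW.
  by rewrite eT; lra.
have hc i : eps / 2 * (\sum_(m <- us) (i \in cell_sites m))%:R <= eps / 2.
  by rewrite ler_piMr ?lern1 ?cell_multiplicity//; lra.
have hw i : e * (\sum_(z <- zs) (i \in wall_sites z))%:R <= eps / 2.
  by rewrite -eT ler_wpM2l ?(ltW e0)// -natrX ler_nat wall_multiplicity.
have hc0 i : 0 <= eps / 2 * (\sum_(m <- us) (i \in cell_sites m))%:R :> R.
  by rewrite mulr_ge0//; lra.
have hw0 i : 0 <= e * (\sum_(z <- zs) (i \in wall_sites z))%:R :> R.
  by rewrite mulr_ge0// ltW.
apply: (@le_trans _ _ (Epair v (fun=> p) (void_event us))).
  apply: Ex_le => [i|a _]; first by rewrite mulr_ge0.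
  apply: Ex_le => [i|b _]; first by rewrite mulr_ge0// subr_ge0; lra.
  rewrite ler_nat; have := old_void (a := a) (b := b) NL cov.
  by case: (old_event _ _ _) => //; case: (void_event _ _ _) => //; move=> /(_ isT).
have l1 i : p + eps / 2 * (\sum_(m <- us) (i \in cell_sites m))%:R <= 1.
  by have := hc i; lra.
apply: le_trans (void_cells _ he fullu (fun=> p0) l1) _; first by lra.
set lam := fun i => p + _.
have lam0 i : 0 <= lam i by rewrite /lam addr_ge0.
apply: (@le_trans _ _ (Epair v lam (joins_event (closed_region [::])))).
  apply: Ex_le => [i|a _]; first by rewrite mulr_ge0.
  apply: Ex_le => [i|b _]; first by rewrite mulr_ge0// subr_ge0 l1.
  rewrite ler_nat; suff : void_event [::] a b -> joins_event (closed_region [::]) a b.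
    by case: (void_event _ _ _) => //; case: (joins_event _ _ _) => //; move=> /(_ isT).
  move=> /asboolP h; apply/asboolP; apply: joinsS h => y [_ [|[]//]].
  apply: slack_voronoi_mono => // x [//|[z []]].
  by rewrite in_nil.
have l2 i : lam i + e * (\sum_(z <- zs) (i \in wall_sites z))%:R <= 1.
  by rewrite /lam; have := hc i; have := hw i; lra.
have e01 : 0 < e <= 1 by rewrite e0.
apply: le_trans (trunc_boxes e01 uzs hb hH fullz lam0 l2) _.
apply: Epair_le => //.
- move=> i; rewrite addr_ge0//= /lam.
  by have := hc i; have := hw i; lra.
- by apply: joins_event_mono => b b'; exact: closed_regionS.
Qed.

End discrete_model.

(** * Occupancy of cells by the Poisson process *)

Section Ex_lists.
Context {R : realType}.

Lemma Ex_cat (J : finType) (t : J -> R) s1 s2 f :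
  Ex t (s1 ++ s2) f = Ex t s1 (fun A => Ex t s2 (fun B => f (A :|: B)%SET)).
Proof.
elim: s1 f => [|i s IH] f /=; first by apply: eq_Ex => B; rewrite finset.set0U.
rewrite !IH; congr (_ + _ * _).
by apply: eq_Ex => A; apply: eq_Ex => B; rewrite finset.setUA.
Qed.

Lemma Ex_map (I J : finType) (g : I -> J) (t : J -> R) s f :
  Ex t (map g s) f = Ex (t \o g) s (fun A => f (g @: A)%SET).
Proof.
elim: s f => [|i s IH] f /=; first by rewrite imset0.
rewrite !IH; congr (_ + _ * _).
by apply: eq_Ex => A; rewrite imsetU1.
Qed.

End Ex_lists.

Section occupancy.
Context {R : realType} {d : nat} {dT : measure_display} {T : measurableType dT}.
Variables (P : probability T R) (eta : T -> set ('rV[R]_d * R)).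
Hypothesis eta_poisson : poisson_process P ([set: 'rV[R]_d] `*` `[0, 1])
  (lebesgue_rV d \x @lebesgue_measure R)%E eta.

Section family.
Context {J : finType}.
Variables (B : J -> set ('rV[R]_d * R)) (t : J -> R).
Hypotheses (mB : forall j, measurable (B j))
  (BD : forall j, B j `<=` [set: 'rV[R]_d] `*` `[0, 1]).

Definition occupied w : {set J} := [set j | `[< eta w `&` B j !=set0 >]]%SET.

Lemma num_points_eq0 w j : (num_points (eta w) (B j) = 0)%E <-> j \notin occupied w.
Proof.
rewrite finset.inE /num_points; split=> [h|h].
  apply/negP => /asboolP; apply/set0P/negP/negPn/eqP.
  move: h; rewrite /counting; case: asboolP => // fX /eqP.
  by rewrite eqe pnatr_eq0 finmap.cardfs_eq0 => /eqP/(fset_set_set0 fX).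
have -> : eta w `&` B j = set0.
  by apply: contrapT => /eqP/set0P h'; move/negP: h; apply; apply/asboolP.
exact: measure0.
Qed.

Lemma measurable_occupied1 j : measurable [set w | j \in occupied w].
Proof.
have -> : [set w | j \in occupied w] =
    ~` ((fun w => num_points (eta w) (B j)) @^-1` [set 0%E]).
  apply/seteqP; split=> w /=; first by move=> jw /num_points_eq0; rewrite jw.
  by move=> h; apply: contrapT => /negP/num_points_eq0.
apply: measurableC.
have := pp_measurable eta_poisson (mB j) (@BD j) measurableT (emeasurable_set1 0%E).
by rewrite setTI.
Qed.

Lemma measurable_occupied (Psi : {set J} -> Prop) : measurable [set w | Psi (occupied w)].
Proof.
have -> : [set w | Psi (occupied w)] = \bigcup_(X in [set X : {set J} | Psi X])
    \bigcap_(j in [set: J]) [set w | (j \in occupied w) = (j \in X)].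
  apply/seteqP; split=> w /=.
    by move=> h; exists (occupied w).
  move=> [X PX h]; rewrite (_ : occupied w = X)//.
  by apply/finset.setP => j; exact: h.
apply: fin_bigcup_measurable; first exact: finite_finset.
move=> X _; apply: fin_bigcap_measurable; first exact: finite_finset.
move=> j _; case: (j \in X); first exact: measurable_occupied1.
rewrite (_ : [set w | _] = ~` [set w | j \in occupied w]).
  exact/measurableC/measurable_occupied1.
by apply/seteqP; split=> w /=; [move=> ->|move/negP/negbTE].
Qed.

Hypotheses (t0 : forall j, 0 <= t j)
  (muB : forall j, (lebesgue_rV d \x @lebesgue_measure R)%E (B j) = (t j)%:E)
  (tB : trivIset [set: J] B).

Definition occ_weight j (b : bool) : R := if b then 1 - expR (- t j) else expR (- t j).

Lemma prob_vacant j : P [set w | j \notin occupied w] = (expR (- t j))%:E.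
Proof.
have -> : [set w | j \notin occupied w] = [set w | num_points (eta w) (B j) = 0%:R%:E].
  by apply/seteqP; split=> w /= /num_points_eq0.
rewrite (pp_poisson eta_poisson (mB j) (@BD j)); last by rewrite muB ltry.
rewrite muB /= /poisson_prob; case: ifPn => tj; last first.
  have -> : t j = 0 by apply/eqP; rewrite eq_le t0 andbT leNgt.
  by rewrite oppr0 expR0 diracE mem_set.
rewrite esum_set1//.
  by rewrite /poisson_pmf tj expr0 fact0 invr1 !mul1r.
by rewrite lee_fin poisson_pmf_ge0.
Qed.

Lemma prob_occ j b : P [set w | (j \in occupied w) = b] = (occ_weight j b)%:E.
Proof.
case: b => /=; last first.
  by rewrite -prob_vacant; congr (P _); apply/seteqP; split=> w /=; [move=> ->|move/negbTE].
rewrite EFinB -prob_vacant.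
rewrite (_ : [set w | _] = ~` [set w | j \notin occupied w]).
  by rewrite probability_setC//; exact: (measurable_occupied (fun X => j \notin X)).
by apply/seteqP; split=> w /=; [move=> ->|move/negP/negPn].
Qed.

Lemma prob_assignment (s : seq J) (sig : J -> bool) : uniq s ->
  P [set w | forall j, j \in s -> (j \in occupied w) = sig j] =
  (\prod_(j <- s) occ_weight j (sig j))%:E.
Proof.
move=> us.
(* Independence is applied to the whole family, with a trivial constraint off [s]. *)
pose A (i : 'I_#|J|) : set (\bar R) := if enum_val i \in s then
  (if sig (enum_val i) then ~` [set 0%E] else [set 0%E]) else setT.
have mA i : measurable (A i).
  rewrite /A; case: ifP => _ //; case: ifP => _; last exact: emeasurable_set1.
  exact/measurableC/emeasurable_set1.
have AE w i : A i (num_points (eta w) (B (enum_val i))) <->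
    (enum_val i \in s -> (enum_val i \in occupied w) = sig (enum_val i)).
  rewrite /A; case: ifP => _; last by split.
  case: (sig _); split=> /=.
  - by move=> h _; apply: contrapT => /negP/num_points_eq0.
  - by move=> /(_ isT) h /num_points_eq0; rewrite h.
  - by move=> /num_points_eq0/negbTE.
  - by move=> /(_ isT) h; apply/num_points_eq0; rewrite h.
have -> : [set w | forall j, j \in s -> (j \in occupied w) = sig j] =
    [set w | forall i, A i (num_points (eta w) (B (enum_val i)))].
  apply/seteqP; split=> w /= h; first by move=> i; apply/AE/h.
  by move=> j; have /AE := h (enum_rank j); rewrite enum_rankK.
rewrite (pp_independent eta_poisson) //; last first.
  move=> i j _ _ [x [Bi Bj]]; apply: enum_val_inj; apply: tB => //.
  by exists x.
transitivity (\prod_(i < #|J|) (if enum_val i \in s then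
    occ_weight (enum_val i) (sig (enum_val i)) else 1)%:E)%E.
  apply: eq_bigr => i _.
  have -> : [set w | A i (num_points (eta w) (B (enum_val i)))] =
     [set w | enum_val i \in s -> (enum_val i \in occupied w) = sig (enum_val i)].
    by apply/seteqP; split=> w /= /AE.
  case: ifP => _; last by rewrite (_ : [set w | _] = setT) ?probability_setT//; apply/seteqP; split.
  by rewrite -prob_occ; congr (P _); apply/seteqP; split=> w /=; [apply|].
rewrite prodEFin; congr EFin.
rewrite -(big_enum_val (fun j => if j \in s then occ_weight j (sig j) else 1)).
rewrite /= -big_mkcond big_uniq//=.
Qed.

(** Sites are revealed one at a time, following the recursion of [Ex]. The list [s0] keeps those
    already revealed, so that independence enters only at the end, through [prob_assignment]. *)
Lemma prob_occupied_aux (s s0 : seq J) (sig : J -> bool) (Phi : pred {set J}) :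
  uniq (s0 ++ s) ->
  P [set w | (forall j, j \in s0 -> (j \in occupied w) = sig j) /\
             Phi [set j in s | j \in occupied w]%SET] =
  ((\prod_(j <- s0) occ_weight j (sig j)) * Ex t s (fun X => (Phi X)%:R))%:E.
Proof.
elim: s s0 sig Phi => [|i s IH] s0 sig Phi us /=.
  have E (w : T) : [set j in [::] | j \in occupied w]%SET = finset.set0.
    by apply/finset.setP => j; rewrite !finset.inE.
  have us0 : uniq s0 by move: us; rewrite cats0.
  have [P0|P0] := boolP (Phi finset.set0).
    rewrite mulr1 -prob_assignment//; congr (P _).
    by apply/seteqP; split=> w; [case|move=> h; split=> //; rewrite E].
  rewrite mulr0 -[RHS](measure0 P); congr (P _).
  apply/seteqP; split=> w // [_ h]; exfalso; move/negP: P0; apply.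
  by rewrite -(E w).
have i0 : i \notin s0.
  by move: us; rewrite cat_uniq => /and3P[_ /hasPn/(_ i (mem_head _ _))].
pose sg b j := if j == i then b else sig j.
have us' : uniq (rcons s0 i ++ s) by rewrite cat_rcons.
have h0 := IH (rcons s0 i) (sg false) Phi us'.
have h1 := IH (rcons s0 i) (sg true) (fun X => Phi (i |: X)%SET) us'.
have prodE b : \prod_(j <- rcons s0 i) occ_weight j (sg b j) =
    (\prod_(j <- s0) occ_weight j (sig j)) * occ_weight i b.
  rewrite -cats1 big_cat big_seq1 /sg eqxx /=; congr (_ * _).
  apply: eq_big_seq => j js0; case: eqP => // ji.
  by move: i0; rewrite -ji js0.
rewrite prodE in h0; rewrite prodE in h1.
have sgE b w : (forall j, j \in rcons s0 i -> (j \in occupied w) = sg b j) <->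
    (forall j, j \in s0 -> (j \in occupied w) = sig j) /\ (i \in occupied w) = b.
  split=> [h|[h ib] j].
    split=> [j js0|]; last by rewrite h ?mem_rcons ?mem_head// /sg eqxx.
    rewrite h; last by rewrite mem_rcons inE js0 orbT.
    by rewrite /sg; case: eqP => // ji; move: i0; rewrite -ji js0.
  rewrite mem_rcons inE /sg => /predU1P[->|js0]; first by rewrite eqxx.
  by case: eqP => [->//|_]; exact: h.
have occE w : [set j in i :: s | j \in occupied w]%SET =
    if i \in occupied w then (i |: [set j in s | j \in occupied w])%SET
    else [set j in s | j \in occupied w]%SET.
  move: (occupied w) => X; apply/finset.setP => j.
  case: ifP => iw; rewrite !(finset.inE, inE).
    by case: eqP => [->|_] //=; rewrite iw.
  by case: eqP => [->|_] //=; rewrite iw andbF.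
set A0 := [set w | _] in h0; set A1 := [set w | _] in h1.
have -> : [set w | (forall j, j \in s0 -> (j \in occupied w) = sig j) /\
     Phi [set j in i :: s | j \in occupied w]%SET] = A0 `|` A1.
  apply/seteqP; split=> w /=.
    move=> [h]; rewrite occE; case: ifP => iw hP; [right|left]; split=> //;
      exact/sgE.
  by case=> -[/sgE[h iw] hP]; split=> //; rewrite occE iw.
have mX : measurable A0 := measurable_occupied (fun X => (forall j, j \in rcons s0 i -> (j \in X) = sg false j) /\
             Phi [set j in s | j \in X]%SET).
have mY : measurable A1 := measurable_occupied (fun X => (forall j, j \in rcons s0 i -> (j \in X) = sg true j) /\
             Phi (i |: [set j in s | j \in X])%SET).
have A01 : A0 `&` A1 = set0.
  apply/seteqP; split=> w //= [[/sgE[_ h] _] [/sgE[_ h'] _]].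
  by rewrite h in h'.
have -> : P (A0 `|` A1) = (P A0 + P A1)%E by exact: measureU.
rewrite h0 h1 -EFinD; congr EFin; rewrite /occ_weight; ring.
Qed.

Lemma prob_occupied (s : seq J) (Phi : pred {set J}) : uniq s -> (forall j, j \in s) ->
  P [set w | Phi (occupied w)] = (Ex t s (fun X => (Phi X)%:R))%:E.
Proof.
move=> us sJ; have := @prob_occupied_aux s [::] (fun=> true) Phi us.
rewrite big_nil mul1r => <-; congr (P _); apply/seteqP; split=> w /=.
  move=> h; split=> //; rewrite (_ : [set j in _ | _]%SET = occupied w)//.
  by apply/finset.setP => j; rewrite finset.inE sJ.
move=> [_]; rewrite (_ : [set j in _ | _]%SET = occupied w)//.
by apply/finset.setP => j; rewrite finset.inE sJ.
Qed.

End family.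

End occupancy.

Section cubes.
Context {R : realType} {d : nat}.

Definition cube (a : 'rV[R]_d) (h : R) : set 'rV[R]_d :=
  [set x | forall k, a ord0 k <= x ord0 k < a ord0 k + h].

Lemma measurable_cube a h : measurable (cube a h).
Proof.
rewrite (_ : cube a h = \bigcap_(k in [set: 'I_d])
    ((fun v : 'rV[R]_d => v ord0 k) @^-1` `[a ord0 k, a ord0 k + h[)).
  apply: fin_bigcap_measurable; first exact: finite_finset.
  move=> k _; rewrite -[X in measurable X]setTI; apply: measurable_rV_coord => //.
by apply/seteqP; split=> x /= hx k; [move=> _|have := hx k I]; rewrite ?in_itv//=; exact: hx.
Qed.

Lemma lebesgue_cube a h : 0 < h -> lebesgue_rV d (cube a h) = (h ^+ d)%:E.
Proof.
move=> h0; pose A (k : 'I_d) := [set` `[a ord0 k, a ord0 k + h[].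
have -> : cube a h = [set v : 'rV[R]_d | forall k, A k (v ord0 k)].
  by apply/seteqP; split=> x /= hx k; have := hx k; rewrite /A /= in_itv.
have mA k : measurable (A k) by exact: measurable_itv.
rewrite (@lebesgue_rV_box R d A mA).
transitivity (\prod_(k < d) h%:E)%E; last by rewrite prodEFin prodr_const card_ord.
apply: eq_bigr => k _; rewrite lebesgue_measure_itv /= lte_fin ltrDl h0 -EFinB.
by rewrite addrC addKr.
Qed.

End cubes.

Section fine_cells.
Context {R : realType} {d : nat}.
Variables (h : R) (H : nat).
Hypothesis h0 : 0 < h.

Definition site_index : finType := {ffun 'I_d -> 'I_(2 * H)}.

Definition site_pos (i : site_index) : 'rV[R]_d :=
  \row_k (h * ((i k)%:R - H%:R)).

Definition fine_cell (i : site_index) : set 'rV[R]_d :=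
  cube (site_pos i) h.

Lemma measurable_fine_cell i : measurable (fine_cell i).
Proof. exact: measurable_cube. Qed.

Lemma lebesgue_fine_cell i : lebesgue_rV d (fine_cell i) = (h ^+ d)%:E.
Proof. exact: lebesgue_cube. Qed.

Lemma fine_cell_inj i j x : fine_cell i x -> fine_cell j x -> i = j.
Proof.
move=> ix jx; apply/ffunP => k; apply: val_inj => /=.
have := ix k; have := jx k; rewrite !mxE => /andP[a1 a2] /andP[b1 b2].
have c1 : h * (i k)%:R < h * (j k).+1%:R by rewrite -natr1; lra.
have c2 : h * (j k)%:R < h * (i k).+1%:R by rewrite -natr1; lra.
rewrite !ltr_pM2l// !ltr_nat !ltnS in c1 c2.
by apply/eqP; rewrite eqn_leq c1 c2.
Qed.

Lemma fine_cell_pos i : fine_cell i (site_pos i).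
Proof. by move=> k; rewrite lexx ltrDl. Qed.

Definition sites_of (O : set 'rV[R]_d) : {set site_index} :=
  [set i | `[< exists2 x, O x & fine_cell i x >]]%SET.

Definition marked_cell (p : R) (j : site_index + site_index) : set ('rV[R]_d * R) :=
  match j with
  | inl i => fine_cell i `*` `[0, p]
  | inr i => fine_cell i `*` `]p, 1]
  end.

Context {dT : measure_display} {T : measurableType dT}.
Variables (P : probability T R) (eta : T -> set ('rV[R]_d * R)).
Hypothesis eta_poisson : poisson_process P ([set: 'rV[R]_d] `*` `[0, 1])
  (lebesgue_rV d \x @lebesgue_measure R)%E eta.
Variable p : R.
Hypothesis p01 : 0 <= p <= 1.

Let B := marked_cell p.

Let mB j : measurable (B j).
Proof. by case: j => i; apply: measurableX => //; exact: measurable_fine_cell. Qed.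

Let BD j : B j `<=` [set: 'rV[R]_d] `*` `[0, 1].
Proof.
have /andP[p0 p1] := p01.
case: j => i [x t] /= [_]; rewrite !in_itv /= => /andP[a b]; split=> //.
  by rewrite a (le_trans b).
by rewrite b (le_trans p0 (ltW a)).
Qed.

Definition cell_rate (j : site_index + site_index) : R :=
  match j with inl _ => h ^+ d * p | inr _ => h ^+ d * (1 - p) end.

Let rate0 j : 0 <= cell_rate j.
Proof.
have /andP[p0 p1] := p01.
by case: j => i /=; rewrite mulr_ge0 ?exprn_ge0 ?subr_ge0// ltW.
Qed.

Let muB j : (lebesgue_rV d \x @lebesgue_measure R)%E (B j) = (cell_rate j)%:E.
Proof.
have /andP[p0 p1] := p01.
have pE i (C : set R) : measurable C ->
    (lebesgue_rV d \x @lebesgue_measure R)%E (fine_cell i `*` C) = ((h ^+ d)%:E * lebesgue_measure C)%E.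
  move=> mC; rewrite -(lebesgue_fine_cell i); apply: product_measure1E => //.
  exact: measurable_fine_cell.
case: j => i; rewrite /B /= pE//.
  rewrite lebesgue_measure_itv /= lte_fin; case: ltP => //= pp; first by rewrite sube0 EFinM.
  have -> : p = 0 by apply/eqP; rewrite eq_le p0 pp.
  by rewrite mulr0 mule0.
rewrite lebesgue_measure_itv /= lte_fin; case: ltP => //= pp.
have -> : p = 1 by apply/eqP; rewrite eq_le pp p1.
by rewrite subrr mulr0 mule0.
Qed.

Let tB : trivIset [set: site_index + site_index] B.
Proof.
move=> [i|i] [j|j] _ _ [[x t] [[/= ix it] [/= jx jt]]].
- by rewrite (fine_cell_inj ix jx).
- by move: it jt; rewrite !in_itv /= => /andP[_ a] /andP[b _]; have := lt_le_trans b a; rewrite ltxx.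
- by move: it jt; rewrite !in_itv /= => /andP[b _] /andP[_ a]; have := lt_le_trans b a; rewrite ltxx.
- by rewrite (fine_cell_inj ix jx).
Qed.

Let occ_inl w i : (inl i \in occupied eta B w) = (i \in sites_of (open_points (eta w) p)).
Proof.
rewrite !finset.inE; apply/asboolP/asboolP.
  by move=> [[x t] [Ex [/= ix it]]]; exists x => //; exists t.
by move=> [x [t tp Ex] ix]; exists (x, t).
Qed.

Let occ_inr w i : (inr i \in occupied eta B w) = (i \in sites_of (closed_points (eta w) p)).
Proof.
rewrite !finset.inE; apply/asboolP/asboolP.
  by move=> [[x t] [Ex [/= ix it]]]; exists x => //; exists t.
by move=> [x [t tp Ex] ix]; exists (x, t).
Qed.

Let occE (Psi : {set site_index} -> {set site_index} -> Prop) :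
  [set w | Psi (sites_of (open_points (eta w) p)) (sites_of (closed_points (eta w) p))] =
  [set w | (fun X : {set site_index + site_index} => Psi [set i | inl i \in X]%SET [set i | inr i \in X]%SET)
    (occupied eta B w)].
Proof.
apply/seteqP; split=> w /=.
  by congr (Psi _ _); apply/finset.setP => i; rewrite [RHS]finset.inE ?occ_inl ?occ_inr.
by congr (Psi _ _); apply/finset.setP => i; rewrite [LHS]finset.inE ?occ_inl ?occ_inr.
Qed.

Lemma measurable_sites (Psi : {set site_index} -> {set site_index} -> Prop) :
  measurable [set w | Psi (sites_of (open_points (eta w) p)) (sites_of (closed_points (eta w) p))].
Proof. by rewrite occE; exact: (measurable_occupied eta_poisson mB (@BD) (fun X => Psi [set i | inl i \in X]%SET [set i | inr i \in X]%SET)). Qed.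

Lemma prob_sites (Phi : {set site_index} -> {set site_index} -> bool) :
  P [set w | Phi (sites_of (open_points (eta w) p)) (sites_of (closed_points (eta w) p))] =
  (Epair (h ^+ d) (fun=> p) Phi)%:E.
Proof.
rewrite (occE Phi).
set s := (map inl (index_enum site_index) ++ map inr (index_enum site_index)) : seq (site_index + site_index).
have us : uniq s.
  rewrite cat_uniq !map_inj_uniq ?index_enum_uniq//=; try by move=> ? ? [].
  by rewrite andbT; apply/hasPn => x /mapP[i _ ->]; apply/mapP => -[].
have sJ j : j \in s.
  by rewrite mem_cat; case: j => i; apply/orP; [left|right]; apply: map_f; rewrite mem_index_enum.
rewrite (prob_occupied eta_poisson mB (@BD) rate0 muB tB (fun X => Phi [set i | inl i \in X]%SET [set i | inr i \in X]%SET) us sJ).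
congr EFin; rewrite Ex_cat Ex_map /Epair.
apply: eq_Ex => a; rewrite Ex_map; apply: eq_Ex => b.
congr (_%:R); congr (nat_of_bool (Phi _ _)); apply/finset.setP => i; rewrite !finset.inE.
  rewrite mem_imset; last by move=> ? ? [].
  by case: imsetP => [[]//|_]; rewrite orbF.
rewrite orbC mem_imset; last by move=> ? ? [].
by case: imsetP => [[]//|_]; rewrite orbF.
Qed.

End fine_cells.

(** * Limits of fine meshes *)

Section slack.
Context {R : realType} {d : nat}.
Implicit Types (x y o : 'rV[R]_d) (O C : set 'rV[R]_d) (Phi : set ('rV[R]_d -> R)).

(* [y] is closer to [O], up to [e], than every constraint of [Phi]; the
   constraints are distances to points, or the constant [N] of the truncated
   model. *)
Definition slack O Phi (e : R) y : Prop :=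
  forall phi, Phi phi -> exists2 o, O o & enorm (y - o) < phi y + e.

(** Asking for every error above [e] replaces a distance that need not be attained. It makes the set
    closed, and error 0 gives exactly the Voronoi sets. *)
Definition slack_set O Phi (e : R) : set 'rV[R]_d :=
  [set y | forall e', e < e' -> slack O Phi e' y].

Definition lip Phi := forall phi, Phi phi -> forall y y', phi y <= phi y' + enorm (y - y').

Definition dist_constraints C : set ('rV[R]_d -> R) :=
  [set (fun y => enorm (y - x)) | x in C].

Definition trunc_constraints (c : R) C : set ('rV[R]_d -> R) :=
  dist_constraints C `|` [set (fun=> c)].

Lemma lip_dist C : lip (dist_constraints C).
Proof.
move=> _ [x Cx <-] y y' /=; rewrite [leRHS]addrC; exact: enorm_triangle.
Qed.

Lemma lip_trunc c C : lip (trunc_constraints c C).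
Proof.
move=> phi [/lip_dist //|->] y y'; by rewrite lerDl enorm_ge0.
Qed.

Lemma closed_slack_set O Phi e : lip Phi -> closed (slack_set O Phi e).
Proof.
move=> lPhi y cly e' ee' phi Pphi.
pose t := (e' - e) / (4 * (d%:R + 1)).
have d1 : 0 < d%:R + 1 :> R by rewrite ltr_wpDl.
have t0 : 0 < t by rewrite divr_gt0 ?subr_gt0// mulr_gt0.
have [|y' [yS yy']] := cly (ball y t); first exact: nbhsx_ballx.
have {}yy' : enorm (y - y') <= (e' - e) / 4.
  apply: le_trans (enorm_le_norm _) _; move: yy'; rewrite mx_norm_ball /= => /ltW h.
  apply: (@le_trans _ _ (d%:R * t)); first by rewrite ler_wpM2l.
  rewrite /t mulrA ler_pdivrMr ?mulr_gt0//.
  rewrite (_ : _ / 4 * _ = (e' - e) * (d%:R + 1)); last by field.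
  by rewrite mulrC ler_wpM2l ?subr_ge0 1?ltW// ltrDl.
have [|x Ox xy] := yS ((e' + e) / 2) _ phi Pphi; first by lra.
exists x => //; apply: le_lt_trans (enorm_triangle _ y' _) _.
have := lPhi phi Pphi y' y; rewrite (enormB y'); lra.
Qed.

Lemma slack_set0E O Phi : slack_set O Phi 0 = \bigcap_(e in [set e : R | 0 < e]) slack_set O Phi e.
Proof.
apply/seteqP; split=> y h.
  by move=> e /= e0 e' ee'; apply: h; exact: lt_trans ee'.
by move=> e e0; apply: (h (e / 2)); rewrite /=; lra.
Qed.

Lemma connects_slack_limit (r s : R) O Phi : lip Phi ->
  (forall e, 0 < e -> joins (closed_eball r) (esphere s) (slack_set O Phi e `&` closed_eball s)) ->
  connects r s (slack_set O Phi 0).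
Proof.
move=> lPhi h.
have : joins (closed_eball r) (esphere s)
    (\bigcap_(e in [set e : R | 0 < e]) (slack_set O Phi e `&` closed_eball s)).
  apply: (@joins_directed _ _ _ _ _ (closed_eball s)) => //.
  - exact: compact_closed_eball.
  - exact: closed_closed_eball.
  - split; first by exists 1 => /=.
    move=> i j i0 j0; exists (Num.min i j); first by rewrite /= lt_min i0.
    move=> y [yS yB]; split; split=> // e' ee'; apply: yS; rewrite gt_min ee' ?orbT//.
  - by move=> e _; apply: closedI; [exact: closed_slack_set|exact: closed_closed_eball].
  - exact: closed_closed_eball.
  - exact: closed_esphere.
move=> [A [coA AS AB AC]]; apply/connectsP; exists A; split=> // y /AS hy.
by rewrite slack_set0E => e e0; case: (hy e e0).
Qed.

Lemma dist_to_le (c : R) O y : (dist_to y O <= c%:E)%E <->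
  forall e, 0 < e -> exists2 o, O o & enorm (y - o) < c + e.
Proof.
split=> [h e e0|h].
  have : (dist_to y O < (c + e)%:E)%E by apply: le_lt_trans h _; rewrite lte_fin ltrDl.
  by move=> /ereal_inf_lt[_ [x Ox <-]]; rewrite lte_fin => xy; exists x.
apply/lee_addgt0Pr => e e0; have [x Ox xy] := h e e0.
apply: (@le_trans _ _ (enorm (y - x))%:E).
  by apply: ereal_inf_lbound; exists x.
by rewrite -EFinD lee_fin ltW.
Qed.

Lemma dist_to_leP O C y : (dist_to y O <= dist_to y C)%E <->
  forall x, C x -> (dist_to y O <= (enorm (y - x))%:E)%E.
Proof.
split=> [h x Cx|h].
  by apply: le_trans h _; apply: ereal_inf_lbound; exists x.
by apply: le_ereal_inf_tmp => _ [x Cx <-]; exact: h.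
Qed.

Lemma voronoiE (E : set ('rV[R]_d * R)) p :
  voronoi E p = slack_set (open_points E p) (dist_constraints (closed_points E p)) 0.
Proof.
apply/seteqP; split=> y.
  move=> /dist_to_leP h e e0 _ [x Cx <-].
  by have /dist_to_le/(_ e e0) := h x Cx.
move=> h; apply/dist_to_leP => x Cx; apply/dist_to_le => e e0.
by apply: (h e e0 (fun y => enorm (y - x))); exists x.
Qed.

Lemma trunc_voronoiE N (E : set ('rV[R]_d * R)) p :
  trunc_voronoi N E p = slack_set (open_points E p) (trunc_constraints N%:R (trunc_closed_points N E p)) 0.
Proof.
apply/seteqP; split=> y.
  rewrite /trunc_voronoi /= le_min => /andP[/dist_to_leP h /dist_to_le h'] e e0 phi [[x Cx <-]|->].
    by have /dist_to_le/(_ e e0) := h x Cx.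
  exact: h'.
move=> h; rewrite /trunc_voronoi /= le_min; apply/andP; split.
  apply/dist_to_leP => x Cx; apply/dist_to_le => e e0.
  by apply: (h e e0 (fun y => enorm (y - x))); left; exists x.
by apply/dist_to_le => e e0; apply: (h e e0 (fun=> N%:R)); right.
Qed.

Lemma closed_voronoi (E : set ('rV[R]_d * R)) p : closed (voronoi E p).
Proof. by rewrite voronoiE; apply/closed_slack_set/lip_dist. Qed.

Lemma closed_trunc_voronoi N (E : set ('rV[R]_d * R)) p : closed (trunc_voronoi N E p).
Proof. by rewrite trunc_voronoiE; apply/closed_slack_set/lip_trunc. Qed.

End slack.

(** * Fine cells inside macro-cells *)

Section site_counts.
Context {R : realType} {d : nat}.
Variables (sg : R) (q W : nat).
Hypotheses (sg0 : 0 < sg) (q0 : (0 < q)%N).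
Let h : R := sg / q%:R.
Let H := (q * W)%N.
Let qR : 0 < q%:R :> R. Proof. by rewrite ltr0n. Qed.
Let h0 : 0 < h. Proof. by rewrite divr_gt0. Qed.
Implicit Types (i : site_index (d := d) H) (x y : 'rV[R]_d) (m z : 'rV[int]_d).
Let pos : site_index (d := d) H -> 'rV[R]_d := @site_pos R d h H.

Lemma macrocell_fine i x : fine_cell h i x ->
  macrocell sg x = \row_k ((i k %/ q)%N%:Z - W%:Z).
Proof.
move=> ix; apply/rowP => k; rewrite !mxE; apply: floor_def.
have := ix k; rewrite mxE => /andP[x1 x2].
rewrite intrD1 rmorphB /= -!pmulrn ler_pdivlMr// ltr_pdivrMr//.
have hE : sg = h * q%:R by rewrite /h; field; rewrite gt_eqF.
have HE : H%:R = q%:R * W%:R :> R by rewrite natrM.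
have e1 : (i k %/ q)%:R * q%:R <= (i k)%:R :> R by rewrite -natrM ler_nat leq_trunc_div.
have e2 : (i k)%:R + 1 <= ((i k %/ q)%:R + 1) * q%:R :> R.
  by rewrite !natr1 -natrM ler_nat ltn_ceil.
have := ler_wpM2l (ltW h0) e1; have := ler_wpM2l (ltW h0) e2.
move: x1 x2; rewrite HE hE.
move: ((i k %/ q)%:R) ((i k)%:R) (x ord0 k) (q%:R) (W%:R) => a b c e f x1 x2 u1 u2.
apply/andP; split; lra.
Qed.

Lemma macrocell_site i : macrocell sg (pos i) = \row_k ((i k %/ q)%N%:Z - W%:Z).
Proof. exact/macrocell_fine/fine_cell_pos. Qed.

Lemma fine_macrocell i x : fine_cell h i x -> macrocell sg (pos i) = macrocell sg x.
Proof. by move=> /macrocell_fine ->; rewrite macrocell_site. Qed.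

Lemma ex_fine_cell x : (forall k, `|x ord0 k| < sg * W%:R) -> exists i, fine_cell h i x.
Proof.
move=> xW.
have hH : sg * W%:R = h * H%:R by rewrite /h /H natrM; field; rewrite gt_eqF.
pose f k := Num.floor (x ord0 k / h) + H%:Z.
have fP k : 0 <= f k < (2 * H)%N%:Z.
  have := xW k; rewrite hH ltr_norml => /andP[x1 x2].
  rewrite /f -lerBlDr sub0r floor_ge_int -ltrBrDr floor_lt_int.
  rewrite ler_pdivlMr// ltr_pdivrMr// mul2n -addnn PoszD addrK rmorphN /= -pmulrn.
  by apply/andP; split; [apply: ltW; lra|lra].
have aP k : (`|f k| < 2 * H)%N by have := fP k; lia.
exists [ffun k => Ordinal (aP k)] => k; rewrite !mxE ffunE /=.
have -> : (`|f k|)%:R = (Num.floor (x ord0 k / h))%:~R + H%:R :> R.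
  rewrite pmulrn gez0_abs; last by case/andP: (fP k).
  by rewrite /f rmorphD /= -pmulrn.
have := floor_itv (x ord0 k / h); rewrite intrD1 ler_pdivlMr// ltr_pdivrMr//.
move: (x ord0 k) (_%:~R) (H%:R) => c a b /andP[x1 x2].
apply/andP; split; lra.
Qed.

Lemma card_cell_sites_le m : (#|cell_sites pos sg m| <= q ^ d)%N.
Proof.
pose f i : {ffun 'I_d -> 'I_q} := [ffun k => Ordinal (ltn_pmod (i k) q0)].
rewrite -(card_in_imset (f := f)); last first.
  move=> i j; rewrite !finset.inE !macrocell_site => /eqP im /eqP jm /ffunP ff.
  apply/ffunP => k; apply: val_inj => /=.
  have := ff k; rewrite !ffunE => -[ek].
  have : (\row_k ((i k %/ q)%N%:Z - W%:Z) : 'rV[int]_d) ord0 k = (\row_k ((j k %/ q)%N%:Z - W%:Z) : 'rV[int]_d) ord0 k.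
    by rewrite im jm.
  rewrite !mxE => /addIr [dk].
  by rewrite (divn_eq (i k) q) (divn_eq (j k) q) ek dk.
by apply: leq_trans (max_card _) _; rewrite card_ffun !card_ord.
Qed.

Lemma card_cell_sites m : (forall k, - W%:Z <= m ord0 k < W%:Z) ->
  #|cell_sites pos sg m| = (q ^ d)%N.
Proof.
move=> mW; apply/eqP; rewrite eqn_leq card_cell_sites_le/=.
have cP k (t : 'I_q) : (`|(m ord0 k + W%:Z)%R|%N * q + t < 2 * H)%N.
  have : (`|(m ord0 k + W%:Z)%R|%N.+1 <= 2 * W)%N by have := mW k; lia.
  move: (`|_|%N) => c; rewrite -(leq_pmul2r q0) /H => cW; have := ltn_ord t; rewrite mulSn in cW.
  by move: cW; rewrite mulnCA (mulnC q); lia.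
pose g (t : {ffun 'I_d -> 'I_q}) : site_index (d := d) H := [ffun k => Ordinal (cP k (t k))].
have ginj : injective g.
  move=> t u /ffunP gg; apply/ffunP => k; have := gg k; rewrite !ffunE => -[] /addnI e.
  exact: val_inj.
have -> : (q ^ d = #|g @: [set: {ffun 'I_d -> 'I_q}]|%SET)%N.
  by rewrite card_imset// finset.cardsT card_ffun !card_ord.
apply/subset_leq_card/fintype.subsetP => _ /imsetP[t _ ->]; rewrite finset.inE macrocell_site.
apply/eqP/rowP => k; rewrite !mxE !ffunE /= divnMDl// divn_small// addn0.
have := mW k; rewrite (ord1 ord0); move: (m _ _) => a; lia.
Qed.

End site_counts.

Section window.
Context {d : nat}.
Implicit Type m : 'rV[int]_d.

Definition window_cells (c : nat) : seq 'rV[int]_d :=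
  [seq \row_k ((t k)%:Z - c%:Z) | t : {ffun 'I_d -> 'I_(2 * c)} <- enum {ffun 'I_d -> 'I_(2 * c)}].

Lemma window_cells_uniq c : uniq (window_cells c).
Proof.
rewrite map_inj_uniq ?enum_uniq// => t u /rowP tu; apply/ffunP => k.
by have := tu k; rewrite !mxE => /addIr [] /val_inj.
Qed.

Lemma mem_window_cells c m : (m \in window_cells c) = [forall k, - c%:Z <= m ord0 k < c%:Z].
Proof.
apply/mapP/forallP => [[t _ ->] k|h'].
  rewrite mxE; move: (ltn_ord (t k)); move: (nat_of_ord (t k)) => a.
  lia.
have tP k : (`|(m ord0 k + c%:Z)%R|%N < 2 * c)%N by have := h' k; lia.
exists [ffun k => Ordinal (tP k)]; first by rewrite mem_enum.
apply/rowP => k; rewrite !mxE ffunE /=; have := h' k; rewrite (ord1 ord0); move: (m _ _) => a; lia.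
Qed.

End window.

Section truncation.
Context {R : realType} {d : nat}.

Definition truncate N (C : set 'rV[R]_d) : set 'rV[R]_d :=
  \bigcup_(z in [set: 'rV[int]_d])
    (if (C `&` grid_box N z #<= `I_(2 * N ^ d)%N)%card then C `&` grid_box N z else grid_box N z).

Lemma trunc_closed_pointsE N (E : set ('rV[R]_d * R)) p :
  trunc_closed_points N E p = truncate N (closed_points E p).
Proof. by []. Qed.

Lemma ex_grid_box N (x : 'rV[R]_d) : (0 < N)%N -> exists z, grid_box N z x.
Proof.
move=> N0; have NR : 0 < N%:R :> R by rewrite ltr0n.
exists (\row_k Num.floor (x ord0 k / N%:R)) => k; rewrite mxE.
have := floor_itv (x ord0 k / N%:R); rewrite intrD1 ler_pdivlMr// ltr_pdivrMr//.
by rewrite mulrDl mul1r mulrC.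
Qed.

Lemma sub_truncate N (C : set 'rV[R]_d) : (0 < N)%N -> C `<=` truncate N C.
Proof.
move=> N0 x Cx; have [z zx] := ex_grid_box x N0; exists z => //.
by case: ifP.
Qed.

Lemma many_points (A : set 'rV[R]_d) (m : nat) : ~~ (A #<= `I_m)%card ->
  exists2 f : 'I_m.+1 -> 'rV[R]_d, injective f & forall i, A (f i).
Proof.
move=> Am.
have [s [us ms sA]] : exists s : seq 'rV[R]_d, [/\ uniq s, (m < size s)%N & forall x, x \in s -> A x].
  have [fA|iA] := pselect (finite_set A); last first.
    have [B BA mB] := infinite_set_fset m.+1 iA.
    by exists (finmap.enum_fset B); split=> //; exact: finmap.fset_uniq.
  exists (finmap.enum_fset (fset_set A)); split; first exact: finmap.fset_uniq.
    have /finite_setP[n An] := fA; rewrite (card_fset_set An).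
    by move: Am; rewrite (card_le_eql An) card_le_II -ltnNge.
  by move=> x; rewrite [_ \in _](in_fset_set fA) inE.
have sB (i : 'I_m.+1) : (i < size s)%N by apply: leq_ltn_trans ms; rewrite -ltnS.
exists (fun i => nth 0 s i).
  by move=> i j /eqP; rewrite nth_uniq ?sB// => /eqP/val_inj.
by move=> i; apply: sA; rewrite mem_nth.
Qed.

End truncation.

Section approximation.
Context {R : realType} {d : nat}.
Variables (N : nat) (sg s : R).
Hypotheses (N0 : (0 < N)%N) (sg0 : 0 < sg).
Variable K : nat.
Hypotheses (NE : N%:R = sg * K%:R) (d0 : (0 < d)%N).
Implicit Types (x y : 'rV[R]_d) (O C : set 'rV[R]_d).

Section level.
Variables (q W : nat).
Hypothesis q0 : (0 < q)%N.
Let h : R := sg / q%:R.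
Let H := (q * W)%N.
Let dl : R := d%:R * h.
(** [dl] bounds the diameter of a fine cell. One [dl] moves a closed point to its site, one moves an
    open point, and one absorbs the error in the definition of [slack_set]. *)
Let kap := 3 * dl.
Let h0 : 0 < h. Proof. by rewrite divr_gt0// ltr0n. Qed.
Let dl0 : 0 < dl. Proof. by rewrite mulr_gt0// ltr0n. Qed.
Let pos : site_index (d := d) H -> 'rV[R]_d := @site_pos R d h H.

Lemma fine_cell_close (i : site_index (d := d) H) x : fine_cell h i x -> enorm (x - pos i) <= dl.
Proof.
move=> ix; apply: enorm_le_sup => [|k]; first exact: ltW.
have /andP[x1 x2] := ix k; rewrite rowBE ger0_norm ?subr_ge0//; lra.
Qed.

Lemma cover_window x : enorm x < sg * W%:R -> exists i : site_index (d := d) H, fine_cell h i x.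
Proof.
move=> xW; apply: ex_fine_cell => // k; exact: le_lt_trans (coord_le_enorm _ _) xW.
Qed.

Lemma site_in O (i : site_index (d := d) H) x : O x -> fine_cell h i x -> i \in sites_of h H O.
Proof. by move=> Ox ix; rewrite finset.inE; apply/asboolP; exists x. Qed.

Let far_enorm y x : enorm y <= s -> sg * W%:R <= enorm x -> sg * W%:R - s <= enorm (y - x).
Proof.
move=> ys xW; have := enorm_triangle x y 0; rewrite !subr0 (enormB x); lra.
Qed.

Lemma slack_old O C L y : L + s <= sg * W%:R -> enorm y <= s ->
  slack_set O (dist_constraints C) 0 y ->
  old_voronoi pos kap s L (sites_of h H O) (sites_of h H C) y.
Proof.
move=> LW ys yV; split=> // j; rewrite finset.inE => /asboolP[x Cx jx].
have c1 := fine_cell_close jx; have c2 := enorm_triangle y (pos j) x.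
rewrite (enormB (pos j)) in c2.
have [|p Op yp] := yV dl dl0 (fun y => enorm (y - x)); first by exists x.
have [pW|pW] := ltP (enorm p) (sg * W%:R).
  right; have [i ip] := cover_window pW; exists i; first exact: site_in ip.
  have := enorm_triangle y p (pos i); have := fine_cell_close ip; rewrite /kap; lra.
by left; have := far_enorm ys pW; have := dl0; rewrite /kap; lra.
Qed.

Lemma old_slack O C (e : R) y o : O o -> 0 <= s -> 8 * dl <= e -> 8 * dl <= 1 ->
  4 * s + enorm o + 1 <= sg * W%:R ->
  old_voronoi pos kap s (sg * W%:R - s) (sites_of h H O) (sites_of h H C) y ->
  slack_set O (dist_constraints C) e y.
Proof.
move=> Oo s0 de d1 oW [ys yV] e' ee' _ [x Cx <-].
have yo : enorm (y - o) <= s + enorm o.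
  by have := enorm_triangle y 0 o; rewrite subr0 sub0r enormN; lra.
have [xo|xo] := leP (2 * s + enorm o) (enorm x).
  exists o => //; have := enorm_triangle x y 0; rewrite !subr0 (enormB x).
  have := dl0; lra.
have xW : enorm x < sg * W%:R by lra.
have [j jx] := cover_window xW.
have c1 := fine_cell_close jx; have c2 := enorm_triangle y x (pos j).
have [|[i ia yi]] := yV j (site_in Cx jx).
  have := enorm_triangle y 0 x; rewrite subr0 sub0r enormN /kap.
  have := dl0; lra.
move: ia; rewrite finset.inE => /asboolP[p Op ip]; exists p => //.
have := enorm_triangle y (pos i) p; have := fine_cell_close ip.
rewrite (enormB p) /kap in yi *; have := dl0; lra.
Qed.

Lemma old_empty C x y : C x -> 0 <= s -> 8 * dl <= 1 ->
  4 * s + enorm x + 1 <= sg * W%:R ->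
  ~ old_voronoi pos kap s (sg * W%:R - s) (sites_of h H set0) (sites_of h H C) y.
Proof.
move=> Cx s0 d1 xW' [ys yV].
have x0 := enorm_ge0 x.
have xW : enorm x < sg * W%:R by lra.
have [j jx] := cover_window xW.
have c1 := fine_cell_close jx; have c2 := enorm_triangle y x (pos j).
have [|[i]] := yV j (site_in Cx jx).
  have := enorm_triangle y 0 x; rewrite subr0 sub0r enormN /kap.
  have := dl0; lra.
by rewrite finset.inE => /asboolP[].
Qed.

(** Distinct cells contain distinct points, and a fine cell never straddles two boxes. *)
Lemma card_box_sites_truncate C z : (#|sites_of h H C :&: box_sites pos N z|%SET > 2 * N ^ d)%N ->
  ~~ (C `&` grid_box N z #<= `I_(2 * N ^ d)%N)%card.
Proof.
set S := (_ :&: _)%SET => h1; apply/negP => Am; set A := C `&` grid_box N z in Am.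
have fA : finite_set A by apply: card_le_finite Am _; exact: finite_II.
have /finite_setP[n An] := fA.
have nm : (n <= 2 * N ^ d)%N by rewrite -card_le_II -(card_le_eql An).
pose g (i : site_index (d := d) H) : 'rV[R]_d := xget 0 [set x | A x /\ fine_cell h i x].
have gP i : i \in S -> A (g i) /\ fine_cell h i (g i).
  rewrite /S !finset.inE => /andP[/asboolP[x Cx ix] /asboolP bi].
  apply: (@xgetPex _ 0 [set x | A x /\ fine_cell h i x]); exists x; split=> //; split=> //.
  apply/(grid_boxE sg0 NE); rewrite -(fine_macrocell sg0 q0 ix).
  exact/(grid_boxE sg0 NE).
have : (#|S| <= n)%N.
  rewrite -(card_fset_set An) cardE -(size_map g); apply: uniq_leq_size.
    rewrite map_inj_in_uniq ?enum_uniq// => i j; rewrite !mem_enum => /gP[_ i1] /gP[_ j1] ij.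
    by rewrite ij in i1; exact: fine_cell_inj i1 j1.
  move=> x /mapP[i]; rewrite mem_enum => /gP[Ag _] ->.
  by rewrite [_ \in _](in_fset_set fA) inE.
by move=> Sn; have := leq_ltn_trans (leq_trans Sn nm) h1; rewrite ltnn.
Qed.

Lemma slack_trunc O C zs y : dl < 1 -> s + N%:R + 1 <= sg * W%:R -> enorm y <= s ->
  slack_set O (trunc_constraints N%:R (truncate N C)) 0 y ->
  slack_voronoi N kap s (sites_at pos (sites_of h H O)) (closed_region pos N zs (sites_of h H C)) y.
Proof.
move=> d1 sW ys yV.
have [|o Oo yo] := yV dl dl0 (fun=> N%:R); first by right.
have oW : enorm o < sg * W%:R.
  by have := enorm_triangle o y 0; rewrite !subr0 (enormB o); lra.
have [i0 io] := cover_window oW.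
have i0a := site_in Oo io; have c0 := fine_cell_close io; have t0 := enorm_triangle y o (pos i0).
have key x : truncate N C x -> exists2 p, sites_at pos (sites_of h H O) p & enorm (y - p) <= enorm (y - x) + 2 * dl.
  move=> Tx; have [|p Op yp] := yV dl dl0 (fun y => enorm (y - x)); first by left; exists x.
  have [pW|pW] := ltP (enorm p) (sg * W%:R).
    have [i ip] := cover_window pW; exists (pos i); first by exists i => //; exact: site_in ip.
    have := enorm_triangle y p (pos i); have := fine_cell_close ip; lra.
  exists (pos i0); first by exists i0.
  have := far_enorm ys pW; lra.
split=> //; first by exists (pos i0); [exists i0|rewrite /kap; have := dl0; lra].
move=> u [[j jb ->]|[z [zz hz uz]]].
  move: jb; rewrite finset.inE => /asboolP[x Cx jx].
  have [p Op yp] := key x (sub_truncate N0 Cx); exists p => //.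
  have := fine_cell_close jx; have := enorm_triangle y (pos j) x; rewrite (enormB (pos j)) /kap; lra.
have [|p Op yp] := key u.
  by exists z => //; rewrite (negbTE (card_box_sites_truncate hz)).
by exists p => //; rewrite /kap; have := dl0; lra.
Qed.

Lemma trunc_slack O C zs (e : R) y : 8 * dl <= e -> 8 * dl <= 1 ->
  s + N%:R + 1 < sg * W%:R ->
  (forall z x, grid_box N z x -> enorm x <= s + N%:R + 1 ->
     ~~ (C `&` grid_box N z #<= `I_(2 * N ^ d)%N)%card ->
     z \in zs /\ (2 * N ^ d < #|sites_of h H C :&: box_sites pos N z|%SET)%N) ->
  slack_voronoi N kap s (sites_at pos (sites_of h H O)) (closed_region pos N zs (sites_of h H C)) y ->
  slack_set O (trunc_constraints N%:R (truncate N C)) e y.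
Proof.
move=> de d1 sW bad [ys [p [i ia ->] yi] yC] e' ee'.
have toO i' : i' \in sites_of h H O -> exists2 o, O o & enorm (y - o) <= enorm (y - pos i') + dl.
  rewrite finset.inE => /asboolP[w Ow iw]; exists w => //.
  have := enorm_triangle y (pos i') w; have := fine_cell_close iw; rewrite (enormB w); lra.
have [w Ow yo] := toO i ia.
have yoN : enorm (y - w) <= N%:R + 4 * dl by rewrite /kap in yi; lra.
move=> phi [[x [z _ zx] <-]|->]; last by exists w => //; have := dl0; lra.
have [xfar|xnear] := ltP (s + N%:R + 1) (enorm x).
  exists w => //; have := enorm_triangle x y 0; rewrite !subr0 (enormB x).
  have := dl0; lra.
move: zx; case: ifPn => [_ [Cx zx]|zbad zx].
  have [j jx] : exists j : site_index (d := d) H, fine_cell h j x.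
    by apply: cover_window; exact: le_lt_trans sW.
  have [|p' [i' i'a ->] yp'] := yC (pos j); first by left; exists j => //; exact: site_in jx.
  have [w' Ow' yo'] := toO i' i'a; exists w' => //.
  have := fine_cell_close jx; have := enorm_triangle y x (pos j); rewrite /kap in yp' *.
  have := dl0; lra.
have [zzs hz] := bad z x zx xnear zbad.
have [|p' [i' i'a ->] yp'] := yC x; first by right; exists z.
have [w' Ow' yo'] := toO i' i'a; exists w' => //.
rewrite /kap in yp' *; have := dl0; lra.
Qed.

End level.

(** Choose 2 N^d + 1 distinct points of the box, be its set of points finite or not: they occupy
    distinct cells once the mesh is at most their smallest sup distance [e] and the window contains
    them all. *)
Lemma bad_box_detected C z : ~~ (C `&` grid_box N z #<= `I_(2 * N ^ d)%N)%card ->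
  exists e c : R, 0 < e /\ forall q W : nat, (0 < q)%N -> sg / q%:R <= e -> c < sg * W%:R ->
    (2 * N ^ d < #|sites_of (sg / q%:R) (q * W) C :&: box_sites (@site_pos R d (sg / q%:R) (q * W)) N z|%SET)%N.
Proof.
move=> /many_points[f finj fA]; set m := (2 * N ^ d)%N in f finj fA *.
pose e := \big[Num.min/1]_(ij : 'I_m.+1 * 'I_m.+1 | ij.1 != ij.2) `|f ij.1 - f ij.2|.
pose c := \big[Num.max/0]_(i < m.+1) enorm (f i).
have eP i j : i != j -> e <= `|f i - f j|.
  move=> ij; exact: (@bigmin_le_cond _ _ _ 1 (i, j) (fun ij => ij.1 != ij.2) (fun ij => `|f ij.1 - f ij.2|)).
have cP i : enorm (f i) <= c by exact: (@le_bigmax _ _ _ 0 (fun i => enorm (f i)) i).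
have e0 : 0 < e.
  apply/bigmin_gtP; split=> // -[i j] /= ij; rewrite normr_gt0 subr_eq0.
  by apply: contraNneq ij => /finj ->.
exists e, c; split=> // q W q0 he cW.
have tE i : exists t : site_index (d := d) (q * W), fine_cell (sg / q%:R) t (f i).
  by apply: cover_window => //; exact: le_lt_trans cW.
have [t tP] := boolp.choice tE.
have tinj : injective t.
  move=> i j tij; apply/eqP/negPn/negP => ij.
  have := eP i j ij; rewrite leNgt => /negP; apply; apply: lt_le_trans he.
  have h0 : 0 < sg / q%:R by rewrite divr_gt0// ltr0n.
  rewrite -[ltLHS]/(mx_norm _) mx_normrE; apply/bigmax_ltP; split=> // -[a k] _ /=.
  have := tP i k; have := tP j k; rewrite -tij (ord1 a) rowBE => /andP[x1 x2] /andP[y1 y2].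
  rewrite ltr_norml; apply/andP; split; lra.
rewrite -[m.+1]card_ord -(card_imset _ tinj); apply/subset_leq_card/fintype.subsetP => _ /imsetP[i _ ->].
have [Cf zf] := fA i.
rewrite finset.inE (site_in Cf (tP i)) /= finset.inE; apply/asboolP.
apply/(grid_boxE sg0 NE); rewrite (fine_macrocell sg0 q0 (tP i)).
exact/(grid_boxE sg0 NE).
Qed.

Lemma bad_boxes_detected C (zs : seq 'rV[int]_d) :
  exists e c : R, 0 < e /\ forall q W : nat, (0 < q)%N -> sg / q%:R <= e -> c < sg * W%:R ->
    forall z, z \in zs -> ~~ (C `&` grid_box N z #<= `I_(2 * N ^ d)%N)%card ->
    (2 * N ^ d < #|sites_of (sg / q%:R) (q * W) C :&: box_sites (@site_pos R d (sg / q%:R) (q * W)) N z|%SET)%N.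
Proof.
elim: zs => [|z zs [e [c [e0 IH]]]]; first by exists 1, 0; split.
have [good|/bad_box_detected[e' [c' [e'0 h]]]] := boolP (C `&` grid_box N z #<= `I_(2 * N ^ d)%N)%card.
  exists e, c; split=> // q W q0 he cW z'; rewrite inE => /predU1P[->|]; last exact: IH.
  by rewrite good.
exists (Num.min e e'), (Num.max c c'); split; first by rewrite lt_min e0.
move=> q W q0; rewrite le_min gt_max => /andP[he he'] /andP[cW cW'] z'.
by rewrite inE => /predU1P[->|z'zs]; [move=> _; exact: h|exact: IH].
Qed.

End approximation.

(** * Choice of the scale *)

Section large_scale.
Context {R : realType}.

Lemma expRN_le (t : R) : 0 <= t -> expR (- t) <= (1 + t)^-1.
Proof.
move=> t0; rewrite expRN lef_pV2 ?posrE ?expR_gt0//; last by lra.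
exact: expR_ge1Dx.
Qed.

(** Hence e^(11 / 10) / 4 <= 10 / 11: the bound (e / 4)^X on overcrowding beats the price e^(- X /
    10) of a wall, with X = N^d. The proof takes the fourth power of e^(11 / 40) <= 1 / (1 - 11 /
    40). *)
Lemma expR_11_10 : expR (11 / 10) <= 40 / 11 :> R.
Proof.
have -> : 11 / 10 = 4%:R * (11 / 40) :> R by field.
rewrite expRM_natl.
have h : expR (11 / 40) <= 40 / 29 :> R.
  have -> : 40 / 29 = (1 + - (11 / 40))^-1 :> R by field.
  rewrite -[expR _]invrK -expRN lef_pV2 ?posrE ?expR_gt0//; last by lra.
  exact: expR_ge1Dx.
apply: (@le_trans _ _ ((40 / 29) ^+ 4)).
  by rewrite lerXn2r ?nnegrE ?expR_ge0//; lra.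
lra.
Qed.

Lemma geometric_le (n : nat) : (10 / 11) ^+ n <= (1 + n%:R / 10)^-1 :> R.
Proof.
have h : 1 + n%:R / 10 <= (11 / 10) ^+ n :> R.
  elim: n => [|n IH]; first by rewrite mul0r addr0 expr0.
  have n0 : 0 <= n%:R :> R by [].
  rewrite exprS -natr1; apply: (@le_trans _ _ (11 / 10 * (1 + n%:R / 10))); first by lra.
  by rewrite ler_wpM2l.
have n1 : 0 < 1 + n%:R / 10 :> R by rewrite ltr_wpDr// divr_ge0.
have -> : 10 / 11 = (11 / 10)^-1 :> R by field.
by rewrite exprVn lef_pV2 ?posrE// (lt_le_trans n1).
Qed.

Lemma large_scale_exists (d K : nat) (eps e : R) : (0 < d)%N -> (0 < K)%N -> 0 < eps -> 0 < e ->
  exists2 N0 : R, 0 < N0 & forall N : nat, N0 <= N%:R ->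
  [/\ (0 < N)%N, expR (- (eps / 2 * (N%:R / K%:R) ^+ d)) <= 2^-1,
   expR (N ^ d)%:R / 2 ^+ (2 * N ^ d) <= 2^-1 * (expR (- 2) * e * expR (- ((N ^ d)%:R / 10))) &
   (K ^ d)%:R * expR (- (e * (N%:R / K%:R) ^+ d)) <= 2^-1].
Proof.
move=> d0 K0 eps0 e0.
pose k : R := (K ^ d)%:R.
have k1 : 1 <= k by rewrite ler1n expn_gt0 K0.
pose c := 2^-1 * (expR (- 2) * e).
have c0 : 0 < c by rewrite !mulr_gt0// expR_gt0.
(* One threshold on N^d for each inequality, read off from e^(-t) <= 1 / (1 + t) and (10 / 11)^n <=
   1 / (1 + n / 10). *)
pose A1 := 2 * k / eps; pose A2 := 10 / c; pose A3 := 2 * k * k / e.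
have A10 : 0 < A1 by rewrite divr_gt0// mulr_gt0//; lra.
have A20 : 0 < A2 by rewrite divr_gt0.
have A30 : 0 < A3 by rewrite divr_gt0// !mulr_gt0//; lra.
exists (1 + A1 + A2 + A3); first by lra.
move=> N hN.
have N0 : (0 < N)%N by rewrite -(ltr_nat R); lra.
set X : R := (N ^ d)%:R.
have XN : N%:R <= X.
  by rewrite /X ler_nat -{1}(expn1 N) leq_pexp2l.
have sgE : (N%:R / K%:R) ^+ d = X / k by rewrite expr_div_n /X /k !natrX.
rewrite sgE; split=> //.
- have h1 : 1 <= eps / 2 * (X / k).
    have : A1 <= X by lra.
    rewrite /A1 ler_pdivrMr// => h.
    have -> : eps / 2 * (X / k) = (X * eps) / (2 * k) by field; rewrite gt_eqF//; lra.
    by rewrite ler_pdivlMr ?mul1r// mulr_gt0//; lra.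
  apply: le_trans (expRN_le _) _; first by lra.
  by rewrite lef_pV2 ?posrE//; lra.
- rewrite mulrA -/c ler_pdivrMr ?exprn_gt0//.
  have X0 : 0 <= X by rewrite /X.
  have h2 : expR X = expR (11 / 10) ^+ (N ^ d) * expR (- (X / 10)).
    by rewrite -expRM_natl -expRD /X; congr expR; field.
  rewrite h2 mulrAC ler_wpM2r ?expR_ge0//.
  apply: (@le_trans _ _ ((40 / 11) ^+ (N ^ d))).
    by rewrite lerXn2r ?nnegrE ?expR_ge0 ?expR_11_10//; lra.
  have -> : (2 : R) ^+ (2 * N ^ d) = 4 ^+ (N ^ d) by rewrite exprM; congr (_ ^+ _); ring.
  have -> : (40 / 11 : R) = 10 / 11 * 4 by field.
  rewrite exprMn ler_wpM2r ?exprn_ge0//.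
  apply: le_trans (geometric_le _) _; rewrite -/X.
  have : A2 <= X by lra.
  rewrite /A2 ler_pdivrMr// => h.
  rewrite invf_ple ?posrE//; last by lra.
  rewrite -[leLHS]mul1r ler_pdivrMr//; nra.
- have h1 : 2 * k <= e * (X / k).
    have : A3 <= X by lra.
    rewrite /A3 ler_pdivrMr// => h.
    have -> : e * (X / k) = (X * e) / k by field; rewrite gt_eqF//; lra.
    by rewrite ler_pdivlMr//; lra.
  rewrite -/k; apply: (@le_trans _ _ (k * (1 + e * (X / k))^-1)).
    by rewrite ler_wpM2l ?expRN_le//; lra.
  rewrite ler_pdivrMr//; lra.
Qed.

End large_scale.

Local Lemma window_bounds {R : realFieldType} (a b v c t : R) :
  1 <= c -> t + 4 * c <= b + c -> a <= v -> v < a + c ->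
  - (t + c + 1) <= v -> v <= t + c + 1 -> - b <= a < b.
Proof. by move=> *; apply/andP; split; lra. Qed.

Local Lemma refinement_bound (a b n : nat) : (0 < b)%N -> (3 * a <= (8 * a * b).+1 + n)%N.
Proof. nia. Qed.

Local Lemma int_window (a : int) (u v : nat) : (v <= u)%N ->
  - v%:Z <= a < v%:Z -> - u%:Z <= a < u%:Z.
Proof. lia. Qed.

(** * Levels of refinement: the mesh shrinks and the window grows *)

Section levels.
Context {R : realType} {d : nat}.
Variables (N K : nat) (r s : R).
Hypotheses (d0 : (0 < d)%N) (N0 : (0 < N)%N) (K0 : (0 < K)%N) (s0 : 0 <= s) (rs : r <= s).
Implicit Types (O C : set 'rV[R]_d).

Definition macro_side : R := N%:R / K%:R.
(** The part 8 d N keeps the diameter bound of a fine cell below 1/8 and the slack below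
    [macro_side] at every level; [n] makes the mesh tend to 0. *)
Definition level_refinement (n : nat) : nat := ((8 * d * N).+1 + n)%N.
Definition level_width (n : nat) : nat := (Num.bound s + 4 + n)%N.
Definition level_mesh (n : nat) : R := macro_side / (level_refinement n)%:R.
Definition level_halfsize (n : nat) : nat := (level_refinement n * (K * level_width n))%N.
Definition level_slack (n : nat) : R := 3 * (d%:R * level_mesh n).
Definition level_site (n : nat) : site_index (d := d) (level_halfsize n) -> 'rV[R]_d :=
  @site_pos R d (level_mesh n) (level_halfsize n).
Definition level_sites n O := sites_of (level_mesh n) (level_halfsize n) O.
Definition level_radius n : R := N%:R * (level_width n)%:R - s.
(** One layer of boxes less than the window, so that the walls around them stay inside it. *)
Definition level_boxes n : seq 'rV[int]_d := window_cells (level_width n).-1.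

Definition old_level n :=
  old_event (@level_site n) (level_slack n) r s (level_radius n).
Definition trunc_level n :=
  joins_event (@level_site n) N (level_slack n) r s (closed_region (@level_site n) N (level_boxes n)).

Let sg := macro_side.
Let N1 : 1 <= N%:R :> R. Proof. by rewrite ler1n. Qed.
Let K1 : 1 <= K%:R :> R. Proof. by rewrite ler1n. Qed.
Let sg0 : 0 < sg. Proof. by rewrite divr_gt0// ltr0n. Qed.
Let NE : N%:R = sg * K%:R. Proof. by rewrite /sg /macro_side divfK// gt_eqF// ltr0n. Qed.
Let sgN : sg <= N%:R. Proof. by rewrite NE ler_peMr// ltW. Qed.
Let q0 n : (0 < level_refinement n)%N. Proof. by []. Qed.

Let widthE n : sg * (K * level_width n)%:R = N%:R * (level_width n)%:R.
Proof. by rewrite natrM mulrA -NE. Qed.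

Lemma width_ge n : s + 4 * N%:R + n%:R <= N%:R * (level_width n)%:R.
Proof.
have := archi_boundP s0; rewrite /level_width !natrD.
have : 0 <= (Num.bound s)%:R :> R by [].
have : 0 <= n%:R :> R by [].
move: N1; move: (N%:R) ((Num.bound s)%:R) (n%:R) => a b c; nra.
Qed.

Lemma level_mesh_gt0 n : 0 < level_mesh n.
Proof. by rewrite divr_gt0// ltr0n. Qed.

Let meshE n (c : R) : c * (d%:R * level_mesh n) = c * d%:R * sg / (level_refinement n)%:R.
Proof. by rewrite /level_mesh; move: (d%:R) ((_ n)%:R^-1) macro_side sg (erefl macro_side : macro_side = sg) => a b u v <-; rewrite !mulrA. Qed.

Lemma mesh_le (n : nat) (e : R) : 0 < e -> 8 * d%:R * sg <= n%:R * e ->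
  8 * (d%:R * level_mesh n) <= e.
Proof.
move=> e0 h; rewrite meshE ler_pdivrMr ?ltr0n//.
apply: le_trans h _; rewrite mulrC (ler_pM2l e0) ler_nat.
by rewrite /level_refinement leq_addl.
Qed.

Lemma level_mesh_le n : 8 * (d%:R * level_mesh n) <= 1.
Proof.
rewrite meshE ler_pdivrMr ?ltr0n// mul1r.
apply: (@le_trans _ _ (8 * d%:R * N%:R)); first by rewrite ler_wpM2l.
by rewrite -!natrM ler_nat /level_refinement addSn ltnW// ltnS leq_addr.
Qed.

Lemma level_slack_le n : 0 <= level_slack n <= sg.
Proof.
have h0 := level_mesh_gt0 n; apply/andP; split; first by rewrite /level_slack !mulr_ge0// ltW.
rewrite /level_slack meshE ler_pdivrMr ?ltr0n// mulrC (ler_pM2l sg0).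
by rewrite -natrM ler_nat refinement_bound.
Qed.

Let widthP n : level_radius n + s <= sg * (K * level_width n)%:R.
Proof. by rewrite widthE /level_radius subrK. Qed.

Lemma eventually_large (x : R) : exists m : nat, forall n : nat, (m <= n)%N -> x <= n%:R.
Proof.
exists (Num.bound `|x|) => n mn; apply: (@le_trans _ _ (Num.bound `|x|)%:R); last by rewrite ler_nat.
by apply: le_trans (ler_norm x) _; apply: ltW; apply: archi_boundP.
Qed.

Lemma connects_old_level O C : connects r s (slack_set O (dist_constraints C) 0) ->
  forall n, @old_level n (level_sites n O) (level_sites n C).
Proof.
move=> h n; apply/asboolP.
have cl : closed (slack_set O (dist_constraints C) 0) by exact/closed_slack_set/lip_dist.
apply: joinsS (connects_ball cl rs h) => y [yV ys].
exact: (@slack_old R d sg s sg0 d0 (level_refinement n) (K * level_width n) (q0 n) O C _ y (widthP n) ys yV).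
Qed.

(** At high levels the discrete set is contained in the slack set of any given error. Infinitely
    many levels are enough, which is the form that [le_measure_io] provides. *)
Lemma old_level_connects O C :
  (forall m, exists2 n, (m <= n)%N & @old_level n (level_sites n O) (level_sites n C)) ->
  connects r s (slack_set O (dist_constraints C) 0).
Proof.
move=> h; apply: connects_slack_limit; first exact: lip_dist.
move=> e e0.
suff [m hm] : exists m, forall n, (m <= n)%N ->
    old_voronoi (@level_site n) (level_slack n) s (level_radius n) (level_sites n O) (level_sites n C)
    `<=` slack_set O (dist_constraints C) e.
  have [n mn /asboolP jn] := h m; apply: joinsS jn => y yV.
  by split; [exact: hm yV|case: yV].
have [C0|/existsNP[x /contrapT Cx]] := pselect (forall x, ~ C x).
  by exists 0%N => n _ y _ e' _ phi [x /C0].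
have [m1 H1] := eventually_large (8 * d%:R * sg / e).
have small n : (m1 <= n)%N -> 8 * (d%:R * level_mesh n) <= e.
  by move=> /H1 h1'; apply: mesh_le => //; rewrite -ler_pdivrMr.
have [noO|/existsNP[w /contrapT Ow]] := pselect (forall x, ~ O x).
  have [m2 h2] := eventually_large (3 * s + enorm x + 1).
  exists m2 => n mn y yV; exfalso.
  have O_0 : O = set0 by apply/seteqP; split=> // z /noO.
  apply: (@old_empty R d sg s sg0 d0 (level_refinement n) (K * level_width n) (q0 n) C x y Cx s0).
  - exact: level_mesh_le.
  - by rewrite widthE; have := width_ge n; have := h2 n mn; have := N1; lra.
  - by move: yV; rewrite O_0 /level_radius -widthE.
have [m2 h2] := eventually_large (3 * s + enorm w + 1).
exists (maxn m1 m2) => n; rewrite geq_max => /andP[n1 n2] y yV.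
apply: (@old_slack R d sg s sg0 d0 (level_refinement n) (K * level_width n) (q0 n) O C e y w Ow s0).
- exact: small.
- exact: level_mesh_le.
- by rewrite widthE; have := width_ge n; have := h2 n n2; have := N1; lra.
- by move: yV; rewrite /level_radius -widthE.
Qed.

Lemma connects_trunc_level O C :
  connects r s (slack_set O (trunc_constraints N%:R (truncate N C)) 0) ->
  forall n, @trunc_level n (level_sites n O) (level_sites n C).
Proof.
move=> h n; apply/asboolP.
have cl : closed (slack_set O (trunc_constraints N%:R (truncate N C)) 0).
  exact/closed_slack_set/lip_trunc.
apply: joinsS (connects_ball cl rs h) => y [yV ys].
apply: (@slack_trunc R d N sg s N0 sg0 K NE d0 (level_refinement n) (K * level_width n) (q0 n)) => //.
- have : 0 < d%:R * level_mesh n by rewrite mulr_gt0 ?level_mesh_gt0// ltr0n.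
  by move: (level_mesh_le n); rewrite -[sg / _]/(level_mesh n); move: (_ * level_mesh n) => x; lra.
- by rewrite widthE; have := width_ge n; have := N1; have : 0 <= n%:R :> R by []; lra.
Qed.

Lemma trunc_level_connects O C :
  (forall m, exists2 n, (m <= n)%N & @trunc_level n (level_sites n O) (level_sites n C)) ->
  connects r s (slack_set O (trunc_constraints N%:R (truncate N C)) 0).
Proof.
move=> h; apply: connects_slack_limit; first exact: lip_trunc.
move=> e e0.
suff [m hm] : exists m, forall n, (m <= n)%N ->
    slack_voronoi N (level_slack n) s (sites_at (@level_site n) (level_sites n O))
      (closed_region (@level_site n) N (level_boxes n) (level_sites n C))
    `<=` slack_set O (trunc_constraints N%:R (truncate N C)) e.
  have [n mn /asboolP jn] := h m; apply: joinsS jn => y yV.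
  by split; [exact: hm yV|case: yV].
have [m1 H1] := eventually_large (8 * d%:R * sg / e).
have small n : (m1 <= n)%N -> 8 * (d%:R * level_mesh n) <= e.
  by move=> /H1 h1'; apply: mesh_le => //; rewrite -ler_pdivrMr.
(* The boxes that matter meet a fixed ball, so finitely many of them have to be detected, whatever
   the level. *)
pose zs : seq 'rV[int]_d := level_boxes 0.
have [e' [c [e'0 bad]]] := bad_boxes_detected sg0 NE C zs.
have [m2 h2] := eventually_large (8 * d%:R * sg / e').
have [m3 h3] := eventually_large c.
exists (maxn m1 (maxn m2 m3)) => n; rewrite !geq_max => /and3P[n1 n2 n3] y.
have wn := width_ge n; have nn : 0 <= n%:R :> R by [].
apply: (@trunc_slack R d N sg s sg0 d0 (level_refinement n) (K * level_width n) (q0 n)).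
- exact: small.
- exact: level_mesh_le.
- by rewrite widthE; have := N1; lra.
move=> z x zx xs zbad.
have zz : z \in zs.
  rewrite mem_window_cells; apply/forallP => k.
  have /andP[x1 x2] := zx k; have := le_trans (coord_le_enorm x k) xs.
  rewrite ler_norml => /andP[x3 x4].
  have := width_ge 0 => w0; rewrite addr0 in w0.
  have wE : (level_width 0)%:R = (level_width 0).-1%:R + 1 :> R.
    by rewrite natr1 prednK// /level_width !addn_gt0 orbT.
  rewrite wE mulrDr mulr1 in w0.
  rewrite -(ler_int R) -(ltr_int R) rmorphN /= -pmulrn -(ler_pM2l (lt_le_trans ltr01 N1)).
  rewrite -[X in _ && X](ltr_pM2l (lt_le_trans ltr01 N1)) mulrN.
  exact: window_bounds N1 w0 x1 x2 x3 x4.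
split.
  move: zz; rewrite /zs /level_boxes !mem_window_cells => /forallP zz; apply/forallP => k.
  have : ((level_width 0).-1 <= (level_width n).-1)%N by rewrite -!subn1 leq_sub2r// /level_width leq_add2l.
  have := zz k; move=> /[swap]; apply: int_window.
apply: bad => //; last first.
  rewrite widthE; apply: le_lt_trans (h3 n n3) _; apply: lt_le_trans wn.
  by have := N1; have := s0; lra.
have := h2 n n2; rewrite ler_pdivrMr// => hh.
have := mesh_le e'0 hh; rewrite /level_mesh -/sg => h8.
have : 1 <= d%:R :> R by rewrite ler1n.
have := level_mesh_gt0 n; rewrite /level_mesh -/sg; move: h8; move: (sg / _) (d%:R) => a b; nra.
Qed.

End levels.

(** Reverse Fatou lemma: [x] bounds from below the probability of the limit superior of the [F n],
    which lies in [E]. *)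
Lemma le_measure_io {R : realType} {dT : measure_display} {T : measurableType dT}
    (P : probability T R) (x : \bar R) (F : nat -> set T) (E : set T) :
  (forall n, measurable (F n)) -> measurable E -> (forall n, (x <= P (F n))%E) ->
  (forall w, (forall m, exists2 n, (m <= n)%N & F n w) -> E w) -> (x <= P E)%E.
Proof.
move=> mF mE xF FE.
pose G m := \bigcup_(n in [set n | (m <= n)%N]) F n.
have mG m : measurable (G m) by apply: bigcup_measurable.
have GP : P (\bigcap_m G m) = limn (P \o G).
  apply/esym/cvg_lim => //; apply: nonincreasing_cvg_mu => //.
  - by rewrite ltey_eq fin_num_measure.
  - exact: bigcap_measurable.
  - move=> a b ab; apply/subsetPset => w [n bn Fw]; exists n => //=; exact: leq_trans bn.
have GE : \bigcap_m G m `<=` E.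
  by move=> w Gw; apply: FE => m; have [n mn Fn] := Gw m I; exists n.
apply: (@le_trans _ _ (P (\bigcap_m G m))).
  rewrite GP; apply: lime_ge.
    apply: ereal_nonincreasing_is_cvgn => a b ab; apply: le_measure; rewrite ?inE//.
    by move=> w [n bn Fw]; exists n => //=; exact: leq_trans bn.
  apply: nearW => m; apply: le_trans (xF m) _; apply: le_measure; rewrite ?inE//.
  by move=> w Fw; exists m => /=.
apply: le_measure; rewrite ?inE//; exact: bigcap_measurable.
Qed.

Local Lemma near_window (K n b : nat) (z m : int) (c : nat) :
  - ((b + 4 + n).-1)%:Z <= z < ((b + 4 + n).-1)%:Z ->
  K%:Z * z - c%:Z <= m < K%:Z * z + K%:Z + c%:Z -> (c <= K)%N ->
  - ((K * (b + 4 + n))%N%:Z) <= m < (K * (b + 4 + n))%N%:Z.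
Proof. nia. Qed.

Local Lemma radius_bound {R : realFieldType} (a b c t n : R) :
  0 <= n -> t + 4 * c + n <= a -> b <= c -> 1 <= c -> c + b <= a - t.
Proof. lra. Qed.

(** * Comparison of connection probabilities *)

Section comparison.
Context {R : realType} {d : nat} {dT : measure_display} {T : measurableType dT}.
Variables (P : probability T R) (eta : T -> set ('rV[R]_d * R)).
Hypothesis eta_poisson : poisson_process P ([set: 'rV[R]_d] `*` `[0, 1])
  (lebesgue_rV d \x @lebesgue_measure R)%E eta.
Hypothesis d0 : (0 < d)%N.

Definition at_level N K s n p
    (Psi : rel {set site_index (d := d) (@level_halfsize R d N K s n)}) : set T :=
  [set w | Psi (level_sites N K s n (open_points (eta w) p))
               (level_sites N K s n (closed_points (eta w) p))].

Lemma measurable_at_level N K s n p Psi : 0 <= p <= 1 -> measurable (@at_level N K s n p Psi).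
Proof. by move=> p01; exact: (measurable_sites _ eta_poisson p01 Psi). Qed.

Lemma voronoi_level (N K : nat) (r s p : R) w : (0 < N)%N -> (0 < K)%N -> 0 <= s -> r <= s ->
  connects r s (voronoi (eta w) p) -> forall n, at_level p (@old_level R d N K r s n) w.
Proof. by move=> N0 K0 s0 rs; rewrite voronoiE => /connects_old_level; exact. Qed.

Lemma level_voronoi (N K : nat) (r s p : R) w : (0 < N)%N -> (0 < K)%N -> 0 <= s ->
  (forall m, exists2 n, (m <= n)%N & at_level p (@old_level R d N K r s n) w) ->
  connects r s (voronoi (eta w) p).
Proof. by move=> N0 K0 s0 h; rewrite voronoiE; exact: (@old_level_connects R d N K). Qed.

Lemma trunc_voronoi_level (N K : nat) (r s p : R) w : (0 < N)%N -> (0 < K)%N -> 0 <= s -> r <= s ->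
  connects r s (trunc_voronoi N (eta w) p) -> forall n, at_level p (@trunc_level R d N K r s n) w.
Proof.
by move=> N0 K0 s0 rs; rewrite trunc_voronoiE trunc_closed_pointsE => /connects_trunc_level; exact.
Qed.

Lemma level_trunc_voronoi (N K : nat) (r s p : R) w : (0 < N)%N -> (0 < K)%N -> 0 <= s ->
  (forall m, exists2 n, (m <= n)%N & at_level p (@trunc_level R d N K r s n) w) ->
  connects r s (trunc_voronoi N (eta w) p).
Proof.
move=> N0 K0 s0 h; rewrite trunc_voronoiE trunc_closed_pointsE.
exact: (@trunc_level_connects R d N K).
Qed.

(** The event is the intersection of its discretisations, each of which depends on finitely many
    cells; any scale will do, hence N = K = 1. *)
Lemma measurable_connects_voronoi (r s p : R) : 0 <= p <= 1 -> 0 <= s -> r <= s ->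
  measurable [set w | connects r s (voronoi (eta w) p)].
Proof.
move=> p01 s0 rs.
rewrite (_ : [set _ | _] = \bigcap_n at_level p (@old_level R d 1 1 r s n)).
  by apply: bigcap_measurable => // n _; exact: measurable_at_level.
apply/seteqP; split=> w h; first by move=> n _; exact: voronoi_level.
by apply: (@level_voronoi 1 1) => // m; exists m => //; exact: h.
Qed.

Lemma measurable_connects_trunc_voronoi (N : nat) (r s p : R) : (0 < N)%N ->
  0 <= p <= 1 -> 0 <= s -> r <= s ->
  measurable [set w | connects r s (trunc_voronoi N (eta w) p)].
Proof.
move=> N0 p01 s0 rs.
rewrite (_ : [set _ | _] = \bigcap_n at_level p (@trunc_level R d N 1 r s n)).
  by apply: bigcap_measurable => // n _; exact: measurable_at_level.
apply/seteqP; split=> w h; first by move=> n _; exact: trunc_voronoi_level.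
by apply: (@level_trunc_voronoi N 1) => // m; exists m => //; exact: h.
Qed.

Lemma level_comparison (N K : nat) (r s p eps : R) (n : nat) :
  let sg : R := N%:R / K%:R in let e := eps / (2 * 3 ^+ d) in
  (0 < N)%N -> (d < K)%N -> (@shell_width d <= K)%N ->
  (forall z : 'rV[int]_d, (10 * #|wall_indices sg K r z| <= K ^ d)%N) ->
  0 < eps -> 0 <= p -> p + eps <= 1 -> 0 <= s -> r <= s ->
  expR (- (eps / 2 * sg ^+ d)) <= 2^-1 ->
  expR (N ^ d)%:R / 2 ^+ (2 * N ^ d) <=
    2^-1 * (expR (-2) * e * expR (- ((N ^ d)%:R / 10))) ->
  (K ^ d)%:R * expR (- (e * sg ^+ d)) <= 2^-1 ->
  Epair (@level_mesh R d N K n ^+ d) (fun=> p) (@old_level R d N K r s n) <=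
  Epair (@level_mesh R d N K n ^+ d) (fun=> p + eps) (@trunc_level R d N K r s n).
Proof.
move=> sg e N0 dK wK wc eps0 p0 p1 s0 rs n1 n2 n3.
have K0 : (0 < K)%N by exact: leq_trans dK.
have N1 : 1 <= N%:R :> R by rewrite ler1n.
have sg0 : 0 < sg by rewrite divr_gt0// ltr0n.
have NE : N%:R = sg * K%:R by rewrite /sg divfK// gt_eqF// ltr0n.
have sgN : sg <= N%:R by rewrite ler_pdivrMr ?ltr0n// ler_peMr// ler1n.
have q0 : (0 < @level_refinement d N n)%N by [].
have m0 : 0 < @level_mesh R d N K n by exact: level_mesh_gt0.
have kap := @level_slack_le R d N K N0 K0 n.
have widthE : sg * (K * level_width s n)%:R = N%:R * (level_width s n)%:R by rewrite natrM mulrA -NE.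
have wn := width_ge N0 s0 n.
have nn : 0 <= n%:R :> R by [].
have mz (m : 'rV[int]_d) : m \in window_cells (K * level_width s n) ->
    #|cell_sites (@level_site R d N K s n) sg m| = (@level_refinement d N n ^ d)%N.
  rewrite mem_window_cells => /forallP hm; exact: card_cell_sites.
have v01 : 0 <= @level_mesh R d N K n ^+ d <= 1.
  rewrite exprn_ge0 ?(ltW m0)//= exprn_ile1 ?(ltW m0)//.
  have := @level_mesh_le R d N K N0 K0 n; have : 1 <= d%:R :> R by rewrite ler1n.
  by move: m0; move: (@level_mesh R d N K n) (d%:R) => a b; nra.
have vq : @level_mesh R d N K n ^+ d * (@level_refinement d N n ^ d)%:R = sg ^+ d.
  by rewrite natrX -exprMn /level_mesh divfK// gt_eqF// ltr0n.
have := @discrete_comparison R d _ (@level_site R d N K s n) N K _ sg _ _ r s sg0 NE q0 v01 vq kap rs dK wK wc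
  (@card_cell_sites_le _ _ _ _ _ sg0 q0)
  (window_cells (K * level_width s n)) (@level_boxes R d s n) p eps (@level_radius R N s n) eps0 p0 p1
  (window_cells_uniq _) (window_cells_uniq _).
apply => //.
- have kN : @level_slack R d N K n <= N%:R by case/andP: kap => _ h; exact: le_trans h sgN.
  by rewrite /level_radius; exact: radius_bound nn wn kN N1.
- move=> y ys; rewrite mem_window_cells; apply/forallP => k; rewrite mxE.
  have yk := le_trans (coord_le_enorm y k) ys.
  have yW : `|y ord0 k| < sg * (K * level_width s n)%:R.
    by rewrite widthE; apply: lt_le_trans wn; move: nn N1 yk; lra.
  rewrite floor_ge_int floor_lt_int rmorphN /= -!pmulrn ler_pdivlMr// ltr_pdivrMr//.
  by move: yW; rewrite mulrC ltr_norml mulNr => /andP[/ltW -> ->].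
- move=> z m; rewrite mem_window_cells => /forallP hz /forallP hm; apply: mz.
  rewrite mem_window_cells; apply/forallP => k.
  move: (hz k) (hm k) wK; rewrite /level_width; move: (Num.bound s) (z ord0 k) (m ord0 k) shell_width.
  exact: near_window.
Qed.

(** At each level, a connection in V(p) implies the old discrete event, whose probability is at most
    that of the truncated one. The truncated event at infinitely many levels forces a connection in
    V_N. *)
Lemma connection_comparison (eps : R) : 0 < eps -> exists2 N0 : R, 0 < N0 &
  forall N : nat, N0 <= N%:R -> (0 < N)%N /\
  forall p r s : R, 0 <= p -> p + eps <= 1 -> 0 <= s -> r <= s ->
  (P [set w | connects r s (voronoi (eta w) p)] <=
   P [set w | connects r s (trunc_voronoi N (eta w) (p + eps))])%E.
Proof.
move=> eps0; have [K [dK wK wc]] := wall_scale_exists d0.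
have K0 : (0 < K)%N by exact: leq_trans dK.
have e0 : 0 < eps / (2 * 3 ^+ d) by rewrite divr_gt0// mulr_gt0// exprn_gt0.
have [N0 N00 hN] := large_scale_exists d0 K0 eps0 e0.
exists N0 => // N /hN[NN n1 n2 n3]; split=> // p r s p0 p1 s0 rs.
have p01 : 0 <= p <= 1 by rewrite p0; move: p1 eps0; lra.
have q01 : 0 <= p + eps <= 1 by rewrite p1 addr_ge0// ltW.
have h0 n : 0 < @level_mesh R d N K n by exact: level_mesh_gt0.
apply: (@le_measure_io R dT T P _ (fun n => at_level (p + eps) (@trunc_level R d N K r s n))).
- by move=> n; exact: measurable_at_level.
- exact: measurable_connects_trunc_voronoi.
- move=> n.
  rewrite (prob_sites (h0 n) eta_poisson q01 (@trunc_level R d N K r s n)).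
  apply: (@le_trans _ _ (P (at_level p (@old_level R d N K r s n)))).
    apply: le_measure; rewrite ?inE.
    + exact: measurable_connects_voronoi.
    + exact: measurable_at_level.
    + by move=> w h; exact: voronoi_level.
  rewrite (prob_sites (h0 n) eta_poisson p01 (@old_level R d N K r s n)) lee_fin.
  by apply: level_comparison => // z; apply: wc; rewrite divr_gt0// ltr0n.
- by move=> w h; exact: (@level_trunc_voronoi N K).
Qed.

Let percolates_eventsE (V : T -> set 'rV[R]_d) : (forall w, closed (V w)) ->
  [set w | percolates (V w)] =
  \bigcup_(r : nat) \bigcap_(s in [set s : nat | (r < s)%N]) [set w | connects r%:R s%:R (V w)].
Proof.
move=> clV; apply/seteqP; split=> w.
  by move=> /(percolatesP (clV w))[r rs]; exists r.
by move=> [r _ rs]; apply/(percolatesP (clV w)); exists r => s; exact: rs.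
Qed.

Lemma measurable_percolates_voronoi (p : R) : 0 <= p <= 1 ->
  measurable [set w | percolates (voronoi (eta w) p)].
Proof.
move=> p01; rewrite (percolates_eventsE (fun w => @closed_voronoi R d (eta w) p)).
apply: bigcup_measurable => r _; apply: bigcap_measurableType => s rs.
by apply: measurable_connects_voronoi => //; rewrite ler_nat ltnW.
Qed.

Lemma measurable_percolates_trunc_voronoi (N : nat) (p : R) : (0 < N)%N -> 0 <= p <= 1 ->
  measurable [set w | percolates (trunc_voronoi N (eta w) p)].
Proof.
move=> N0 p01; rewrite (percolates_eventsE (fun w => @closed_trunc_voronoi R d N (eta w) p)).
apply: bigcup_measurable => r _; apply: bigcap_measurableType => s rs.
by apply: measurable_connects_trunc_voronoi => //; rewrite ler_nat ltnW.
Qed.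

End comparison.

(** * Percolation at p = 1 *)

Section renormalisation.
Implicit Types (c : nat * nat) (s t : 'I_3 * 'I_3).

Definition sub_block c s : nat * nat := (3 * c.1 + s.1, 3 * c.2 + s.2)%N.

(** Each predicate fails at most once, so together they exclude at most two of the three indices. It
    serves for the three pairs of sub-blocks facing each other across the side shared by two good
    blocks. *)
Lemma common_index (f f' : 'I_3 -> bool) :
  (forall i j, i != j -> f i || f j) -> (forall i j, i != j -> f' i || f' j) ->
  exists i, f i && f' i.
Proof.
pose i0 : 'I_3 := ord0; pose i1 : 'I_3 := Ordinal (isT : 1 < 3)%N; pose i2 : 'I_3 := ord_max.
move=> h h'; have := (h i0 i1 isT, h i0 i2 isT, h i1 i2 isT); have := (h' i0 i1 isT, h' i0 i2 isT, h' i1 i2 isT).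
case e0 : (f i0 && f' i0); first by exists i0.
case e1 : (f i1 && f' i1); first by exists i1.
case e2 : (f i2 && f' i2); first by exists i2.
by move: e0 e1 e2; case: (f i0); case: (f i1); case: (f i2); case: (f' i0); case: (f' i1); case: (f' i2) => //= ? ? ? [[]] // ? ? ? [[]].
Qed.

Section good_blocks.
Variable occ : nat * nat -> bool.

Fixpoint good n c : bool :=
  if n is n'.+1 then
    [forall s, forall t, (s != t) ==> (good n' (sub_block c s) || good n' (sub_block c t))]
  else occ c.

Lemma goodP n c : reflect
  (forall s t, s != t -> good n (sub_block c s) || good n (sub_block c t)) (good n.+1 c).
Proof.
apply: (iffP forallP) => h s; last by apply/forallP => t; apply/implyP; exact: h.
by move=> t; have /forallP/(_ t)/implyP := h s.
Qed.

(** A bad block has two bad sub-blocks, and so on downwards: this binary tree ends in 2 ^ n vacant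
    cells, and the lists are the possible sets of leaves. *)
Fixpoint witnesses n c : seq (seq (nat * nat)) :=
  if n is n'.+1 then
    flatten [seq [seq u ++ v | u <- witnesses n' (sub_block c st.1), v <- witnesses n' (sub_block c st.2)]
            | st <- enum {: ('I_3 * 'I_3) * ('I_3 * 'I_3)} & st.1 != st.2]
  else [:: [:: c]].

Lemma bad_witness n c : ~~ good n c -> exists2 u, u \in witnesses n c & all (fun x => ~~ occ x) u.
Proof.
elim: n c => [|n IH] c.
  by move=> h; exists [:: c]; rewrite ?inE//= h.
move=> /forallPn[s /forallPn[t]]; rewrite negb_imply negb_or => /and3P[st hs ht].
have [u us ua] := IH _ hs; have [v vt va] := IH _ ht.
exists (u ++ v); last by rewrite all_cat ua.
apply/flattenP; exists [seq u ++ v | u <- witnesses n (sub_block c s), v <- witnesses n (sub_block c t)].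
  by apply/mapP; exists (s, t) => //; rewrite mem_filter mem_enum st.
by apply/allpairsP; exists (u, v).
Qed.

(** There are at most 81 ordered pairs of sub-blocks, whence a(n + 1) <= 81 a(n)^2; multiplying by
    81 turns this into plain squaring. *)
Lemma size_witnesses n c : (81 * size (witnesses n c) <= 81 ^ (2 ^ n))%N.
Proof.
elim: n c => [|n IH] c //=.
set l := [seq st <- _ | _]; rewrite size_flatten /shape -map_comp sumnE big_map.
have sl : (size l <= 81)%N.
  rewrite size_filter; apply: leq_trans (count_size _ _) _.
  by rewrite -cardE !card_prod !card_ord.
rewrite -(leq_pmul2l (isT : (0 < 81)%N)) mulnA big_distrr /= expnSr expnM.
apply: (@leq_trans (\sum_(st <- l) (81 ^ 2 ^ n) ^ 2)).
  by apply: leq_sum => st _; rewrite size_allpairs mulnACA leq_mul.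
by rewrite big_const_seq count_predT iter_addn_0 mulnC leq_mul2r sl orbT.
Qed.

Definition in_block n c (x : nat * nat) :=
  (3 ^ n * c.1 <= x.1 < 3 ^ n * c.1.+1)%N && (3 ^ n * c.2 <= x.2 < 3 ^ n * c.2.+1)%N.

Lemma in_sub_block n c s x : in_block n (sub_block c s) x -> in_block n.+1 c x.
Proof.
have := ltn_ord s.1; have := ltn_ord s.2; rewrite /in_block /= expnS.
move: (3 ^ n)%N (nat_of_ord s.1) (nat_of_ord s.2) c.1 c.2 x.1 x.2 => e a b u v p q.
nia.
Qed.

(** It makes the cells of a witness distinct, hence independent. *)
Lemma in_block_disjoint n c s t x :
  in_block n (sub_block c s) x -> in_block n (sub_block c t) x -> s = t.
Proof.
case: s t => [s1 s2] [t1 t2]; rewrite /in_block /= => h1 h2.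
have e0 : (0 < 3 ^ n)%N by rewrite expn_gt0.
congr (_, _); apply: val_inj => /=; move: h1 h2 e0;
  move: (3 ^ n)%N (nat_of_ord s1) (nat_of_ord s2) (nat_of_ord t1) (nat_of_ord t2) c.1 c.2 x.1 x.2.
  clear; move=> e a b u v p q f g; nia.
clear; move=> e a b u v p q f g; nia.
Qed.

Lemma witnessesP n c u : u \in witnesses n c ->
  [/\ size u = (2 ^ n)%N, uniq u & all (in_block n c) u].
Proof.
elim: n c u => [|n IH] c u /=.
  by rewrite inE => /eqP ->; split=> //=; rewrite /in_block expn0 !mul1n !leqnn.
move=> /flattenP[l /mapP[[s t]]]; rewrite mem_filter /= => /andP[st _] -> /allpairsP[[v w] /= [vs wt ->]].
have [v1 v2 v3] := IH _ _ vs; have [w1 w2 w3] := IH _ _ wt; split.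
- by rewrite size_cat v1 w1 expnS mul2n addnn.
- rewrite cat_uniq v2 w2 andbT /=; apply/hasPn => x xw; apply/negP => xv.
  by move: st; rewrite (in_block_disjoint (allP v3 x xv) (allP w3 x xw)) eqxx.
- by rewrite all_cat; apply/andP; split; [move: v3|move: w3]; apply: sub_all => x; exact: in_sub_block.
Qed.

(** The cells reached through good blocks at all levels. Occupied cells inside a bad sub-block are
    left out, as they may be isolated. *)
Fixpoint backbone n c (x : nat * nat) : Prop :=
  if n is n'.+1 then exists2 s, good n' (sub_block c s) & backbone n' (sub_block c s) x
  else x = c.

Lemma backbone_in_block n c x : backbone n c x -> in_block n c x.
Proof.
elim: n c => [|n IH] c; last by move=> [s _ /IH]; exact: in_sub_block.
by move=> ->; rewrite /in_block expn0 !mul1n !leqnn.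
Qed.

Lemma backbone_occ n c x : good n c -> backbone n c x -> occ x.
Proof. by elim: n c => [|n IH] c; [move=> + ->|move=> _ [s gs /IH]; exact]. Qed.

Lemma good_sub n c s t : good n.+1 c -> s != t -> ~~ good n (sub_block c s) -> good n (sub_block c t).
Proof. by move=> /goodP h /h /orP[->|]. Qed.

Lemma backbone_ex n c : good n c -> exists x, backbone n c x.
Proof.
elim: n c => [|n IH] c; first by exists c.
move=> gc; have [g|/(good_sub gc)] := boolP (good n (sub_block c (ord0, ord0))).
  by have [x xb] := IH _ g; exists x; exists (ord0, ord0).
move=> /(_ (ord0, ord_max) isT) g.
by have [x xb] := IH _ g; exists x; exists (ord0, ord_max).
Qed.

Lemma backbone_far n c : good n.+1 c -> exists2 x, backbone n.+1 c x & (3 ^ n * 2 <= x.1)%N.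
Proof.
move=> gc; have [s s2 g] : exists2 s : 'I_3 * 'I_3, s.1 = ord_max & good n (sub_block c s).
  have [g|/(good_sub gc)] := boolP (good n (sub_block c (ord_max, ord0))).
    by exists (ord_max, ord0).
  by move=> /(_ (ord_max, ord_max) isT) g; exists (ord_max, ord_max).
have [x xb] := backbone_ex g; exists x; first by exists s.
have := backbone_in_block xb; rewrite /in_block /= s2 => /andP[/andP[h _] _].
by apply: leq_trans h; rewrite leq_mul2l leq_addl orbT.
Qed.

Definition h_adjacent (c c' : nat * nat) := (c'.1 == c.1.+1) && (c'.2 == c.2).
Definition v_adjacent (c c' : nat * nat) := (c'.1 == c.1) && (c'.2 == c.2.+1).
Definition adjacent c c' := h_adjacent c c' || v_adjacent c c'.

Variable L : nat * nat -> nat * nat -> Prop.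
Hypotheses (L_refl : forall x, occ x -> L x x) (L_sym : forall x y, L x y -> L y x)
  (L_trans : forall x y z, L x y -> L y z -> L x z)
  (L_adj : forall x y, occ x -> occ y -> adjacent x y -> L x y).

Let linked n c c' := forall x y, backbone n c x -> backbone n c' y -> L x y.

Let linked_trans n c c' c'' : good n c' -> linked n c c' -> linked n c' c'' -> linked n c c''.
Proof.
by move=> /backbone_ex[z zb] h h' x y xb yb; apply: L_trans (h x z xb zb) (h' z y zb yb).
Qed.

Let linked_sym n c c' : linked n c c' -> linked n c' c.
Proof. by move=> h x y xb yb; exact/L_sym/h. Qed.

(** The two claims need each other: inside a block one passes through adjacent good sub-blocks, and
    between adjacent blocks through two good sub-blocks facing each other. *)
Lemma good_linked n :
  (forall c, good n c -> linked n c c) /\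
  (forall c c', good n c -> good n c' -> adjacent c c' -> linked n c c').
Proof.
elim: n => [|n [IH1 IH2]].
  split=> [c oc x y -> ->|c c' oc oc' cc x y -> ->]; [exact: L_refl|exact: L_adj].
have line (f : 'I_3 -> nat * nat) : (forall i, good n (f i)) ->
    (forall i j : 'I_3, j = i.+1 :> nat -> adjacent (f i) (f j)) ->
    forall i j, linked n (f i) (f j).
  move=> gf adj.
  have from0 i : linked n (f ord0) (f i).
    case: i => [] [|[|[|//]]] i3.
    - by rewrite (_ : Ordinal i3 = ord0); [exact: IH1|exact: val_inj].
    - by apply: IH2 => //; exact: adj.
    - apply: (@linked_trans _ _ (f (Ordinal (isT : (1 < 3)%N)))) => //; apply: IH2 => //; exact: adj.
  by move=> i j; apply: (@linked_trans _ _ (f ord0)) => //; exact: linked_sym.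
have row c b : (forall a, good n (sub_block c (a, b))) ->
    forall a a', linked n (sub_block c (a, b)) (sub_block c (a', b)).
  move=> g; apply: (@line (fun a => sub_block c (a, b))) => // i j ij.
  by rewrite /adjacent /h_adjacent /= ij addnS !eqxx.
have col c a : (forall b, good n (sub_block c (a, b))) ->
    forall b b', linked n (sub_block c (a, b)) (sub_block c (a, b')).
  move=> g; apply: (@line (fun b => sub_block c (a, b))) => // i j ij.
  by rewrite /adjacent /v_adjacent /= ij addnS !eqxx orbT.
have inner c : good n.+1 c -> forall s t, good n (sub_block c s) -> good n (sub_block c t) ->
    linked n (sub_block c s) (sub_block c t).
  move=> gc.
  have [[e ge]|/forallNP allg] := pselect (exists e, ~~ good n (sub_block c e)); last first.
    have gg s : good n (sub_block c s) by apply/negPn/negP; exact: allg.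
    move=> [a b] [a' b'] _ _; apply: (@linked_trans _ _ (sub_block c (a, b'))) => //.
      exact: col.
    exact: row.
  have other t : t != e -> good n (sub_block c t).
    by move=> te; apply: good_sub gc _ ge; rewrite eq_sym.
  have [e1 e1P] : exists i : 'I_3, i != e.1.
    by case: (eqVneq e.1 ord0) => [->|h]; [exists ord_max|exists ord0; rewrite eq_sym].
  have [e2 e2P] : exists i : 'I_3, i != e.2.
    by case: (eqVneq e.2 ord0) => [->|h]; [exists ord_max|exists ord0; rewrite eq_sym].
  have gcol a : a != e.1 -> forall b, good n (sub_block c (a, b)).
    by move=> ae b; apply: other; apply: contraNneq ae => <-.
  have grow b : b != e.2 -> forall a, good n (sub_block c (a, b)).
    by move=> be a; apply: other; apply: contraNneq be => <-.
  (* The row and the column through (e1, e2) avoid the only bad sub-block [e]. Any good sub-block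
     reaches one of them along its own column or row. *)
  have hub s : good n (sub_block c s) -> linked n (sub_block c (e1, e2)) (sub_block c s).
    case: s => a b gs; have [ae|ae] := eqVneq a e.1.
      have be : b != e.2.
        by apply/eqP => be; move: ge; rewrite (surjective_pairing e) -ae -be gs.
      apply: (@linked_trans _ _ (sub_block c (e1, b))); first exact: gcol.
        by apply: col; exact: gcol.
      by apply: row; exact: grow.
    apply: (@linked_trans _ _ (sub_block c (a, e2))); first exact: gcol.
      by apply: row; exact: grow.
    by apply: col; exact: gcol.
  move=> s t gs gt; apply: (@linked_trans _ _ (sub_block c (e1, e2))); first exact: gcol.
    exact/linked_sym/hub.
  exact: hub.
have block c s : good n.+1 c -> good n (sub_block c s) ->
    forall x y, backbone n.+1 c x -> backbone n (sub_block c s) y -> L x y.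
  by move=> gc gs x y [t gt tx] yb; apply: (inner c gc t s).
split=> [c gc x y xb [t gt ty]|c c' gc gc' cc x y xb yb]; first by apply: block xb ty.
have facing : exists s t, [/\ good n (sub_block c s), good n (sub_block c' t)
    & adjacent (sub_block c s) (sub_block c' t)].
  case/orP: (cc) => /andP[/eqP c1 /eqP c2].
    have [||b /andP[bs bt]] := @common_index (fun b => good n (sub_block c (ord_max, b)))
        (fun b => good n (sub_block c' (ord0, b))).
    - by move=> b b' bb; move/goodP: gc; apply; rewrite xpair_eqE eqxx.
    - by move=> b b' bb; move/goodP: gc'; apply; rewrite xpair_eqE eqxx.
    exists (ord_max, b), (ord0, b); split=> //.
    by rewrite /adjacent /h_adjacent /= c1 c2 eqxx andbT mulnS addn0 addnC; apply/orP; left; apply/eqP; lia.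
  have [||a /andP[bs bt]] := @common_index (fun a => good n (sub_block c (a, ord_max)))
      (fun a => good n (sub_block c' (a, ord0))).
  - by move=> b b' bb; move/goodP: gc; apply; rewrite xpair_eqE eqxx andbT.
  - by move=> b b' bb; move/goodP: gc'; apply; rewrite xpair_eqE eqxx andbT.
  exists (a, ord_max), (a, ord0); split=> //.
  by rewrite /adjacent /v_adjacent /= c1 c2 eqxx; apply/orP; right; apply/eqP; lia.
have [s [t [gs gt st]]] := facing.
have [z zb] := backbone_ex gs; have [z' zb'] := backbone_ex gt.
apply: L_trans (block c s gc gs x z xb zb) _.
by apply: L_trans (IH2 _ _ gs gt st z z' zb zb') _; apply/L_sym/(block c' t).
Qed.

End good_blocks.
End renormalisation.

Section full_intensity.
Context {R : realType} {d : nat}.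
Implicit Types (E : set ('rV[R]_d * R)) (x y : 'rV[R]_d).

(** Without closed points the constant [N] is the only constraint left. *)
Lemma ball_sub_trunc_voronoi N E x y : open_points E 1 x -> enorm (y - x) <= N%:R ->
  trunc_voronoi N E 1 y.
Proof.
move=> Ex yx.
have C0 : closed_points E 1 = set0.
  by apply/seteqP; split=> // z [t]; rewrite in_itv /= => /andP[t1 t2]; have := lt_le_trans t1 t2; rewrite ltxx.
rewrite trunc_voronoiE trunc_closed_pointsE C0 => e e0 phi hphi; exists x => //.
suff -> : phi = fun=> N%:R by apply: le_lt_trans yx _; rewrite ltrDl.
case: hphi => // -[u [z _]]; rewrite set0I; case: ifPn => // /negP[].
exact: card_ge0.
Qed.

Lemma connected_segment x y : connected [set x + t *: (y - x) | t in `[0, 1]%classic : set R].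
Proof.
apply: connected_continuous_connected; first exact: segment_connected.
apply: continuous_subspaceT => t; apply: cvgD; first exact: cvg_cst.
by apply: cvgZl.
Qed.

Lemma close_points N E x y : open_points E 1 x -> open_points E 1 y -> enorm (y - x) <= N%:R ->
  connected_component (trunc_voronoi N E 1) x y.
Proof.
move=> Ex Ey xy; exists [set x + t *: (y - x) | t in `[0, 1]%classic].
  split; last exact: connected_segment.
    by exists 0; rewrite ?scale0r ?addr0//= in_itv /= lexx ler01.
  move=> _ [t + <-]; rewrite /= in_itv /= => /andP[t0 t1].
  apply: ball_sub_trunc_voronoi Ex _; rewrite addrAC subrr add0r; apply: le_trans xy.
  rewrite enorm_le ?enorm_ge0// enorm_sqr; apply: ler_sum => i _; rewrite mxE exprMn.
  by rewrite ler_piMl ?sqr_ge0// exprn_ile1.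
by exists 1; rewrite ?scale1r 1?addrC ?subrK//= in_itv /= lexx ler01.
Qed.

End full_intensity.

(** The union bound over witnesses; summed over all levels, the right-hand sides give 1/2, so all
    blocks at the origin are good with positive probability. *)
Lemma witness_bound {R : realFieldType} (W n : nat) (q : R) : 0 <= q -> 81 * q <= 2^-1 ->
  (81 * W <= 81 ^ (2 ^ n))%N -> q ^+ (2 ^ n) * W%:R <= 2^-1 / (2 ^ n.+1)%:R.
Proof.
move=> q0 hq hW.
have h1 : 81 * (q ^+ (2 ^ n) * W%:R) <= (2^-1) ^+ n.
  apply: (@le_trans _ _ ((81 * q) ^+ (2 ^ n))).
    rewrite exprMn mulrCA [leRHS]mulrC ler_wpM2l ?exprn_ge0//.
    by rewrite -natrM -natrX ler_nat.
  apply: (@le_trans _ _ ((2^-1) ^+ (2 ^ n))).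
    by apply: lerXn2r; rewrite ?nnegrE ?mulr_ge0 ?invr_ge0.
  by rewrite ler_wiXn2l ?invr_ge0 ?invf_le1 ?ler1n// ltnW// ltn_expl.
have -> : 2^-1 / (2 ^ n.+1)%:R = (2^-1) ^+ n / 4 :> R.
  by rewrite natrX exprSr exprVn; field.
have : 0 <= q ^+ (2 ^ n) * W%:R by rewrite mulr_ge0// exprn_ge0.
move: h1; move: (q ^+ _ * _) (_ ^+ n) => a c; lra.
Qed.

Section cells.
Context {R : realType} {d : nat} {dT : measure_display} {T : measurableType dT}.
Variables (P : probability T R) (eta : T -> set ('rV[R]_d * R)).
Hypothesis eta_poisson : poisson_process P ([set: 'rV[R]_d] `*` `[0, 1])
  (lebesgue_rV d \x @lebesgue_measure R)%E eta.
Variables (b : nat) (k0 k1 : 'I_d).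
Hypotheses (b0 : (0 < b)%N) (k01 : k0 != k1).
Let bR : 0 < b%:R :> R. Proof. by rewrite ltr0n. Qed.

Definition cell_corner (x : nat * nat) : 'rV[R]_d :=
  \row_k (b%:R * (if k == k0 then x.1 else if k == k1 then x.2 else 0%N)%:R).

Definition cell (x : nat * nat) : set 'rV[R]_d := cube (cell_corner x) b%:R.

Definition cell_occupied w x : bool := `[< eta w `&` (cell x `*` (`[0, 1]%classic : set R)) !=set0 >].

Lemma cell_inj x y v : cell x v -> cell y v -> x = y.
Proof.
case: x y => [x1 x2] [y1 y2] xv yv.
have inj (m n : nat) (u : R) : b%:R * m%:R <= u < b%:R * m%:R + b%:R ->
    b%:R * n%:R <= u < b%:R * n%:R + b%:R -> m = n.
  move=> /andP[m1 m2] /andP[n1 n2].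
  have h1 : b%:R * m%:R < b%:R * n.+1%:R :> R by rewrite -natr1 mulrDr mulr1; exact: le_lt_trans n2.
  have h2 : b%:R * n%:R < b%:R * m.+1%:R :> R by rewrite -natr1 mulrDr mulr1; exact: le_lt_trans m2.
  by rewrite !ltr_pM2l// !ltr_nat !ltnS in h1 h2; apply/eqP; rewrite eqn_leq h1.
have := xv k0; have := yv k0; have := xv k1; have := yv k1.
rewrite !mxE !eqxx /= [k1 == k0]eq_sym (negbTE k01) => h1 h2 h3 h4.
by congr (_, _); [exact: inj h4 h3|exact: inj h2 h1].
Qed.

Lemma cell_occupied_ex w x : cell_occupied w x -> exists2 v, open_points (eta w) 1 v & cell x v.
Proof. by move=> /asboolP[[v t] /= [vt [xv t01]]]; exists v => //; exists t. Qed.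

Lemma adjacent_cells x y u v : cell x u -> cell y v -> adjacent x y ->
  enorm (v - u) <= d%:R * (2 * b%:R).
Proof.
move=> xu yv xy; apply: enorm_le_sup => [|k]; first by rewrite mulr_ge0// ltW.
have := xu k; have := yv k; rewrite rowBE !mxE /=.
set m := (if _ then _ else _); set n := (if _ then _ else _).
have : (n <= m <= n.+1)%N.
  rewrite /m /n; case/orP: xy => /andP[/eqP -> /eqP ->]; case: ifP => _; rewrite ?leqnn ?leqnSn//;
    case: ifP => _; rewrite ?leqnn ?leqnSn//.
move=> /andP[nm mn].
have h1 : b%:R * n%:R <= b%:R * m%:R :> R by rewrite ler_pM2l// ler_nat.
have h2 : b%:R * m%:R <= b%:R * n%:R + b%:R :> R.
  by rewrite -[X in _ + X]mulr1 -mulrDr natr1 ler_pM2l// ler_nat.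
move: h1 h2; move: (b%:R * _) (b%:R * _) (u _ _) (v _ _) bR; move: (b%:R) => c p q r s c0 h1 h2 /andP[h3 h4] /andP[h5 h6].
by rewrite ler_norml; apply/andP; split; lra.
Qed.

Let measurable_slab_cell x : measurable (cell x `*` (`[0, 1]%classic : set R)).
Proof. by apply: measurableX => //; exact: measurable_cube. Qed.

Let slab_cell_sub x : cell x `*` (`[0, 1]%classic : set R) `<=` [set: 'rV[R]_d] `*` `[0, 1].
Proof. by move=> [v t] []. Qed.

Let mu_slab_cell x : (lebesgue_rV d \x @lebesgue_measure R)%E (cell x `*` (`[0, 1]%classic : set R)) = (b%:R ^+ d)%:E.
Proof.
transitivity (lebesgue_rV d (cell x) * @lebesgue_measure R (`[0%R, 1%R]%classic))%E.
  by apply: product_measure1E => //; exact: measurable_cube.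
by rewrite lebesgue_measure_itv /= lte_fin ltr01 sube0 mule1 lebesgue_cube.
Qed.

Section vacant.
Variable u : seq (nat * nat).
Hypothesis uu : uniq u.
Let B (i : 'I_(size u)) := cell (nth (0, 0)%N u i) `*` (`[0, 1]%classic : set R).

Let vacantE : [set w | all (fun x => ~~ cell_occupied w x) u] =
  [set w | forall i, i \in enum 'I_(size u) -> (i \in occupied eta B w) = false].
Proof.
apply/seteqP; split=> w /=.
  move=> /(all_nthP (0, 0)%N) h i _; apply/negbTE; rewrite finset.inE; exact: (h i).
move=> h; apply/(all_nthP (0, 0)%N) => i iu; have := h (Ordinal iu).
by rewrite mem_enum => /(_ isT)/negbT; rewrite finset.inE.
Qed.

Lemma measurable_vacant : measurable [set w | all (fun x => ~~ cell_occupied w x) u].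
Proof.
rewrite vacantE; exact: (measurable_occupied eta_poisson (fun=> measurable_slab_cell _)
  (fun i => @slab_cell_sub _) (fun X => forall i, i \in enum 'I_(size u) -> (i \in X) = false)).
Qed.

Lemma prob_cells_vacant :
  P [set w | all (fun x => ~~ cell_occupied w x) u] = (expR (- b%:R ^+ d) ^+ size u)%:E.
Proof.
rewrite vacantE (@prob_assignment R d dT T P eta eta_poisson _ B (fun=> b%:R ^+ d)) ?enum_uniq//.
- rewrite (eq_bigr (fun=> expR (- b%:R ^+ d)))// big_const_seq count_predT size_enum_ord.
  by rewrite iter_mulr_1.
- by move=> i; exact: measurable_slab_cell.
- by move=> i; exact: slab_cell_sub.
- by move=> i; exact: mu_slab_cell.
- move=> i j _ _ [[v t] [[iv _] [jv _]]]; apply: val_inj => /=; apply/eqP.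
  have <- := nth_uniq (0, 0)%N (ltn_ord i) (ltn_ord j) uu; apply/eqP; exact: cell_inj iv jv.
Qed.

End vacant.
(** The blocks at the origin are nested, so the backbone of every level is linked to the cell of the
    origin, and [backbone_far] makes these backbones unbounded. *)
Lemma good_percolates w N : d%:R * (2 * b%:R) <= N%:R :> R ->
  (forall n, good (cell_occupied w) n (0, 0)%N) -> percolates (trunc_voronoi N (eta w) 1).
Proof.
move=> bN g; set V := trunc_voronoi N (eta w) 1.
pose pt x := xget 0 [set v | open_points (eta w) 1 v /\ cell x v].
have ptP x : cell_occupied w x -> open_points (eta w) 1 (pt x) /\ cell x (pt x).
  move=> /cell_occupied_ex[v v1 v2].
  by apply: (@xgetPex _ 0 [set v | open_points (eta w) 1 v /\ cell x v]); exists v.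
pose L x y := connected_component V (pt x) (pt y).
have ptV x : cell_occupied w x -> V (pt x).
  by move=> /ptP[h _]; apply: ball_sub_trunc_voronoi h _; rewrite subrr enorm0.
have lk n : forall x y, backbone (cell_occupied w) n (0, 0)%N x ->
    backbone (cell_occupied w) n (0, 0)%N y -> L x y.
  have := (@good_linked (cell_occupied w) L _ _ _ _ n).1 (0, 0)%N (g n).
  apply.
  - by move=> x /ptV; exact: connected_component_refl.
  - by move=> x y; exact: connected_component_sym.
  - by move=> x y z; exact: connected_component_trans.
  - move=> x y /ptP[x1 x2] /ptP[y1 y2] xy; apply: close_points => //.
    by apply: le_trans bN; exact: adjacent_cells xy.
have b00 n : backbone (cell_occupied w) n (0, 0)%N (0, 0)%N.
  by elim: n => // n IH; exists (ord0, ord0) => //; exact: g.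
exists (pt (0, 0)%N); first by apply: ptV; exact: (g 0%N).
move=> [M [_ /(_ (M + 1))]]; rewrite ltrDl => /(_ ltr01) hM.
pose n := Num.bound `|M + 1|.
have [y yb yn] := backbone_far (g n.+1).
have oy : cell_occupied w y by exact: backbone_occ (g n.+1) yb.
have := hM (pt y) (lk n.+1 _ _ (b00 _) yb); apply/negP; rewrite -ltNge.
apply: (@lt_le_trans _ _ n%:R).
  by apply: le_lt_trans (ler_norm _) _; exact: archi_boundP.
apply: (@le_trans _ _ (pt y ord0 k0)); last first.
  by apply: le_trans (coord_le_norm _ k0); exact: ler_norm.
have := (ptP y oy).2 k0; rewrite mxE eqxx => /andP[+ _]; apply: le_trans.
rewrite -natrM ler_nat; apply: leq_trans (leq_pmull _ b0); apply: leq_trans yn.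
by rewrite -[leqLHS]muln1 leq_mul// ltnW// ltn_expl.
Qed.

Hypothesis b_large : 81 * expR (- b%:R ^+ d) <= 2^-1 :> R.

Lemma prob_all_good N : d%:R * (2 * b%:R) <= N%:R :> R ->
  measurable [set w | percolates (trunc_voronoi N (eta w) 1)] ->
  (0 < P [set w | percolates (trunc_voronoi N (eta w) 1)])%E.
Proof.
move=> bN mperc.
pose A (u : seq (nat * nat)) := [set w | all (fun x => ~~ cell_occupied w x) u].
pose U n := \big[setU/set0]_(u <- witnesses n (0, 0)%N) A u.
have mA u : measurable (A u) by exact: measurable_vacant.
have mU n : measurable (U n) by apply: bigsetU_measurable.
pose q : R := expR (- b%:R ^+ d).
have PU n : (P (U n) <= (2^-1 / (2 ^ n.+1)%:R)%:E)%E.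
  apply: (@le_trans _ _ (\sum_(u <- witnesses n (0, 0)%N) P (A u))%E).
    rewrite /U; elim: (witnesses n _) => [|u l IH]; first by rewrite !big_nil measure0.
    rewrite !big_cons; apply: le_trans (measureU2 _ _ _) _ => //.
      by apply: bigsetU_measurable.
    by rewrite leeD2l.
  apply: (@le_trans _ _ (\sum_(u <- witnesses n (0, 0)%N) (q ^+ (2 ^ n))%:E)%E).
    rewrite big_seq [leRHS]big_seq; apply: lee_sum => u /witnessesP[su uu _].
    by rewrite prob_cells_vacant// su.
  rewrite sumEFin lee_fin big_const_seq count_predT iter_addr_0 -[_ *+ size _]mulr_natr.
  by apply: witness_bound => //; [exact: expR_ge0|exact: size_witnesses].
have PX : (P (\bigcup_n U n) <= (2^-1)%:E)%E.
  apply: (@le_trans _ _ (\sum_(0 <= n <oo) P (U n))%E).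
    by apply: measure_sigma_subadditive => //; exact: bigcup_measurable.
  apply: (@le_trans _ _ (\sum_(0 <= n <oo) (2^-1 / (2 ^ n.+1)%:R)%:E)%E).
    by apply: lee_nneseries => // n _; exact: PU.
  exact: epsilon_trick0.
apply: (@lt_le_trans _ _ (P (~` \bigcup_n U n))).
  rewrite probability_setC; last exact: bigcup_measurable.
  rewrite sube_gt0; apply: le_lt_trans PX _; rewrite lte_fin; lra.
apply: le_measure; rewrite ?inE//; first by apply/measurableC/bigcup_measurable.
move=> w h; apply: good_percolates => // n; apply/negPn/negP => /bad_witness[u uW ua].
by apply: h; exists n => //; rewrite /U -bigcup_seq; exists u.
Qed.

End cells.

Lemma cvge_from_above {R : realType} (f : nat -> \bar R) (l : \bar R) : l != -oo%E ->
  (forall N, (0 < N)%N -> (l <= f N)%E) ->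
  (forall u : R, (l < u%:E)%E -> exists M, forall N, (M <= N)%N -> (f N <= u%:E)%E) ->
  f @ \oo --> l.
Proof.
case: l => [l||] // _ lf fu; last first.
  apply: cvg_near_cst; exists 1%N => // N /= N0; apply/eqP; rewrite eq_le leey; exact: lf.
have near e : 0 < e -> exists2 M, (0 < M)%N & forall N, (M <= N)%N -> (l%:E <= f N <= (l + e)%:E)%E.
  move=> e0; have [|M hM] := fu (l + e); first by rewrite lte_fin ltrDl.
  exists (maxn M 1) => [|N]; rewrite ?leq_max ?orbT// geq_max => /andP[MN N1].
  by rewrite lf// hM.
apply/fine_cvgP; split.
  have [M M0 hM] := near 1 ltr01; exists M => // N /= /hM /andP[h1 h2].
  by rewrite fin_numE; move: h1 h2; case: (f N).
apply/cvgrPdist_le => e e0; have [M M0 hM] := near e e0; exists M => // N /hM /=.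
case: (f N) => [x||] //; last by rewrite leye_eq andbF.
rewrite /= !lee_fin ler_distl => /andP[h1 h2]; apply/andP; split; lra.
Qed.

(** * Critical points *)

Section monotonicity.
Context {R : realType} {d : nat}.
Implicit Types (E : set ('rV[R]_d * R)) (A B : set 'rV[R]_d).

Lemma dist_to_subset y A B : A `<=` B -> (dist_to y B <= dist_to y A)%E.
Proof. by move=> AB; apply: le_ereal_inf_tmp => _ [x Ax <-]; apply: ereal_inf_lbound; exists x => //; exact: AB. Qed.

Lemma trunc_voronoi_sub N E p : (0 < N)%N -> trunc_voronoi N E p `<=` voronoi E p.
Proof.
move=> N0 y; rewrite /trunc_voronoi /voronoi /= le_min => /andP[h _]; apply: le_trans h _.
apply: dist_to_subset; rewrite trunc_closed_pointsE; exact: sub_truncate.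
Qed.

End monotonicity.

Section critical_points.
Context {R : realType} {d : nat} {dT : measure_display} {T : measurableType dT}.
Variables (P : probability T R) (eta : T -> set ('rV[R]_d * R)).
Hypothesis eta_poisson : poisson_process P ([set: 'rV[R]_d] `*` `[0, 1])
  (lebesgue_rV d \x @lebesgue_measure R)%E eta.

Lemma trunc_percolates_one : (1 < d)%N -> exists N1 : nat, forall N, (N1 <= N)%N ->
  (0 < P [set w | percolates (trunc_voronoi N (eta w) 1)])%E.
Proof.
move=> d1; have d0 : (0 < d)%N by exact: ltnW.
pose k0 := Ordinal d0; pose k1 := Ordinal d1.
(* Side 200 makes 81 e^(- 200^d) at most 1/2; [N] must then exceed 400 d, the bound on the distance
   between points of adjacent cells. *)
exists (2 * d * 200)%N => N hN.
have N0 : (0 < N)%N by apply: leq_trans hN; rewrite !muln_gt0 d0.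
apply: (@prob_all_good R d dT T P eta eta_poisson 200 k0 k1) => //.
- have h : 200 <= 200%:R ^+ d :> R.
    by rewrite -natrX ler_nat -[leqLHS]expn1 leq_exp2l.
  have h0 : 0 <= 200%:R ^+ d :> R by rewrite exprn_ge0.
  apply: (@le_trans _ _ (81 * (1 + 200%:R ^+ d)^-1)).
    by rewrite ler_wpM2l// expRN_le.
  by rewrite ler_pdivrMr; lra.
- by rewrite -!natrM ler_nat; apply: leq_trans hN; rewrite mulnA [(d * 2)%N]mulnC.
- by apply: (measurable_percolates_trunc_voronoi eta_poisson) => //; rewrite ler01 lexx.
Qed.

(** By countable additivity, for some [r] the ball of radius [r] is connected to all larger spheres
    with positive probability. This number bounds from below all connection probabilities of V_N
    from that ball, hence the probability of their limit superior. *)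
Lemma percolates_comparison (p q : R) (N : nat) : (0 < d)%N -> (0 < N)%N ->
  0 <= p <= 1 -> 0 <= q <= 1 ->
  (forall r s : R, 0 <= s -> r <= s -> (P [set w | connects r s (voronoi (eta w) p)] <=
    P [set w | connects r s (trunc_voronoi N (eta w) q)])%E) ->
  (0 < P [set w | percolates (voronoi (eta w) p)])%E ->
  (0 < P [set w | percolates (trunc_voronoi N (eta w) q)])%E.
Proof.
move=> d0 N0 p01 q01 cmp pp.
pose G (r : nat) := \bigcap_(s in [set s : nat | (r < s)%N]) [set w | connects r%:R s%:R (voronoi (eta w) p)].
have mG r : measurable (G r).
  apply: bigcap_measurableType => s rs.
  by apply: (measurable_connects_voronoi eta_poisson) => //; rewrite ler_nat ltnW.
have [r Gr] : exists r, (0 < P (G r))%E.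
  apply: contrapT => /forallNP G0.
  suff : (P [set w | percolates (voronoi (eta w) p)] <= 0)%E by rewrite leNgt pp.
  apply: (@le_trans _ _ (\sum_(0 <= r <oo) P (G r))%E).
    apply: measure_sigma_subadditive => //; first exact: (measurable_percolates_voronoi eta_poisson).
    by move=> w /(percolatesP (@closed_voronoi R d (eta w) p))[r rs]; exists r.
  rewrite eseries0// => r _ _; apply/eqP; rewrite eq_le measure_ge0 andbT leNgt.
  by apply/negP; exact: G0.
apply: (lt_le_trans Gr).
apply: (@le_measure_io R dT T P _ (fun s => [set w | connects r%:R (r + s.+1)%:R (trunc_voronoi N (eta w) q)])).
- by move=> s; apply: (measurable_connects_trunc_voronoi eta_poisson) => //; rewrite ler_nat leq_addr.
- exact: (measurable_percolates_trunc_voronoi eta_poisson).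
- move=> s; have le : r%:R <= (r + s.+1)%:R :> R by rewrite ler_nat leq_addr.
  apply: (@le_trans _ _ (P [set w | connects r%:R (r + s.+1)%:R (voronoi (eta w) p)])); last exact: cmp.
  apply: le_measure; rewrite ?inE//; first exact: (measurable_connects_voronoi eta_poisson).
  by move=> w; apply; rewrite /= -[ltnLHS]addn0 ltn_add2l.
- move=> w h; apply/percolatesP; first exact: closed_trunc_voronoi.
  exists r => s rs; have [n sn] := h s; apply: connects_le.
  by rewrite !ler_nat ltnW//= (leq_trans sn)// (leq_trans (leqnSn n))// leq_addl.
Qed.

Lemma critical_point_ge0 (V : R -> T -> set 'rV[R]_d) : (0 <= critical_point P V)%E.
Proof. by apply: le_ereal_inf_tmp => _ [p [/andP[p0 _] _] <-]; rewrite lee_fin. Qed.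

Lemma critical_point_le (V : R -> T -> set 'rV[R]_d) p : 0 <= p <= 1 ->
  (0 < P [set w | percolates (V p w)])%E -> (critical_point P V <= p%:E)%E.
Proof. by move=> p01 h; apply: ereal_inf_lbound; exists p. Qed.

Lemma cvg_critical_point : (1 < d)%N ->
  critical_point P (fun p w => trunc_voronoi N (eta w) p) @[N --> \oo] -->
    critical_point P (fun p w => voronoi (eta w) p).
Proof.
move=> d1; have d0 : (0 < d)%N by exact: ltnW.
apply: cvge_from_above.
- by apply/eqP => h; have := critical_point_ge0 (fun p w => voronoi (eta w) p); rewrite h.
- move=> N N0; apply: le_ereal_inf_tmp => _ [p [p01 pp] <-]; apply: critical_point_le => //.
  apply: (lt_le_trans pp); apply: le_measure; rewrite ?inE.
  + exact: (measurable_percolates_trunc_voronoi eta_poisson).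
  + exact: (measurable_percolates_voronoi eta_poisson).
  + by move=> w; apply: percolates_mono; exact: trunc_voronoi_sub.
- move=> u /ereal_inf_lt[_ [p [p01 pp] <-]]; rewrite lte_fin => pu.
  have /andP[p0 p1] := p01.
  (* At p = 1 there is no room to add [eps]; percolation of the Boolean model takes over. *)
  have [p_1|p_1] := ltP p 1; last first.
    have [N1 hN1] := trunc_percolates_one d1; exists N1 => N /hN1 h.
    apply: (@le_trans _ _ 1%:E); last by rewrite lee_fin; exact: le_trans (ltW pu).
    by apply: critical_point_le => //; rewrite ler01 lexx.
  pose eps := Num.min (u - p) (1 - p).
  have eps0 : 0 < eps by rewrite lt_min !subr_gt0 pu.
  have eps1 : p + eps <= 1 by rewrite -lerBrDl ge_min lexx orbT.
  have epsu : p + eps <= u by rewrite -lerBrDl ge_min lexx.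
  have [N0 N00 hN] := connection_comparison eta_poisson d0 eps0.
  have [M hM] := eventually_large N0; exists M => N /hM/hN[NN cmp].
  apply: (@le_trans _ _ (p + eps)%:E); last by rewrite lee_fin.
  have q01 : 0 <= p + eps <= 1 by rewrite eps1 addr_ge0// ltW.
  apply: critical_point_le => //; apply: (percolates_comparison d0 NN p01 q01) pp => r s s0 rs.
  exact: cmp.
Qed.

End critical_points.

Theorem theorem3p3 (R : realType) (d : nat) (d_ge3 : (3 <= d)%N)
    (dT : measure_display) (T : measurableType dT) (P : probability T R)
    (eta : T -> set ('rV[R]_d * R))
    (eta_poisson : poisson_process P ([set: 'rV[R]_d] `*` `[0, 1])
       (lebesgue_rV d \x @lebesgue_measure R)%E eta) :
  (forall eps : R, 0 < eps ->
    exists2 N0 : R, 0 < N0 &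
      forall N : nat, N0 <= N%:R ->
      forall p : R, 2 * eps <= p <= 1 - 2 * eps ->
      forall r s : R, 1 <= r -> r < s ->
      (P [set w | connects r s (voronoi (eta w) p)] <=
       P [set w | connects r s (trunc_voronoi N (eta w) (p + eps))])%E) /\
  critical_point P (fun p w => trunc_voronoi N (eta w) p) @[N --> \oo] -->
    critical_point P (fun p w => voronoi (eta w) p).
Proof.
have d0 : (0 < d)%N by exact: leq_trans d_ge3.
split; last by apply: cvg_critical_point => //; exact: leq_trans d_ge3.
move=> eps eps0; have [N0 N00 hN] := connection_comparison eta_poisson d0 eps0.
exists N0 => // N /hN[_ cmp] p /andP[p0 p1] r s r1 rs; apply: cmp; try lra.
Qed.
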